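(* Let $\rho\in(0,1)$ and let $u_0:[0,1]\to[0,1]$ be differentiable with bounded derivative. Assume that $u_0(0)=u_0(1)=\rho$ and that $u_0(x)\in(0,1)$ for every $x\in[0,1]$. For $\ell\in\mathbb N=\{1,2,\dots\}$ let $c_\ell(u_0):=\sqrt2\int_0^1 (u_0(x)-\rho)\sin(\pi\ell x)\,dx$, assume that some $c_\ell(u_0)$ is non-zero, and let $\ell_0\in\mathbb N$ be the smallest integer such that $c_{\ell_0}(u_0)\neq 0$. Then, for every $b\in\mathbb R$, $$\lim_{n\to\infty} D_n\big(t^n(b);\nu_0^n\big)=\mathcal G(\gamma e^{-b}),$$ where $$t^n(b):=\frac{1}{2\pi^2\ell_0^2}\log n+\frac{b}{\pi^2\ell_0^2}\quad\text{and}\quad \gamma:=\frac{|c_{\ell_0}(u_0)|}{\sqrt{\rho(1-\rho)}}.$$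
   Context: For $n\in\{2,3,\dots\}$ let $\Lambda_n:=\{1,\dots,n-1\}$ and $\Omega_n:=\{0,1\}^{\Lambda_n}$. For $\eta\in\Omega_n$, $\eta^{x,y}$ denotes the configuration obtained from $\eta$ by exchanging the values $\eta(x)$ and $\eta(y)$, and $\eta^x$ the configuration obtained by replacing $\eta(x)$ by $1-\eta(x)$. For $f:\Omega_n\to\mathbb R$ put $\nabla_{x,y}f(\eta)=f(\eta^{x,y})-f(\eta)$ and $\nabla_xf(\eta)=f(\eta^x)-f(\eta)$. The symmetric simple exclusion process with reservoir density $\rho$ is the continuous-time Markov chain $\{\eta_t: t\ge0\}$ on $\Omega_n$ with generator $$\mathfrak L_nf(\eta)=n^2\sum_{x=1}^{n-2}\nabla_{x,x+1}f(\eta)+n^2\sum_{x\in\{1,n-1\}}\big(\rho(1-\eta(x))+(1-\rho)\eta(x)\big)\nabla_xf(\eta).$$ For $u:\Lambda_n\to[0,1]$ let $\nu^n_{u(\cdot)}(\eta):=\prod_{x\in\Lambda_n}\{\eta(x)u(x)+(1-\eta(x))(1-u(x))\}$ be the Bernoulli product measure with density $u$. Let $\bar\nu^n_\rho$ be the Bernoulli product measure with constant density $\rho$; it is the unique invariant measure of the chain. Given $u_0:[0,1]\to[0,1]$, let $\nu_0^n$ be the Bernoulli product measure on $\Omega_n$ with density $x\mapsto u_0(x/n)$. Let $\mu_t^n$ be the law of $\eta_t$ when the chain starts from $\nu_0^n$, and set $D_n(t;\nu_0^n):=\|\mu_t^n-\bar\nu^n_\rho\|_{\mathrm{TV}}$,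 where $\|\mu-\nu\|_{\mathrm{TV}}=\frac12\sum_{\eta}|\mu(\eta)-\nu(\eta)|$. For fixed $b$, $t^n(b)\ge0$ for all $n$ large enough. The function $\mathcal G:\mathbb R\to[0,1]$ is the total variation distance between Gaussian laws, $\mathcal G(m):=\|\mathcal N(m,1)-\mathcal N(0,1)\|_{\mathrm{TV}}=\frac12\mathbb E\big[\big|e^{mX-m^2/2}-1\big|\big]$ with $X\sim\mathcal N(0,1)$. *)

(* Defs.v *)
From HB Require Import structures.
From mathcomp Require Import all_boot all_order all_algebra all_fingroup.
From mathcomp Require Import all_classical all_reals all_analysis.

Set Implicit Arguments.
Unset Strict Implicit.
Unset Printing Implicit Defensive.

Import Order.TTheory GRing.Theory Num.Theory.
Import numFieldNormedType.Exports.

Local Open Scope classical_set_scope.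
Local Open Scope ring_scope.

Section Chain.
Context {R : realType}.

(** The index [x : Lambda n] stands for the site [site x] of {1, ..., n-1}. *)
Definition Lambda (n : nat) : finType := 'I_n.-1.

Definition site (n : nat) (x : Lambda n) : nat := x.+1.

Definition Omega (n : nat) : finType := {ffun Lambda n -> bool}.

Definition occ (n : nat) (eta : Omega n) (x : Lambda n) : R := (eta x)%:R.

Definition exchange (n : nat) (x y : Lambda n) (eta : Omega n) : Omega n :=
  [ffun z => eta (tperm x y z)].

Definition flip (n : nat) (x : Lambda n) (eta : Omega n) : Omega n :=
  [ffun z => if z == x then ~~ eta z else eta z].

Definition nabla2 (n : nat) (x y : Lambda n) (f : Omega n -> R) : Omega n -> R :=
  fun eta => f (exchange x y eta) - f eta.

Definition nabla1 (n : nat) (x : Lambda n) (f : Omega n -> R) : Omega n -> R :=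
  fun eta => f (flip x eta) - f eta.

(** In the boundary sum {1, n-1} is a set: for n = 2 its only site counts
    once. *)
Definition generator (rho : R) (n : nat) (f : Omega n -> R) : Omega n -> R :=
  fun eta =>
    n%:R ^+ 2 * (\sum_(x : Lambda n) \sum_(y : Lambda n | site y == (site x).+1)
                   nabla2 x y f eta)
  + n%:R ^+ 2 * (\sum_(x : Lambda n | (site x == 1%N) || (site x == n.-1))
                   (rho * (1 - occ eta x) + (1 - rho) * occ eta x)
                   * nabla1 x f eta).

(** [exp (t L)] applied to [f]; on a finite state space this is the transition
    semigroup of the continuous-time Markov chain with generator [L]:
    [semigroup L t f x] is the expectation of [f (eta_t)] when [eta_0 = x]. *)
Definition semigroup (T : finType) (L : (T -> R) -> (T -> R)) (t : R)
    (f : T -> R) (x : T) : R :=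
  limn (series (fun k : nat => t ^+ k / k`!%:R * iter k L f x)).

Definition law_at (T : finType) (L : (T -> R) -> (T -> R)) (mu0 : T -> R)
    (t : R) (y : T) : R :=
  \sum_(x : T) mu0 x * semigroup L t (fun z => (z == y)%:R) x.

Definition bernoulli_product (n : nat) (u : Lambda n -> R) (eta : Omega n) : R :=
  \prod_(x : Lambda n) (occ eta x * u x + (1 - occ eta x) * (1 - u x)).

Definition stationary (rho : R) (n : nat) : Omega n -> R :=
  bernoulli_product (fun=> rho).

Definition initial (u0 : R -> R) (n : nat) : Omega n -> R :=
  bernoulli_product (fun x : Lambda n => u0 ((site x)%:R / n%:R)).

Definition tv_fin (T : finType) (mu nu : T -> R) : R :=
  2^-1 * \sum_(x : T) `|mu x - nu x|.

Definition D (rho : R) (u0 : R -> R) (n : nat) (t : R) : R :=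
  tv_fin (law_at (@generator rho n) (@initial u0 n) t) (@stationary rho n).

End Chain.

Section Profile.
Context {R : realType}.

(** Differentiability on the closed interval [0, 1], one-sided at 0 and 1:
    only the values of [u0] on [0, 1] matter. *)
Definition has_derivative01 (u0 du0 : R -> R) : Prop :=
  forall x, x \in `[0, 1] ->
    (u0 y - u0 x) / (y - x) @[y --> within (`[0, 1]%classic : set R) x^']
      --> du0 x.

Definition bounded_derivative01 (u0 : R -> R) : Prop :=
  exists (du0 : R -> R) (M : R), has_derivative01 u0 du0 /\
    forall x, x \in `[0, 1] -> `|du0 x| <= M.

Definition coef (rho : R) (u0 : R -> R) (l : nat) : R :=
  Num.sqrt 2 *
  \int[lebesgue_measure]_(x in `[0, 1]) ((u0 x - rho) * sin (pi * l%:R * x)).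

End Profile.

Section Gaussian.
Context {R : realType}.

(** For laws on a finite set this is half the l1-distance [tv_fin]. *)
Definition tv (d : measure_display) (T : measurableType d)
    (P Q : probability T R) : R :=
  sup [set `|fine (P A) - fine (Q A)| | A in (measurable : set (set T))].

Definition G (m : R) : R := tv (normal_prob m 1) (normal_prob 0 1).

End Gaussian.

Definition cutoff_time {R : realType} (l0 : nat) (b : R) (n : nat) : R :=
  ln n%:R / (2 * pi ^+ 2 * l0%:R ^+ 2) + b / (pi ^+ 2 * l0%:R ^+ 2).

(* Main.v *)
(** Idea. Let [u t] solve the discrete heat equation with boundary value [rho]
    started from the initial profile.

    The law at time [t] is compared with the product measure of density
    [u t x]. In the derivative of the relative entropy everything cancels
    except the Dirichlet form and the two-point correlations of neighbours
    weighted by the squared discrete gradient of [u]. A maximum principle for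
    the duality equation of the two-point function bounds these correlations by
    O(1/n), and a log-Sobolev inequality, obtained by carrying a flip from a
    site to the reservoir, then shows that the entropy is O(exp (- c t)) uniformly
    in [n]. At the diverging time [cutoff_time l0 b n] only the two product
    measures matter.

    The total variation between the product measures of densities [rho + v] and
    [rho] is the price of a call of strike 1 on their likelihood ratio, and a
    Lindeberg replacement driven by the Black-Scholes equation shows that it is
    close to [G m] as soon as [\sum_x v x ^+ 2 / (rho * (1 - rho))] is close to
    [m ^+ 2] and [v] is uniformly small. For the heat profile the sum of squares
    is computed in the sine basis: the modes below [l0] are O(1/n), the modes
    above [l0] have decayed, and mode [l0] gives the limit. *)

Require Import Defs.
From HB Require Import structures.
From mathcomp Require Import all_boot all_order all_algebra all_fingroup.
From mathcomp Require Import all_classical all_reals all_analysis.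
From mathcomp Require Import ring lra.

Set Implicit Arguments.
Unset Strict Implicit.
Unset Printing Implicit Defensive.

Import Order.TTheory GRing.Theory Num.Theory.
Import numFieldNormedType.Exports.

Local Open Scope classical_set_scope.
Local Open Scope ring_scope.

(** The moving product measure is the right reference because, bond by bond, the adjoint of the
    generator applied to it is a polynomial of degree two in the scores [W]. Its linear part is
    exactly the time derivative of the log density when the profile solves the heat equation. The
    quadratic part has weight n^2 (grad u)^2, so correlations of order 1/n leave a multiple of n
    times the sum of (grad u)^2, which is bounded and decays exponentially. Only negative
    correlations can feed the entropy, so a one-sided bound suffices.

    The log-Sobolev inequality concerns an inhomogeneous measure that is not reversible for the
    chain. It is a static statement: transporting a flip uses Young weights 1 + 1/n, so that up to n
    steps cost a bounded factor.

    A call price becomes non-smooth as the volatility tends to 0. The replacement therefore starts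
    from a small volatility, fixed while n grows, whose cost is linear in it.

    All derivatives are two-sided, even at time 0: the semigroup is a power series and the profile
    an explicit sine sum, both meaningful for negative times. *)

Local Notation dv f t l := (is_derive t 1 f l).

(** * Derivatives and differential inequalities *)

Section Calculus.
Context {R : realType}.
Implicit Types (f g y : R -> R) (t a b : R).

Lemma dv_eq f t a b : dv f t a -> a = b -> dv f t b.
Proof. by move=> ? <-. Qed.

Lemma dv_ext f g t a : f =1 g -> dv f t a -> dv g t a.
Proof. by move=> /funext ->. Qed.

Lemma dvc (c t : R) : dv (fun=> c) t 0.
Proof. exact: is_derive_cst. Qed.

Lemma dvid t : dv (fun s : R => s) t 1.
Proof. exact: is_derive_id. Qed.

Lemma dvD f g t a b : dv f t a -> dv g t b -> dv (fun s => f s + g s) t (a + b).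
Proof. exact: is_deriveD. Qed.

Lemma dvN f t a : dv f t a -> dv (fun s => - f s) t (- a).
Proof. exact: is_deriveN. Qed.

Lemma dvB f g t a b : dv f t a -> dv g t b -> dv (fun s => f s - g s) t (a - b).
Proof. exact: is_deriveB. Qed.

Lemma dvM f g t a b :
  dv f t a -> dv g t b -> dv (fun s => f s * g s) t (a * g t + f t * b).
Proof.
move=> ha hb; apply: (@dv_eq (fun s => f s * g s) _ _ _ (is_deriveM ha hb)).
by rewrite /GRing.scale /=; ring.
Qed.

Lemma dvZ (c : R) f t a : dv f t a -> dv (fun s => c * f s) t (c * a).
Proof. by move=> h; apply: (dv_eq (dvM (dvc c t) h)); ring. Qed.

Lemma dv_comp f g t a b : dv f (g t) a -> dv g t b -> dv (fun s => f (g s)) t (a * b).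
Proof. exact: is_derive1_comp. Qed.

Lemma dv_exp f t a : dv f t a -> dv (fun s => expR (f s)) t (expR (f t) * a).
Proof. by move=> h; apply: (dv_comp (f := expR)). Qed.

Lemma dv_ln f t a : 0 < f t -> dv f t a -> dv (fun s => ln (f s)) t (a / f t).
Proof.
move=> f0 h; rewrite mulrC; apply: (dv_comp (f := @ln R)) h.
exact: is_derive1_ln.
Qed.

Lemma dvV f t a : f t != 0 -> dv f t a -> dv (fun s => (f s)^-1) t (- a / f t ^+ 2).
Proof.
move=> f0 h; apply: (@dv_eq (fun s => (f s)^-1) _ _ _ (is_deriveV f0 h)).
by rewrite /GRing.scale /=; ring.
Qed.

Lemma dv_sqrt f t a : 0 < f t -> dv f t a ->
  dv (fun s => Num.sqrt (f s)) t (a / (2 * Num.sqrt (f t))).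
Proof.
move=> f0 h; rewrite mulrC; apply: (dv_comp (f := Num.sqrt)) h.
exact: is_derive1_sqrt.
Qed.

Lemma dv_sum (I : Type) (r : seq I) (P : pred I) (F : I -> R -> R) (dF : I -> R) t :
  (forall i, dv (F i) t (dF i)) ->
  dv (fun s => \sum_(i <- r | P i) F i s) t (\sum_(i <- r | P i) dF i).
Proof.
move=> h; elim: r => [|i r ih].
  rewrite big_nil; apply: dv_ext (dvc 0 t) => s; by rewrite big_nil.
rewrite big_cons; case: ifP => hi.
- by apply: dv_ext (dvD (h i) ih) => s; rewrite big_cons hi.
- by apply: dv_ext ih => s; rewrite big_cons hi.
Qed.

Lemma dv_continuous f t a : dv f t a -> {for t, continuous f}.
Proof. by move=> [h _]; apply: differentiable_continuous; apply/derivable1_diffP. Qed.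

Lemma mvt f (df : R -> R) a b : a <= b ->
  (forall x, a <= x <= b -> dv f x (df x)) ->
  exists2 c, a <= c <= b & f b - f a = df c * (b - a).
Proof.
move=> ab h.
have [||c] := @MVT_segment R f df a b ab.
- by move=> x; rewrite in_itv /= => /andP[/ltW ? /ltW ?]; apply: h; apply/andP.
- apply: derivable_within_continuous => x; rewrite in_itv /= => /h.
  by case.
- by rewrite in_itv /= => hc e; exists c.
Qed.

Lemma mvt_lip f (df : R -> R) a b K : a <= b ->
  (forall x, a <= x <= b -> dv f x (df x)) ->
  (forall x, a <= x <= b -> `|df x| <= K) ->
  `|f b - f a| <= K * (b - a).
Proof.
move=> ab h hK; have [c hc ->] := mvt ab h.
rewrite normrM [`|b - a|]ger0_norm ?subr_ge0//.
by rewrite ler_wpM2r ?subr_ge0// hK.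
Qed.

Lemma dv_le f (df : R -> R) a b : a <= b ->
  (forall x, a <= x <= b -> dv f x (df x)) ->
  (forall x, a <= x <= b -> df x <= 0) -> f b <= f a.
Proof.
move=> ab h hK; have [c hc e] := mvt ab h.
by rewrite -subr_le0 e mulr_le0_ge0 ?subr_ge0// hK.
Qed.

Lemma gronwall y (dy : R -> R) K :
  (forall t, 0 <= t -> dv y t (dy t)) ->
  (forall t, 0 <= t -> dy t <= K * y t) ->
  forall t, 0 <= t -> y t <= expR (K * t) * y 0.
Proof.
move=> h hK t t0.
have : expR (- K * t) * y t <= expR (- K * 0) * y 0.
  apply: (dv_le (f := fun s => expR (- K * s) * y s)
    (df := fun s => (expR (- K * s) * (- K * 1)) * y s + expR (- K * s) * dy s)) t0 _ _.
  - move=> x /andP[x0 _].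
    exact: (dvM (dv_exp (dvZ _ (dvid _))) (h _ x0)).
  - move=> x /andP[x0 _].
    rewrite mulr1 -mulrA -mulrDr mulr_ge0_le0 ?expR_ge0//.
    by rewrite mulNr addrC subr_le0 hK.
rewrite mulr0 expR0 mul1r => hh.
have -> : y t = expR (K * t) * (expR (- K * t) * y t).
  by rewrite mulrA -expRD mulNr subrr expR0 mul1r.
by rewrite ler_wpM2l ?expR_ge0.
Qed.

(** A first-order expansion with quadratic error suits functions defined by cases, where the
    differentiation rules do not apply across the break. *)
Lemma dv_quad f t l C :
  (forall h, `|f (t + h) - f t - h * l| <= C * h ^+ 2) -> dv f t l.
Proof.
move=> hf.
have hC : 0 <= C.
  by have := hf 1; rewrite expr1n mulr1; apply: le_trans.
have cv : h^-1 *: (f (h *: (1:R) + t) - f t) @[h --> (0:R)^'] --> l.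
  apply/cvgrPdist_le => /= e e0; near=> h.
  have h0 : h != 0 by near: h; exact: nbhs_dnbhs_neq.
  have hh : `|h| <= e / (C + 1).
    near: h; apply: dnbhs0_le; rewrite divr_gt0//; lra.
  rewrite /GRing.scale /= mulr1 [h + t]addrC.
  have -> : l - h^-1 * (f (t + h) - f t) = - h^-1 * (f (t + h) - f t - h * l).
    by field.
  rewrite normrM normrN normfV ler_pdivrMl ?normr_gt0//.
  apply: le_trans (hf h) _.
  rewrite -real_normK ?num_real// expr2 mulrCA ler_wpM2l//.
  apply: (@le_trans _ _ ((C + 1) * `|h|)); first by rewrite ler_wpM2r//; lra.
  by rewrite -ler_pdivlMl ?[(_^-1) * _]mulrC//; lra.
apply: DeriveDef; first by apply/cvg_ex; exists l.
exact: cvg_lim.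
Unshelve. all: by end_near.
Qed.

(** Squaring removes the kink at 0: in every sign case the first-order expansion has error at most
    h^2. *)
Lemma dv_neg_part_sqr (x : R) : dv (fun z => (Num.min z 0) ^+ 2) x (2 * Num.min x 0).
Proof.
apply: (@dv_quad _ _ _ 1) => h; rewrite ler_norml; apply/andP.
by rewrite /Num.min; case: ifP => h1; case: ifP => h2;
  move: h1 h2 => /=; rewrite ?ltNge => h1 h2; split; nra.
Qed.

End Calculus.

Section Comparison.
Context {R : realType}.

(* Maximum principle: the hypothesis on [dz] is quasi-positivity of the
   vector field, and the energy [\sum_i (min (z i) 0)^2] satisfies a
   Gronwall inequality. *)
Lemma comparison (T : finType) (K : R) (z dz : R -> T -> R) :
  0 <= K ->
  (forall (t : R) i, 0 <= t -> dv (z ^~ i) t (dz t i)) ->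
  (forall (t : R) i B, 0 <= t -> (forall j, - B <= z t j) -> z t i <= 0 ->
     - (K * B) <= dz t i) ->
  (forall i, 0 <= z 0 i) ->
  forall (t : R) i, 0 <= t -> 0 <= z t i.
Proof.
move=> K0 hz hdz h0 t i t0.
pose m s j := Num.min (z s j) 0.
have m0 s j : m s j <= 0 by rewrite /m ge_min lexx orbT.
have E0 : \sum_j m t j ^+ 2 <= expR (2 * K * #|T|%:R * t) * (\sum_j m 0 j ^+ 2).
  apply: (gronwall (y := fun s => \sum_j m s j ^+ 2)
     (dy := fun s => \sum_j 2 * m s j * dz s j)) t0.
  - move=> s s0; apply: dv_sum => j.
    exact: (dv_comp (f := fun z => (Num.min z 0) ^+ 2) (dv_neg_part_sqr _) (hz _ _ s0)).
  (* The total negative mass serves as the common lower bound on the coordinates; unlike a maximum,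
     it compares directly with the sum of squares. *)
  - move=> s s0; pose B := \sum_j - m s j.
    have B0 j : - m s j <= B.
      rewrite /B (bigD1 j)//= lerDl sumr_ge0// => k _; by rewrite oppr_ge0.
    have hB j : - B <= z s j.
      by rewrite lerNl; apply: le_trans (B0 j); rewrite lerN2 /m ge_min lexx.
    have Bge0 : 0 <= B by rewrite sumr_ge0// => k _; rewrite oppr_ge0.
    have h1 : \sum_j 2 * m s j * dz s j <= 2 * K * B * B.
      have -> : 2 * K * B * B = \sum_j 2 * (- m s j) * (K * B).
        by rewrite -mulr_suml -mulr_sumr -/B; ring.
      apply: ler_sum => j _.
      have [zj|zj] := leP (z s j) 0; last first.
        have -> : m s j = 0 by rewrite /m; apply/min_idPr; exact: ltW.
        lra.
      have := hdz s j B s0 hB zj; have := m0 s j; nra.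
    apply: le_trans h1 _.
    (* Cauchy-Schwarz, read off from the nonnegative double sum of (m_j - m_k)^2. *)
    have hcs : B * B <= #|T|%:R * \sum_j m s j ^+ 2.
      have h2 : 0 <= \sum_j \sum_k (m s j - m s k) ^+ 2.
        by apply: sumr_ge0 => j _; apply: sumr_ge0 => k _; exact: sqr_ge0.
      have e2 : \sum_j \sum_k (m s j - m s k) ^+ 2 =
         2 * (#|T|%:R * \sum_j m s j ^+ 2) - 2 * (B * B).
        transitivity (\sum_j (#|T|%:R * m s j ^+ 2 + \sum_k m s k ^+ 2
                       - 2 * (- m s j * B))).
          apply: eq_bigr => j _.
          transitivity (\sum_k (m s j ^+ 2 + m s k ^+ 2 - 2 * (- m s j * - m s k))).
            by apply: eq_bigr => k _; ring.
          rewrite sumrB big_split /= sumr_const -mulr_sumr -mulr_sumr -/B.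
          by rewrite mulr_natl.
        rewrite sumrB big_split /= sumr_const -mulr_sumr -mulr_sumr -mulr_suml -/B.
        by rewrite -[(\sum_k _) *+ _]mulr_natl; ring.
      lra.
    have : 2 * K * (B * B) <= 2 * K * (#|T|%:R * \sum_j m s j ^+ 2).
      by rewrite ler_wpM2l// mulr_ge0.
    by rewrite !mulrA.
have z0 : \sum_j m 0 j ^+ 2 = 0.
  apply: big1 => j _; rewrite /m (min_idPr _) ?expr0n//.
rewrite z0 mulr0 in E0.
have : m t i ^+ 2 <= 0.
  apply: le_trans E0; rewrite (bigD1 i)//= lerDl sumr_ge0// => k _; exact: sqr_ge0.
move=> mi.
have : m t i = 0 by apply/eqP; rewrite -sqrf_eq0 eq_le mi sqr_ge0.
by rewrite /m; case: (leP (z t i) 0) => [_ ->|/ltW].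
Qed.

End Comparison.

(** * The semigroup of a finite chain *)

Lemma cvg_bigsum (R : realType) (U : Type) (F : set_system U) (FF : Filter F)
  (I : Type) (r : seq I) (P : pred I) (f : I -> U -> R) (l : I -> R) :
  (forall i, f i x @[x --> F] --> l i) ->
  \sum_(i <- r | P i) f i x @[x --> F] --> \sum_(i <- r | P i) l i.
Proof.
move=> h; elim: r => [|i r ih].
  by rewrite big_nil; under eq_cvg do rewrite big_nil; exact: cvg_cst.
rewrite big_cons; under eq_cvg do rewrite big_cons.
by case: ifP => // _; exact: cvgD.
Qed.

Section Semigroup.
Context {R : realType} {T : finType}.
Variable L : (T -> R) -> (T -> R).
Let ind (z : T) : T -> R := fun x => (x == z)%:R.
Hypothesis linL : forall f x, L f x = \sum_z f z * L (ind z) x.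

Let B : R := \sum_x \sum_z `|L (ind z) x|.

Let B0 : 0 <= B.
Proof. by apply: sumr_ge0 => x _; apply: sumr_ge0 => z _. Qed.

(** [B] sums the absolute values of all matrix entries, so the semigroup series is dominated by an
    exponential series and converges at every time. *)
Let iter_bound k f x : `|iter k L f x| <= B ^+ k * \sum_z `|f z|.
Proof.
elim: k f x => [|k ih] f x.
  by rewrite /= expr0 mul1r (bigD1 x)//= lerDl sumr_ge0.
rewrite iterS linL; apply: le_trans (ler_norm_sum _ _ _) _.
apply: (@le_trans _ _ (\sum_z (B ^+ k * (\sum_z `|f z|)) * `|L (ind z) x|)).
  by apply: ler_sum => z _; rewrite normrM ler_wpM2r.
have -> : B ^+ k.+1 * (\sum_z `|f z|) = (B ^+ k * \sum_z `|f z|) * B.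
  by rewrite exprS; ring.
rewrite -mulr_sumr ler_wpM2l//.
  apply: mulr_ge0; [by apply: exprn_ge0 | by apply: sumr_ge0].
by rewrite /B [leRHS](bigD1 x)//= lerDl sumr_ge0// => y _; exact: sumr_ge0.
Qed.

Let c f x k := iter k L f x / k`!%:R.

Let semigroupE t f x : semigroup L t f x = limn (pseries (c f x) t).
Proof.
congr (limn _); congr series; apply/funext => k; rewrite /c.
by rewrite /=; ring.
Qed.

Let c_cvg f x t : cvgn (pseries (c f x) t).
Proof.
apply: normed_cvg; apply: (@series_le_cvg _ _
  ((\sum_z `|f z|) *: exp_coeff (B * `|t|))).
- by move=> n /=.
- move=> n; rewrite /exp_coeff /GRing.scale /=.
  by rewrite mulr_ge0 ?sumr_ge0// divr_ge0// exprn_ge0// mulr_ge0.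
- move=> n; rewrite /= /c /exp_coeff /GRing.scale /= !normrM normfV normrX.
  rewrite [`|n`!%:R|]ger0_norm// exprMn.
  rewrite [leLHS](_ : _ = `|iter n L f x| * (`|t| ^+ n / n`!%:R)); last by ring.
  rewrite [leRHS](_ : _ = (B ^+ n * \sum_z `|f z|) * (`|t| ^+ n / n`!%:R)); last by rewrite /GRing.scale /=; ring.
  by apply: ler_wpM2r (iter_bound _ _ _); rewrite divr_ge0// exprn_ge0.
- by apply: is_cvg_seriesZ; exact: is_cvg_series_exp_coeff.
Qed.

Let c_diffs f x : pseries_diffs (c f x) = c (L f) x.
Proof.
apply/funext => k; rewrite /pseries_diffs /c iterSr factS natrM.
by field; rewrite nat1r !pnatr_eq0 -lt0n fact_gt0.
Qed.

(** Term-by-term differentiation shifts the coefficients [iter k L f x / k!] to those of [L f], by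
    [c_diffs]. *)
Lemma dv_semigroup f x (t : R) :
  dv (fun s => semigroup L s f x) t (semigroup L t (L f) x).
Proof.
rewrite semigroupE -c_diffs.
have -> : (fun s => semigroup L s f x) = fun s => limn (pseries (c f x) s).
  by apply/funext => s; rewrite semigroupE.
apply: (@pseries_snd_diffs _ _ (`|t| + 1)); rewrite ?c_diffs; try exact: c_cvg.
by rewrite [ltRHS]ger0_norm ?addr_ge0// ltrDl.
Qed.

Lemma semigroup0 f x : semigroup L 0 f x = f x.
Proof.
rewrite semigroupE; apply: cvg_lim => //.
rewrite -(cvg_shiftn 1); apply: cvg_near_cst; near=> n.
rewrite /pseries /series /= addn1 big_nat_recl// /c /= expr0 fact0 divr1 mulr1.
by rewrite big1 ?addr0// => i _; rewrite exprS mul0r mulr0.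
Unshelve. all: by end_near.
Qed.

Lemma semigroup_lin t f x :
  semigroup L t f x = \sum_z f z * semigroup L t (ind z) x.
Proof.
rewrite semigroupE; apply: cvg_lim => //.
have -> : pseries (c f x) t = fun n => \sum_z f z * pseries (c (ind z) x) t n.
  apply/funext => n; rewrite /pseries /series /=.
  under [RHS]eq_bigr do rewrite mulr_sumr.
  rewrite exchange_big /=; apply: eq_bigr => k _.
  have -> : c f x k = \sum_z f z * c (ind z) x k.
    rewrite /c; under eq_bigr do rewrite mulrA.
    rewrite -mulr_suml; congr (_ / _).
    elim: k x => [|k ih] x /=.
      by rewrite (bigD1 x)//= /ind eqxx mulr1 big1 ?addr0// => z /negbTE zx;
         rewrite eq_sym zx mulr0.
    rewrite linL; under [RHS]eq_bigr do rewrite linL mulr_sumr.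
    rewrite exchange_big /=; apply: eq_bigr => z _.
    by rewrite ih mulr_suml; apply: eq_bigr => y _; rewrite mulrA.
  by rewrite mulr_suml; apply: eq_bigr => z _; rewrite mulrA.
apply: cvg_bigsum => z; rewrite semigroupE.
apply: cvgM; first exact: cvg_cst.
exact: c_cvg.
Qed.

Variable mu0 : T -> R.
Let p t y := law_at L mu0 t y.

Lemma law_at0 y : law_at L mu0 0 y = mu0 y.
Proof.
rewrite /law_at (bigD1 y)//= semigroup0 eqxx mulr1 big1 ?addr0// => x xy.
by rewrite semigroup0 (negbTE xy) mulr0.
Qed.

Lemma law_at_mean t F :
  \sum_y law_at L mu0 t y * F y = \sum_x mu0 x * semigroup L t F x.
Proof.
rewrite /law_at; under eq_bigr do rewrite mulr_suml.
rewrite exchange_big /=; apply: eq_bigr => x _.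
rewrite [in RHS]semigroup_lin mulr_sumr; apply: eq_bigr => z _.
by rewrite -mulrA [_ * F z]mulrC.
Qed.

Lemma dv_law_at_mean F (t : R) :
  dv (fun s => \sum_y law_at L mu0 s y * F y) t
     (\sum_y law_at L mu0 t y * L F y).
Proof.
rewrite law_at_mean.
have -> : (fun s => \sum_y law_at L mu0 s y * F y) =
          (fun s => \sum_x mu0 x * semigroup L s F x).
  by apply/funext => s; exact: law_at_mean.
by apply: dv_sum => x; apply: dvZ; exact: dv_semigroup.
Qed.

Lemma dv_law_at (t : R) y :
  dv (fun s => law_at L mu0 s y) t (\sum_z law_at L mu0 t z * L (ind y) z).
Proof.
apply: dv_ext (dv_law_at_mean (ind y) t) => s.
by rewrite (bigD1 y)//= /ind eqxx mulr1 big1 ?addr0// => x /negbTE ->; rewrite mulr0.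
Qed.

Lemma law_at_gt0 :
  (forall x y, x != y -> 0 <= L (ind y) x) -> (forall x, 0 < mu0 x) ->
  forall (t : R) y, 0 <= t -> 0 < law_at L mu0 t y.
Proof.
move=> Lpos mupos t y t0.
(* [expR (- B * t) * mu0] is a subsolution of the forward equation. *)
have LB x z : `|L (ind z) x| <= B.
  rewrite /B (bigD1 x)//= (bigD1 z)//= -addrA lerDl addr_ge0 ?sumr_ge0// => a _.
  exact: sumr_ge0.
suff : 0 <= law_at L mu0 t y - expR (- B * t) * mu0 y.
  rewrite subr_ge0; apply: lt_le_trans; by rewrite mulr_gt0 ?expR_gt0.
pose z (s : R) y := law_at L mu0 s y - expR (- B * s) * mu0 y.
pose dz (s : R) y := \sum_z law_at L mu0 s z * L (ind y) z -
                (expR (- B * s) * (- B * 1)) * mu0 y.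
apply: (@comparison R T (#|T|%:R * B) z dz _ _ _ _ t y t0).
- by rewrite mulr_ge0.
- move=> s x s0; apply: dvB; first exact: dv_law_at.
  apply: (dv_eq (dvM (dv_exp (dvZ (- B) (dvid s))) (dvc (mu0 x) s))).
  by rewrite mulr0 addr0.
- move=> s x b s0 hb hx.
  have b0 : 0 <= b by rewrite -oppr_le0; apply: le_trans (hb x) hx.
  (* The second term is nonnegative: the off-diagonal entries of [L] are, and [B] compensates the
     diagonal one. *)
  have -> : dz s x = \sum_w z s w * L (ind x) w +
      expR (- B * s) * (\sum_w mu0 w * L (ind x) w + B * mu0 x).
    rewrite /dz /z; under [in RHS]eq_bigr do rewrite mulrBl.
    rewrite sumrB mulrDr mulr_sumr mulr1.
    under [\sum_i expR _ * _ * _]eq_bigr do rewrite -mulrA.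
    by ring.
  have h1 : 0 <= \sum_w mu0 w * L (ind x) w + B * mu0 x.
    rewrite (bigD1 x)//= addrAC addr_ge0//.
      rewrite mulrC -mulrDl mulr_ge0 ?(ltW (mupos _))//.
      by have := LB x x; rewrite ler_norml => /andP[]; lra.
    by apply: sumr_ge0 => w wx; rewrite mulr_ge0 ?(ltW (mupos _))// Lpos.
  apply: (@le_trans _ _ (\sum_w z s w * L (ind x) w)); last first.
    by rewrite lerDl mulr_ge0 ?expR_ge0.
  have -> : - (#|T|%:R * B * b) = \sum_(w : T) - (B * b).
    by rewrite sumr_const -[RHS]mulr_natl; ring.
  apply: ler_sum => w _.
  have := LB w x; rewrite ler_norml => /andP[l1 l2].
  have [->|wx] := eqVneq w x.
    have := LB x x; rewrite ler_norml => /andP[l3 l4]; have := hb x; nra.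
  have := Lpos w x wx; have := hb w; nra.
- by move=> x; rewrite /z law_at0 mulr0 expR0 mul1r subrr.
Qed.

End Semigroup.

(** * Product measures and the exclusion dynamics *)

Section BernoulliProduct.
Context {R : realType} {n : nat}.
Implicit Types (u : Lambda n -> R) (x y : Lambda n) (eta : Omega n).

Definition bweight (p : R) (b : bool) : R := if b then p else 1 - p.

Lemma bernoulli_productE u eta :
  bernoulli_product u eta = \prod_x bweight (u x) (eta x).
Proof.
apply: eq_bigr => x _; rewrite /occ /bweight.
by case: (eta x); rewrite ?(subrr, subr0, mul0r, mul1r, addr0, add0r).
Qed.

Lemma flipE x eta z : flip x eta z = if z == x then ~~ eta z else eta z.
Proof. by rewrite /flip ffunE. Qed.

Lemma exchangeE x y eta z : exchange x y eta z = eta (tperm x y z).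
Proof. by rewrite /exchange ffunE. Qed.

Lemma flipK x : involutive (@flip n x).
Proof.
by move=> eta; apply/ffunP => z; rewrite !flipE; case: eqP => // ->; rewrite negbK.
Qed.

Lemma exchangeK x y : involutive (@exchange n x y).
Proof. by move=> eta; apply/ffunP => z; rewrite !exchangeE tpermK. Qed.

Lemma sum_flip x (F : Omega n -> R) : \sum_eta F (flip x eta) = \sum_eta F eta.
Proof. by rewrite [RHS](reindex_inj (inv_inj (flipK x))). Qed.

(** Written without division, so that it holds for every density; a ratio is formed only where
    positivity is at hand. *)
Lemma bernoulli_flip u x eta :
  bernoulli_product u (flip x eta) * bweight (u x) (eta x) =
  bernoulli_product u eta * bweight (u x) (~~ eta x).
Proof.
rewrite !bernoulli_productE (bigD1 x)//= [in RHS](bigD1 x)//= flipE eqxx.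
rewrite (eq_bigr (fun z => bweight (u z) (eta z))); first by ring.
by move=> z /negbTE zx; rewrite flipE zx.
Qed.

Lemma bernoulli_exchange u x y eta : x != y ->
  bernoulli_product u (exchange x y eta) *
    (bweight (u x) (eta x) * bweight (u y) (eta y)) =
  bernoulli_product u eta * (bweight (u x) (eta y) * bweight (u y) (eta x)).
Proof.
move=> xy; have yx : y != x by rewrite eq_sym.
rewrite !bernoulli_productE (bigD1 x)//= (bigD1 y)//=.
rewrite [in RHS](bigD1 x)//= [in RHS](bigD1 y)//=.
rewrite !exchangeE tpermL tpermR.
rewrite (eq_bigr (fun z => bweight (u z) (eta z))); first by ring.
by move=> z /andP[zx zy]; rewrite exchangeE tpermD// eq_sym.
Qed.

Lemma bernoulli_gt0 u eta : (forall x, 0 < u x < 1) -> 0 < bernoulli_product u eta.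
Proof.
move=> hu; rewrite bernoulli_productE; apply: prodr_gt0 => x _.
by rewrite /bweight; case: ifP => _; have /andP[] := hu x => h1 h2; lra.
Qed.

(** Independence of the sites: a sum over configurations of a product over sites is a product of
    sums over the two states. *)
Lemma bernoulli_mean u (h : Lambda n -> bool -> R) :
  \sum_eta bernoulli_product u eta * \prod_x h x (eta x) =
  \prod_x (u x * h x true + (1 - u x) * h x false).
Proof.
transitivity (\sum_(eta : Omega n) \prod_x (bweight (u x) (eta x) * h x (eta x))).
  by apply: eq_bigr => eta _; rewrite bernoulli_productE big_split.
rewrite -(bigA_distr_bigA (fun x b => bweight (u x) b * h x b)).
by apply: eq_bigr => x _; rewrite big_bool.
Qed.

Lemma bernoulli_sum1 u : \sum_eta bernoulli_product u eta = 1.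
Proof.
transitivity (\sum_eta bernoulli_product u eta * \prod_(x : Lambda n) (1 : R)).
  by apply: eq_bigr => eta _; rewrite big1 ?mulr1.
rewrite (bernoulli_mean u (fun _ _ => 1)).
by apply: big1 => x _; ring.
Qed.

Lemma bernoulli_mean1 u x (g : bool -> R) :
  \sum_eta bernoulli_product u eta * g (eta x) =
  u x * g true + (1 - u x) * g false.
Proof.
have := bernoulli_mean u (fun z b => if z == x then g b else 1).
rewrite [RHS](bigD1 x)//= eqxx [X in _ * X]big1 ?mulr1; last first.
  by move=> z /negbTE ->; ring.
move=> <-; apply: eq_bigr => eta _; congr (_ * _).
by rewrite (bigD1 x)//= eqxx big1 ?mulr1// => z /negbTE ->.
Qed.

Lemma bernoulli_mean2 u x y (g h : bool -> R) : x != y ->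
  \sum_eta bernoulli_product u eta * (g (eta x) * h (eta y)) =
  (u x * g true + (1 - u x) * g false) * (u y * h true + (1 - u y) * h false).
Proof.
move=> xy; have yx : y != x by rewrite eq_sym.
have := bernoulli_mean u (fun z b => if z == x then g b else if z == y then h b else 1).
rewrite [RHS](bigD1 x)//= (bigD1 y)//= eqxx (negbTE yx) eqxx [X in _ * (_ * X)]big1 ?mulr1; last first.
  by move=> z /andP[/negbTE -> /negbTE ->]; ring.
move=> <-; apply: eq_bigr => eta _; congr (_ * _).
rewrite (bigD1 x)//= (bigD1 y)//= eqxx (negbTE yx) eqxx big1 ?mulr1//.
by move=> z /andP[/negbTE -> /negbTE ->].
Qed.

End BernoulliProduct.

Section Bonds.
Context {R : realType}.
Variables (rho : R) (m : nat).
Local Notation n := m.+3.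
Implicit Types (eta : Omega n) (j k l : nat).

(* Sites are addressed by their position [j] in {1, ..., n-1}; bond [k] in
   {0, ..., n-1} joins the positions [k] and [k.+1], the bonds [0] and [n-1]
   being the ones with the reservoirs. *)
Definition pos j : Lambda n := (inord j.-1 : 'I_m.+2).

Definition jump k eta : Omega n :=
  if k == 0%N then flip (pos 1) eta
  else if k == m.+2 then flip (pos m.+2) eta
  else exchange (pos k) (pos k.+1) eta.

Definition resv_rate (b : bool) : R := if b then 1 - rho else rho.

Definition rate k eta : R :=
  if k == 0%N then resv_rate (eta (pos 1))
  else if k == m.+2 then resv_rate (eta (pos m.+2)) else 1.

Lemma val_pos j : (0 < j <= m.+2)%N -> val (pos j) = j.-1.
Proof. by case: j => // j /= h; rewrite /pos /= inordK. Qed.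

Lemma pos_inj j k : (0 < j <= m.+2)%N -> (0 < k <= m.+2)%N ->
  (pos j == pos k) = (j == k).
Proof.
by move=> hj hk; rewrite -val_eqE !val_pos//; case: j hj => // j _; case: k hk.
Qed.

Lemma site_pos (x : Lambda n) : pos (site x) = x.
Proof. by apply: val_inj; rewrite val_pos//= /site /=; case: x. Qed.

Lemma pos_site j : (0 < j <= m.+2)%N -> site (pos j) = j.
Proof. by move=> h; rewrite /site val_pos//; case: j h. Qed.

Lemma site_range (x : Lambda n) : (0 < site x <= m.+2)%N.
Proof. exact: ltn_ord. Qed.

Lemma big_sites (F : Lambda n -> R) :
  \sum_x F x = \sum_(1 <= j < m.+3) F (pos j).
Proof.
rewrite big_add1 big_mkord; apply: eq_bigr => i _; congr F.
by rewrite -[LHS]site_pos.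
Qed.

(** With [n = m.+3] the sites 1 and n-1 are distinct, so the boundary set splits into two reservoir
    bonds and every transition is a jump across one of [n] bonds. *)
Lemma generatorE (f : Omega n -> R) eta :
  generator rho f eta =
  n%:R ^+ 2 * \sum_(0 <= k < n) rate k eta * (f (jump k eta) - f eta).
Proof.
rewrite /generator -mulrDr; congr (_ * _).
rewrite big_nat_recl// big_nat_recr//= addrCA; congr (_ + _); last first.
  rewrite /jump /rate !eqxx /=.
  rewrite (bigD1 (pos 1))/=; last by rewrite pos_site.
  rewrite (bigD1 (pos m.+2))/=; last first.
    by rewrite pos_site ?leqnn// eqxx orbT pos_inj ?leqnn.
  rewrite big1 ?addr0; last first.
    move=> x /andP[/andP[+ h1] h2]; rewrite -[x]site_pos in h1 h2 *.
    have hx := site_range x.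
    rewrite pos_inj// in h1; rewrite pos_inj ?leqnn// in h2.
    by rewrite pos_site// (negbTE h1) (negbTE h2).
  by congr (_ + _); congr (_ * _); rewrite /occ /resv_rate; case: (eta _) => /=; ring.
rewrite big_sites big_nat_recr//= big_add1 /= [X in _ + X]big1 ?addr0; last first.
  move=> y; rewrite pos_site ?leqnn// /site => /eqP[] e.
  by move: (ltn_ord y); rewrite e ltnn.
apply: eq_big_nat => k /andP[_ hk].
have hk2 : (0 < k.+1 <= m.+2)%N by rewrite /= ltnS ltnW.
rewrite /rate /jump /= !eqSS (ltn_eqF hk) mul1r.
rewrite (big_pred1 (pos k.+2)) => [//|y].
have hy := site_range y.
by rewrite pos_site//= -[in RHS](site_pos y) pos_inj.
Qed.

End Bonds.

Lemma sum_nat_pred1 (R : pzRingType) (n j : nat) (F : nat -> R) : (j < n)%N ->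
  \sum_(0 <= k < n) (k == j)%:R * F k = F j.
Proof.
move=> jn; rewrite big_mkord (bigD1 (Ordinal jn))//= eqxx mul1r big1 ?addr0// => i.
by rewrite -val_eqE /= => /negbTE ->; rewrite mul0r.
Qed.

(** * Action of the generator on one- and two-point functions *)

Section Jumps.
Context {R : realType}.
Variables (rho : R) (m : nat).
Local Notation n := m.+3.
Implicit Types (eta : Omega n) (j k l : nat).

Lemma jump_bulk k eta j : (0 < k < m.+2)%N -> (0 < j <= m.+2)%N ->
  jump k eta (pos m j) =
  if j == k then eta (pos m k.+1) else if j == k.+1 then eta (pos m k)
  else eta (pos m j).
Proof.
move=> /andP[k0 km] hj.
have hk : (0 < k <= m.+2)%N by rewrite k0 ltnW.
have hk1 : (0 < k.+1 <= m.+2)%N by [].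
rewrite /jump (gtn_eqF k0) (ltn_eqF km) exchangeE.
have [->|jk] := eqVneq j k; first by rewrite tpermL.
have [->|jk1] := eqVneq j k.+1; first by rewrite tpermR.
by rewrite tpermD// pos_inj// eq_sym.
Qed.

Lemma jump_left eta j : (0 < j <= m.+2)%N ->
  jump 0 eta (pos m j) = if j == 1%N then ~~ eta (pos m j) else eta (pos m j).
Proof. by move=> hj; rewrite /jump /= flipE pos_inj. Qed.

Lemma jump_right eta j : (0 < j <= m.+2)%N ->
  jump m.+2 eta (pos m j) = if j == m.+2 then ~~ eta (pos m j) else eta (pos m j).
Proof. by move=> hj; rewrite /jump /= eqxx flipE pos_inj ?leqnn. Qed.

Lemma jumpK k : involutive (@jump m k).
Proof.
move=> eta; rewrite /jump; case: eqP => _; first by rewrite flipK.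
by case: eqP => _; rewrite ?flipK ?exchangeK.
Qed.

Lemma sum_jump k (F : Omega n -> R) : \sum_eta F (jump k eta) = \sum_eta F eta.
Proof. by rewrite [RHS](reindex_inj (inv_inj (jumpK k))). Qed.

Variant bond_spec k : Prop :=
| LeftBond of k = 0%N
| BulkBond of (0 < k < m.+2)%N
| RightBond of k = m.+2.

Lemma bondP k : (k <= m.+2)%N -> bond_spec k.
Proof.
rewrite leq_eqVlt => /predU1P[->|h]; first exact: RightBond.
by case: k h => [|k] h; [exact: LeftBond | exact: BulkBond].
Qed.

Lemma rate_ge0 k eta : 0 < rho < 1 -> 0 <= rate rho k eta.
Proof.
move=> /andP[h1 h2]; rewrite /rate /resv_rate.
by do 3?[case: ifP => _]; lra.
Qed.

Lemma rate_bulk k eta : (0 < k < m.+2)%N -> rate rho k eta = 1.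
Proof. by move=> /andP[k0 km]; rewrite /rate (gtn_eqF k0) (ltn_eqF km). Qed.

Lemma rate_left eta : rate rho 0 eta = resv_rate rho (eta (pos m 1)).
Proof. by []. Qed.

Lemma rate_right eta : rate rho m.+2 eta = resv_rate rho (eta (pos m m.+2)).
Proof. by rewrite /rate /= eqxx. Qed.

Lemma generator_lin (f : Omega n -> R) eta :
  generator rho f eta =
  \sum_z f z * generator rho (fun x => (x == z)%:R) eta.
Proof.
under eq_bigr do rewrite generatorE mulrCA mulr_sumr.
rewrite generatorE -mulr_sumr exchange_big /=; congr (_ * _).
apply: eq_bigr => k _.
under eq_bigr do rewrite mulrCA mulrBr.
rewrite -mulr_sumr sumrB; congr (_ * (_ - _)).
- rewrite (bigD1 (jump k eta))//= eqxx mulr1 big1 ?addr0// => x.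
  by rewrite eq_sym => /negbTE ->; rewrite mulr0.
- rewrite (bigD1 eta)//= eqxx mulr1 big1 ?addr0// => x.
  by rewrite eq_sym => /negbTE ->; rewrite mulr0.
Qed.

Lemma generator_offdiag_ge0 (eta z : Omega n) : 0 < rho < 1 -> eta != z ->
  0 <= generator rho (fun x => (x == z)%:R) eta.
Proof.
move=> hr ez; rewrite generatorE mulr_ge0 ?sqr_ge0//; apply: sumr_ge0 => k _.
by rewrite (negbTE ez) subr0 mulr_ge0// rate_ge0.
Qed.

(** The value 0 at the reservoir positions 0 and n is what makes the discrete Laplacian of
    [generator_V] correct up to the boundary. *)
Definition V j eta : R :=
  if (0 < j <= m.+2)%N then occ eta (pos m j) - rho else 0.

Lemma V_left eta : V 0 eta = 0. Proof. by []. Qed.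

Lemma V_right eta : V m.+3 eta = 0. Proof. by rewrite /V /= ltnn. Qed.

Lemma V_pos j eta : (0 < j <= m.+2)%N -> V j eta = (eta (pos m j))%:R - rho.
Proof. by rewrite /V => ->. Qed.

Definition bond_diff k j (F : nat -> R) : R :=
  (k == j)%:R * (F j.+1 - F j) + (k.+1 == j)%:R * (F j.-1 - F j).

(** At a reservoir bond the rate times the increment is the drift [rho - eta], the same as a move of
    [V] to the reservoir value 0. *)
Lemma rate_V k j eta : (k <= m.+2)%N -> (0 < j <= m.+2)%N ->
  rate rho k eta * (V j (jump k eta) - V j eta) = bond_diff k j (V ^~ eta).
Proof.
move=> hk hj; rewrite /bond_diff; case: (bondP hk) => {}hk.
- subst k; rewrite rate_left !(V_pos _ hj) jump_left// [0%N == j]eq_sym.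
  rewrite (gtn_eqF (andP hj).1) mul0r add0r [1%N == j]eq_sym.
  have [->|_] := eqVneq j 1%N; last by rewrite subrr mulr0 mul0r.
  by rewrite V_left /resv_rate; case: (eta _) => /=; ring.
- rewrite rate_bulk// mul1r !(V_pos _ hj) jump_bulk//.
  rewrite [k == j]eq_sym [k.+1 == j]eq_sym.
  have [->|jk] := eqVneq j k.
    rewrite (ltn_eqF (ltnSn k)) mul1r mul0r addr0 V_pos//.
    by case/andP: hk => _ ->.
  have [->|jk1] := eqVneq j k.+1; last by rewrite !mul0r addr0 subrr.
  by rewrite mul0r mul1r add0r /= V_pos//; case/andP: hk => -> /ltnW ->.
- subst k; rewrite rate_right !(V_pos _ hj) jump_right//.
  rewrite [m.+2 == j]eq_sym [m.+3 == j]gtn_eqF ?ltnS ?(andP hj).2// mul0r addr0.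
  have [->|_] := eqVneq j m.+2; last by rewrite subrr mulr0 mul0r.
  by rewrite V_right /resv_rate; case: (eta _) => /=; ring.
Qed.

Lemma rate_VV k j l eta : (k <= m.+2)%N -> (0 < j)%N -> (j < l)%N -> (l <= m.+2)%N ->
  rate rho k eta * (V j (jump k eta) * V l (jump k eta) - V j eta * V l eta) =
  bond_diff k j (V ^~ eta) * V l eta + V j eta * bond_diff k l (V ^~ eta)
  + bond_diff k j (V ^~ eta) * bond_diff k l (V ^~ eta).
Proof.
move=> hk j0 jl hl.
have hj : (0 < j <= m.+2)%N by rewrite j0 (leq_trans (ltnW jl)).
have hl' : (0 < l <= m.+2)%N by rewrite (leq_trans _ jl).
have e1 := rate_V eta hk hj; have e2 := rate_V eta hk hl'.
(* The rate may be duplicated: it is 1 in the bulk, and a reservoir bond moves at most one of the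
   two sites, so that both sides vanish. *)
have key : rate rho k eta * ((V j (jump k eta) - V j eta) * (V l (jump k eta) - V l eta))
  = (rate rho k eta * (V j (jump k eta) - V j eta)) * (rate rho k eta * (V l (jump k eta) - V l eta)).
  case: (bondP hk) => hb.
  - subst k; rewrite [V l _]V_pos// [V l eta]V_pos// jump_left//.
    by rewrite (gtn_eqF (leq_ltn_trans j0 jl)) subrr !mulr0.
  - by rewrite rate_bulk// !mul1r.
  - subst k; rewrite [V j _]V_pos// [V j eta]V_pos// jump_right//.
    by rewrite (ltn_eqF (leq_trans jl hl)) subrr !(mul0r,mulr0).
rewrite -{}e1 -{}e2 -key; ring.
Qed.

Lemma sum_bond_diff j (F : nat -> R) : (0 < j <= m.+2)%N ->
  \sum_(0 <= k < n) bond_diff k j F = F j.+1 + F j.-1 - 2 * F j.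
Proof.
case: j => // j hj; rewrite /bond_diff big_split /=.
rewrite sum_nat_pred1// (sum_nat_pred1 (fun=> F j - F j.+1)); last exact: ltnW.
by ring.
Qed.

Lemma generator_V j eta : (0 < j <= m.+2)%N ->
  generator rho (V j) eta =
  n%:R ^+ 2 * (V j.+1 eta + V j.-1 eta - 2 * V j eta).
Proof.
move=> hj; rewrite generatorE -(sum_bond_diff (V ^~ eta) hj); congr (_ * _).
by apply: eq_big_nat => k /andP[_ hk]; rewrite rate_V.
Qed.

(** The two increments overlap only on the bond that joins neighbours. That exchange leaves
    [V j * V l] unchanged, and the square cancels what the two Laplacians attribute to it. *)
Lemma generator_VV j l eta : (0 < j)%N -> (j < l)%N -> (l <= m.+2)%N ->
  generator rho (fun x => V j x * V l x) eta =
  n%:R ^+ 2 * ((V j.+1 eta + V j.-1 eta - 2 * V j eta) * V l eta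
    + V j eta * (V l.+1 eta + V l.-1 eta - 2 * V l eta)
    - (l == j.+1)%:R * (V j.+1 eta - V j eta) ^+ 2).
Proof.
move=> j0 jl hl; rewrite generatorE; congr (_ * _).
have hj : (0 < j <= m.+2)%N by rewrite j0 (leq_trans (ltnW jl)).
have hl' : (0 < l <= m.+2)%N by rewrite (leq_trans _ jl).
under eq_big_nat => k /andP[_ hk] do rewrite rate_VV//.
rewrite !big_split /= -mulr_suml -mulr_sumr !sum_bond_diff//; congr (_ + _).
case: l jl hl hl' => // l; rewrite ltnS => jl hl _; rewrite eqSS /bond_diff.
rewrite (eq_bigr (fun k => (k == j)%:R * ((l == j)%:R * - (V j.+1 eta - V j eta) ^+ 2))).
  by rewrite (sum_nat_pred1 (fun=> _)) ?mulrN// ltnS; case/andP: hj.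
move=> k _; rewrite eqSS.
have [->|kj] := eqVneq k j.
  rewrite (gtn_eqF (ltnSn j)) (ltn_eqF (jl : (j < l.+1)%N)) [l == j]eq_sym.
  by have [->|_] := eqVneq j l; rewrite /=; ring.
have [jk|_] := eqVneq k.+1 j; last by rewrite /=; ring.
have kl : (k < l)%N by rewrite jk.
by rewrite (ltn_eqF kl) (ltn_eqF (ltn_trans kl (ltnSn l))) /=; ring.
Qed.

End Jumps.

(** * Adjoint of the generator with respect to an inhomogeneous product measure *)

Section Adjoint.
Context {R : realType}.
Variables (rho : R) (m : nat).
Local Notation n := m.+3.
Implicit Types (eta : Omega n) (j k l : nat) (U : nat -> R).

Definition profile U : Lambda n -> R := fun x => U (site x).

(** The Bernoulli score: the derivative in [u] of [ln (bweight u b)]. It is centred under density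
    [u], with variance 1 / (u (1 - u)). *)
Definition omega (u : R) (b : bool) : R := (b%:R - u) / (u * (1 - u)).

Definition W U j eta : R :=
  if (0 < j <= m.+2)%N then omega (U j) (eta (pos m j)) else 0.

Definition admissible U :=
  [/\ U 0%N = rho, U m.+3 = rho & forall j, (0 < j <= m.+2)%N -> 0 < U j < 1].

Lemma profile_gt0 U eta : admissible U -> 0 < bernoulli_product (profile U) eta.
Proof. by move=> [_ _ h]; apply: bernoulli_gt0 => x; apply: h; exact: site_range. Qed.

Lemma profile_pos U j : (0 < j <= m.+2)%N -> profile U (pos m j) = U j.
Proof. by move=> hj; rewrite /profile pos_site. Qed.

Lemma W_pos U j eta : (0 < j <= m.+2)%N -> W U j eta = omega (U j) (eta (pos m j)).
Proof. by rewrite /W => ->. Qed.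

Lemma W_left U eta : W U 0 eta = 0. Proof. by []. Qed.
Lemma W_right U eta : W U m.+3 eta = 0. Proof. by rewrite /W /= ltnn. Qed.

(** The weights before and after a jump differ in at most two factors, so the identity is a finite
    check on occupations. At the reservoirs [U] is [rho] and [W] is 0, hence no quadratic term
    there. *)
Lemma bond_ratio U k eta : admissible U -> (k <= m.+2)%N ->
  bernoulli_product (profile U) (jump k eta) * rate rho k (jump k eta)
    - bernoulli_product (profile U) eta * rate rho k eta =
  bernoulli_product (profile U) eta *
    ((U k.+1 - U k) * (W U k eta - W U k.+1 eta)
     - (U k.+1 - U k) ^+ 2 * (W U k eta * W U k.+1 eta)).
Proof.
move=> [U0 Un hU] hk; case: (bondP hk) => hb.
- subst k; rewrite !rate_left jump_left// eqxx W_left U0 W_pos//.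
  have := bernoulli_flip (profile U) (pos m 1) eta.
  rewrite profile_pos// /jump /=; have /andP[h1 h2] := hU 1%N isT.
  have h3 : 0 < 1 - U 1%N by rewrite subr_gt0.
  set P := bernoulli_product _ eta; set Q := bernoulli_product _ _.
  rewrite /bweight /resv_rate /omega; case: (eta _) => /= e.
  - have -> : Q = P * (1 - U 1%N) / U 1%N by rewrite -e mulfK// gt_eqF.
    by field; rewrite !gt_eqF.
  - have -> : Q = P * U 1%N / (1 - U 1%N).
      by rewrite -e mulfK// gt_eqF// subr_gt0.
    by field; rewrite !gt_eqF.
- rewrite !rate_bulk// !mulr1.
  have /andP[k0 km] := hb.
  have hk1 : (0 < k <= m.+2)%N by rewrite k0.
  have hk2 : (0 < k.+1 <= m.+2)%N by [].
  rewrite !W_pos//.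
  have kk : pos m k != pos m k.+1 by rewrite pos_inj// ltn_eqF.
  have := bernoulli_exchange (profile U) eta kk.
  rewrite !profile_pos// /jump (gtn_eqF k0) (ltn_eqF km).
  have /andP[h1 h2] := hU k hk1; have /andP[h3 h4] := hU k.+1 hk2.
  set P := bernoulli_product _ eta; set Q := bernoulli_product _ _.
  move: (U k) (U k.+1) h1 h2 h3 h4 => a b a0 a1 b0 b1.
  have a1' : 0 < 1 - a by rewrite subr_gt0.
  have b1' : 0 < 1 - b by rewrite subr_gt0.
  rewrite /bweight /omega; case: (eta _); case: (eta _) => /= e.
  - have -> : Q = P by apply: (mulIf _ e); rewrite gt_eqF// mulr_gt0.
    by field; rewrite !gt_eqF.
  - have -> : Q = P * ((1 - a) * b) / (a * (1 - b)).
      by rewrite -e mulfK// gt_eqF// mulr_gt0.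
    by field; rewrite !gt_eqF.
  - have -> : Q = P * (a * (1 - b)) / ((1 - a) * b).
      by rewrite -e mulfK// gt_eqF// mulr_gt0.
    by field; rewrite !gt_eqF.
  - have -> : Q = P by apply: (mulIf _ e); rewrite gt_eqF// mulr_gt0.
    by field; rewrite !gt_eqF.
- subst k; rewrite !rate_right jump_right ?leqnn// eqxx W_right Un W_pos ?leqnn//.
  have := bernoulli_flip (profile U) (pos m m.+2) eta.
  rewrite profile_pos ?leqnn// /jump /= eqxx; have /andP[h1 h2] := hU m.+2 (leqnn _).
  have h3 : 0 < 1 - U m.+2 by rewrite subr_gt0.
  set P := bernoulli_product _ eta; set Q := bernoulli_product _ _.
  rewrite /bweight /resv_rate /omega; case: (eta _) => /= e.
  - have -> : Q = P * (1 - U m.+2) / U m.+2 by rewrite -e mulfK// gt_eqF.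
    by field; rewrite !gt_eqF.
  - have -> : Q = P * U m.+2 / (1 - U m.+2).
      by rewrite -e mulfK// gt_eqF// subr_gt0.
    by field; rewrite !gt_eqF.
Qed.

Lemma bond_adjoint U k (f : Omega n -> R) : admissible U -> (k <= m.+2)%N ->
  \sum_eta bernoulli_product (profile U) eta *
    (rate rho k eta * (f (jump k eta) - f eta)) =
  \sum_eta f eta * (bernoulli_product (profile U) eta *
    ((U k.+1 - U k) * (W U k eta - W U k.+1 eta)
     - (U k.+1 - U k) ^+ 2 * (W U k eta * W U k.+1 eta))).
Proof.
move=> hU hk.
under [RHS]eq_bigr do rewrite -bond_ratio// mulrBr.
rewrite sumrB -[X in _ = X - _](sum_jump k) -sumrB.
by apply: eq_bigr => eta _; rewrite jumpK; ring.
Qed.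

Lemma abel_W U eta : admissible U ->
  \sum_(0 <= k < n) (U k.+1 - U k) * (W U k eta - W U k.+1 eta) =
  \sum_(1 <= j < n) (U j.+1 + U j.-1 - 2 * U j) * W U j eta.
Proof.
move=> _.
under eq_bigr do rewrite mulrBr.
rewrite sumrB big_nat_recl// W_left mulr0 add0r [X in _ - X]big_nat_recr//=.
rewrite W_right mulr0 addr0 big_add1 /= -sumrB.
by apply: eq_bigr => k _; ring.
Qed.

(** Abel summation gives the linear part the form Laplacian of [U] against [W]. Along the heat flow
    [dv_ln_bernoulli] gives the time derivative of the log density the same form, and the two cancel
    in the entropy derivative. *)
Lemma generator_adjoint U (f : Omega n -> R) : admissible U ->
  \sum_eta bernoulli_product (profile U) eta * generator rho f eta =
  n%:R ^+ 2 * \sum_eta f eta * bernoulli_product (profile U) eta *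
    (\sum_(1 <= j < n) (U j.+1 + U j.-1 - 2 * U j) * W U j eta
     - \sum_(0 <= k < n) (U k.+1 - U k) ^+ 2 * (W U k eta * W U k.+1 eta)).
Proof.
move=> hU.
under eq_bigr do rewrite generatorE mulrCA mulr_sumr.
rewrite -mulr_sumr exchange_big /=; congr (_ * _).
rewrite big_nat.
under eq_bigr => k /andP[_ hk] do rewrite bond_adjoint//.
rewrite -big_nat exchange_big /=; apply: eq_bigr => eta _.
rewrite -abel_W// -sumrB mulr_sumr; apply: eq_bigr => k _; ring.
Qed.

Lemma ln_bernoulli U eta : admissible U ->
  ln (bernoulli_product (profile U) eta) =
  \sum_(1 <= j < n) ln (bweight (U j) (eta (pos m j))).
Proof.
move=> [_ _ hU].
have h x : 0 < bweight (profile U x) (eta x).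
  have := hU (site x) (site_range x); rewrite /bweight /profile.
  by case: (eta x) => /andP[? ?]; lra.
rewrite bernoulli_productE.
transitivity (\sum_x ln (bweight (profile U x) (eta x))).
  have : 0 < \prod_x bweight (profile U x) (eta x) by apply: prodr_gt0.
  elim/big_rec2 : _ => [|x y1 y2 _ ih]; first by rewrite ln1.
  by move=> h2; have y20 : 0 < y2; [rewrite -(pmulr_rgt0 _ (h x))| rewrite lnM// ?posrE// ih].
rewrite big_sites; apply: eq_big_nat => j hj.
by rewrite profile_pos.
Qed.

Lemma dv_ln_bernoulli (u : R -> nat -> R) (du : nat -> R) (t : R) eta :
  (forall j, (0 < j <= m.+2)%N -> dv (u ^~ j) t (du j)) ->
  (forall j, (0 < j <= m.+2)%N -> 0 < u t j < 1) ->
  dv (fun s => \sum_(1 <= j < n) ln (bweight (u s j) (eta (pos m j)))) t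
     (\sum_(1 <= j < n) du j * W (u t) j eta).
Proof.
move=> hu h01.
(* [dv_sum] wants a derivative at every index, so terms outside the range are replaced by 0. *)
rewrite big_nat; 
have -> : (fun s => \sum_(1 <= j < n) ln (bweight (u s j) (eta (pos m j)))) =
  (fun s => \sum_(1 <= j < n | (1 <= j < n)%N) ln (bweight (u s j) (eta (pos m j)))).
  by apply/funext => s; rewrite big_nat.
rewrite big_seq_cond.
have -> : (fun s => \sum_(1 <= j < n | (1 <= j < n)%N) ln (bweight (u s j) (eta (pos m j)))) =
  (fun s => \sum_(1 <= j < n) (if (1 <= j < n)%N then ln (bweight (u s j) (eta (pos m j))) else 0)).
  by apply/funext => s; rewrite big_mkcond.
rewrite -big_seq_cond big_mkcond; apply: dv_sum => j.
case: ifP => hj; last exact: dvc.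
have /andP[h1 h2] := h01 j hj.
rewrite W_pos// /omega /bweight; case: (eta _) => /=.
- apply: (dv_eq (dv_ln h1 (hu j hj))); by field; rewrite !gt_eqF ?subr_gt0.
- have h3 : 0 < 1 - u t j by rewrite subr_gt0.
  have h4 : dv (fun s => 1 - u s j) t (0 - du j) by exact: dvB (dvc 1 t) (hu j hj).
  apply: (dv_eq (dv_ln (f := fun s => 1 - u s j) h3 h4)).
  by field; rewrite !gt_eqF.
Qed.

End Adjoint.

(** * Relative entropy and correlations *)

Lemma ln_le_subr1 (R : realType) (x : R) : 0 < x -> ln x <= x - 1.
Proof. move=> x0; have -> : ln x = ln (1 + (x - 1)) by congr ln; ring.
by apply: le_ln1Dx; lra. Qed.

(** Twice [ln x <= x - 1] at x = b / a, multiplied by a^2. The retained [(b - a) ^+ 2] becomes the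
    Dirichlet form of the root density, or the Hellinger distance. *)
Lemma ln_sqr_le (R : realType) (a b : R) : 0 < a -> 0 < b ->
  a ^+ 2 * (ln (b ^+ 2) - ln (a ^+ 2)) <= b ^+ 2 - a ^+ 2 - (b - a) ^+ 2.
Proof.
move=> a0 b0; rewrite !expr2 !lnM ?posrE//.
have h : ln b - ln a <= b / a - 1.
  by rewrite -ln_div ?posrE//; apply: ln_le_subr1; rewrite divr_gt0.
have -> : b * b - a * a - (b - a) * (b - a) = a * a * ((b / a - 1) + (b / a - 1)).
  by field; rewrite gt_eqF.
by apply: ler_wpM2l; [rewrite mulr_ge0// ltW | lra].
Qed.

Section EntropyProduction.
Context {R : realType}.
Variables (rho : R) (m : nat).
Local Notation n := m.+3.
Hypothesis hrho : 0 < rho < 1.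
Variable mu0 : Omega n -> R.
Hypothesis mu0_gt0 : forall eta, 0 < mu0 eta.
Variable u : R -> nat -> R.
Hypothesis u_adm : forall t : R, 0 <= t -> admissible rho m (u t).
Hypothesis u_heat : forall (t : R) j, 0 <= t -> (0 < j <= m.+2)%N ->
  dv (u ^~ j) t (n%:R ^+ 2 * (u t j.+1 + u t j.-1 - 2 * u t j)).

Local Notation p := (law_at (@generator R rho n) mu0).
Definition psi (t : R) : Omega n -> R := bernoulli_product (profile (u t)).

Definition log_psi (t : R) (eta : Omega n) : R :=
  \sum_(1 <= j < n) ln (bweight (u t j) (eta (pos m j))).

(* [log_psi t] is [ln (psi t)] for [0 <= t]; it is used here so that the
   two-sided derivative at [0] makes sense. *)
Definition entropy (t : R) : R :=
  \sum_eta p t eta * (ln (p t eta) - log_psi t eta).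

Definition root_density (t : R) (eta : Omega n) : R :=
  Num.sqrt (p t eta / psi t eta).

Definition dirichlet (w g : Omega n -> R) : R :=
  \sum_(0 <= k < n) \sum_eta w eta * (rate rho k eta * (g (jump k eta) - g eta) ^+ 2).

Lemma law_gt0 (t : R) eta : 0 <= t -> 0 < p t eta.
Proof.
apply: law_at_gt0 => //; first exact: generator_lin.
by move=> x y; exact: generator_offdiag_ge0.
Qed.

Lemma psi_gt0 (t : R) eta : 0 <= t -> 0 < psi t eta.
Proof. by move=> t0; apply: profile_gt0; exact: u_adm. Qed.

Lemma generator_cst (c : R) eta : generator rho (fun _ : Omega n => c) eta = 0.
Proof. by rewrite generatorE big1 ?mulr0// => k _; rewrite subrr mulr0. Qed.

Lemma law_mass (t : R) : 0 <= t -> \sum_eta p t eta = \sum_eta mu0 eta.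
Proof.
move=> t0.
have h (s : R) : dv (fun s => \sum_eta p s eta * 1) s 0.
  apply: (dv_eq (dv_law_at_mean (@generator_lin R rho m) mu0 (fun=> 1) s)).
  by apply: big1 => eta _; rewrite generator_cst mulr0.
have [c _ e] := mvt t0 (fun s _ => h s).
transitivity (\sum_eta p t eta * 1); first by apply: eq_bigr => *; rewrite mulr1.
move/eqP: e; rewrite mul0r subr_eq0 => /eqP ->.
by apply: eq_bigr => eta _; rewrite mulr1 law_at0//; exact: generator_lin.
Qed.

Lemma log_psiE (t : R) eta : 0 <= t -> log_psi t eta = ln (psi t eta).
Proof. by move=> t0; rewrite /psi (ln_bernoulli eta (u_adm t0)). Qed.

Lemma entropy_derivative (t : R) : 0 <= t ->
  dv entropy t
    (\sum_eta p t eta * generator rho (fun x => ln (p t x) - ln (psi t x)) eta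
     - \sum_eta p t eta * \sum_(1 <= j < n)
         n%:R ^+ 2 * (u t j.+1 + u t j.-1 - 2 * u t j) * W (u t) j eta).
Proof.
move=> t0.
pose dp eta := \sum_z p t z * generator rho (fun x => (x == eta)%:R) z.
have hdp eta : dv (fun s => p s eta) t (dp eta).
  by apply: dv_law_at; exact: generator_lin.
have hmean F : \sum_eta dp eta * F eta = \sum_eta p t eta * generator rho F eta.
  rewrite /dp; under eq_bigr do rewrite mulr_suml.
  rewrite exchange_big /=; apply: eq_bigr => z _.
  rewrite [in RHS]generator_lin mulr_sumr; apply: eq_bigr => x _; ring.
pose dl (eta : Omega n) := \sum_(1 <= j < n)
         n%:R ^+ 2 * (u t j.+1 + u t j.-1 - 2 * u t j) * W (u t) j eta.
have hl eta : dv (fun s => log_psi s eta) t (dl eta).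
  apply: dv_ln_bernoulli => j hj; first exact: u_heat.
  by have [_ _] := u_adm t0; apply.
have h0 : dv entropy t (\sum_eta (dp eta * (ln (p t eta) - log_psi t eta) +
     p t eta * (dp eta / p t eta - dl eta))).
  apply: dv_sum => eta.
  exact: (dvM (hdp eta) (dvB (dv_ln (law_gt0 eta t0) (hdp eta)) (hl eta))).
apply: (dv_eq h0); rewrite big_split /= -hmean; congr (_ + _).
  by apply: eq_bigr => eta _; rewrite log_psiE.
rewrite -sumrN.
(* Differentiating the logarithm of the law contributes the total mass of [dp], which is 0 because
   the generator kills constants. *)
transitivity (\sum_eta (dp eta * 1 - p t eta * dl eta)).
  by apply: eq_bigr => eta _; field; rewrite gt_eqF// law_gt0.
rewrite sumrB hmean big1 ?sub0r ?sumrN// => eta _.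
by rewrite generator_cst mulr0.
Qed.

(** Yau's relative entropy inequality. With g^2 = p / psi, [ln_sqr_le] on each jump yields the
    generator of g^2 minus the Dirichlet form; [generator_adjoint] then moves the generator on to
    [psi]. *)
Lemma entropy_production (t : R) : 0 <= t ->
  \sum_eta p t eta * generator rho (fun x => ln (p t x) - ln (psi t x)) eta
     - \sum_eta p t eta * \sum_(1 <= j < n)
         n%:R ^+ 2 * (u t j.+1 + u t j.-1 - 2 * u t j) * W (u t) j eta
  <= - n%:R ^+ 2 * dirichlet (psi t) (root_density t)
   - n%:R ^+ 2 * \sum_(0 <= k < n) (u t k.+1 - u t k) ^+ 2 *
       \sum_eta p t eta * (W (u t) k eta * W (u t) k.+1 eta).
Proof.
move=> t0; pose g := root_density t.
have g0 eta : 0 < g eta by rewrite sqrtr_gt0 divr_gt0// ?law_gt0// psi_gt0.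
have g2 eta : g eta ^+ 2 = p t eta / psi t eta.
  by rewrite sqr_sqrtr// divr_ge0// ltW// ?law_gt0// psi_gt0.
have pE eta : p t eta = g eta ^+ 2 * psi t eta.
  by rewrite g2 divfK// gt_eqF// psi_gt0.
have lE eta : ln (p t eta) - ln (psi t eta) = ln (g eta ^+ 2).
  by rewrite g2 ln_div ?posrE ?law_gt0// psi_gt0.
have key : \sum_eta p t eta * generator rho (fun x => ln (p t x) - ln (psi t x)) eta
   <= \sum_eta psi t eta * generator rho (fun x => g x ^+ 2) eta
      - n%:R ^+ 2 * dirichlet (psi t) g.
  rewrite /dirichlet exchange_big /= mulr_sumr -sumrB; apply: ler_sum => eta _.
  rewrite !generatorE.
  rewrite [leLHS](_ : _ = psi t eta * (n%:R ^+ 2 * \sum_(0 <= k < n)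
     rate rho k eta * (g eta ^+ 2 * (ln (g (jump k eta) ^+ 2) - ln (g eta ^+ 2))))); last first.
    rewrite [in RHS](eq_bigr (fun k => g eta ^+ 2 * (rate rho k eta *
      (ln (p t (jump k eta)) - ln (psi t (jump k eta)) - (ln (p t eta) - ln (psi t eta)))))).
      by rewrite -mulr_sumr [X in X * _ = _]pE; ring.
    by move=> k _; rewrite !lE; ring.
  rewrite [leRHS](_ : _ = psi t eta * (n%:R ^+ 2 * \sum_(0 <= k < n)
     rate rho k eta * (g (jump k eta) ^+ 2 - g eta ^+ 2 - (g (jump k eta) - g eta) ^+ 2))); last first.
    rewrite -mulr_sumr; under [in RHS]eq_bigr do rewrite mulrBr.
    by rewrite sumrB; ring.
  rewrite ler_wpM2l//; first by rewrite ltW// psi_gt0.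
  rewrite ler_wpM2l ?sqr_ge0//; apply: ler_sum => k _.
  by rewrite ler_wpM2l ?rate_ge0// ln_sqr_le.
have adj := generator_adjoint (fun x => g x ^+ 2) (u_adm t0).
rewrite -/(psi t) in adj.
rewrite adj in key.
apply: (@le_trans _ _ (n%:R ^+ 2 * (\sum_eta g eta ^+ 2 * psi t eta *
       (\sum_(1 <= j < n) (u t j.+1 + u t j.-1 - 2 * u t j) * W (u t) j eta -
        \sum_(0 <= k < n) (u t k.+1 - u t k) ^+ 2 * (W (u t) k eta * W (u t) k.+1 eta)))
   - n%:R ^+ 2 * dirichlet (psi t) g - \sum_eta p t eta * \sum_(1 <= j < n)
         n%:R ^+ 2 * (u t j.+1 + u t j.-1 - 2 * u t j) * W (u t) j eta)).
  by rewrite lerD2r.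
rewrite le_eqVlt; apply/orP; left; apply/eqP.
have e1 : \sum_eta p t eta * (\sum_(1 <= j < n)
         n%:R ^+ 2 * (u t j.+1 + u t j.-1 - 2 * u t j) * W (u t) j eta) =
  n%:R ^+ 2 * \sum_eta p t eta * (\sum_(1 <= j < n)
         (u t j.+1 + u t j.-1 - 2 * u t j) * W (u t) j eta).
  rewrite mulr_sumr; apply: eq_bigr => eta _; rewrite mulrCA; congr (_ * _).
  by rewrite mulr_sumr; apply: eq_bigr => j _; rewrite mulrA.
have e2 : \sum_(0 <= k < n) (u t k.+1 - u t k) ^+ 2 *
       (\sum_eta p t eta * (W (u t) k eta * W (u t) k.+1 eta)) =
  \sum_eta p t eta * \sum_(0 <= k < n) (u t k.+1 - u t k) ^+ 2 *
       (W (u t) k eta * W (u t) k.+1 eta).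
  under eq_bigr do rewrite mulr_sumr.
  rewrite exchange_big /=; apply: eq_bigr => eta _.
  by rewrite mulr_sumr; apply: eq_bigr => k _; ring.
rewrite e1 e2.
under eq_bigr do rewrite -pE mulrBr.
rewrite sumrB; rewrite /g; ring.
Qed.

End EntropyProduction.

(** * Maximum principles for the discrete heat equation *)

Section HeatComparison.
Context {R : realType}.
Variable m : nat.
Local Notation n := m.+3.

Lemma heat_comparison (c : R) (z : R -> nat -> R) : 0 <= c ->
  (forall (t : R) j, 0 <= t -> (0 < j <= m.+2)%N ->
     dv (z ^~ j) t (c * (z t j.+1 + z t j.-1 - 2 * z t j))) ->
  (forall t : R, 0 <= t -> 0 <= z t 0%N) ->
  (forall t : R, 0 <= t -> 0 <= z t m.+3) ->
  (forall j, (0 < j <= m.+2)%N -> 0 <= z 0 j) ->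
  forall (t : R) j, 0 <= t -> (j <= m.+3)%N -> 0 <= z t j.
Proof.
move=> c0 hz z0 zn hi t j t0.
rewrite leq_eqVlt => /predU1P[->|jn]; first exact: zn.
case: j jn => [_|j jn]; first exact: z0.
have hj : (0 < j.+1 <= m.+2)%N by [].
rewrite -(pos_site hj).
apply: (@comparison R (Lambda n) (2 * c) (fun t (x : Lambda n) => z t (site x))
  (fun t (x : Lambda n) => c * (z t (site x).+1 + z t (site x).-1 - 2 * z t (site x)))
  _ _ _ _ t (pos m j.+1) t0).
- by rewrite mulr_ge0.
- by move=> s x s0; apply: hz => //; exact: site_range.
- move=> s x B s0 hB zx.
  have B0 : 0 <= B by rewrite -oppr_le0; exact: le_trans (hB x) zx.
  have zB k : (k <= m.+3)%N -> - B <= z s k.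
    rewrite leq_eqVlt => /predU1P[->|kn].
      by apply: le_trans (zn s s0); rewrite oppr_le0.
    case: k kn => [_|k kn]; first by apply: le_trans (z0 s s0); rewrite oppr_le0.
    by have := hB (pos m k.+1); rewrite pos_site.
  have /andP[x1 x2] := site_range x.
  have h1 := zB (site x).+1 x2.
  have h2 := zB (site x).-1 (leq_trans (leq_pred _) (leq_trans x2 (leqnSn _))).
  rewrite -mulrA -mulNr -mulrN -subr_ge0.
  rewrite [X in 0 <= X](_ : _ = c * (z s (site x).+1 + z s (site x).-1 - 2 * z s (site x) + 2 * B)); last by ring.
  by rewrite mulr_ge0//; lra.
- by move=> x; apply: hi; exact: site_range.
Qed.

Lemma heat_bound (c a b : R) (z : R -> nat -> R) : 0 <= c ->
  (forall (t : R) j, 0 <= t -> (0 < j <= m.+2)%N ->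
     dv (z ^~ j) t (c * (z t j.+1 + z t j.-1 - 2 * z t j))) ->
  (forall t : R, 0 <= t -> a <= z t 0%N <= b) ->
  (forall t : R, 0 <= t -> a <= z t m.+3 <= b) ->
  (forall j, (0 < j <= m.+2)%N -> a <= z 0 j <= b) ->
  forall (t : R) j, 0 <= t -> (j <= m.+3)%N -> a <= z t j <= b.
Proof.
move=> c0 hz z0 zn hi t j t0 hj.
apply/andP; split; rewrite -subr_ge0.
- apply: (@heat_comparison c (fun s k => z s k - a)) => //.
  + move=> s k s0 hk; apply: (dv_eq (dvB (hz s k s0 hk) (dvc a s))); ring.
  + by move=> s /z0 /andP[? _]; rewrite subr_ge0.
  + by move=> s /zn /andP[? _]; rewrite subr_ge0.
  + by move=> k /hi /andP[? _]; rewrite subr_ge0.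
- apply: (@heat_comparison c (fun s k => b - z s k)) => //.
  + move=> s k s0 hk; apply: (dv_eq (dvB (dvc b s) (hz s k s0 hk))); ring.
  + by move=> s /z0 /andP[_ ?]; rewrite subr_ge0.
  + by move=> s /zn /andP[_ ?]; rewrite subr_ge0.
  + by move=> k /hi /andP[_ ?]; rewrite subr_ge0.
Qed.

(* The discrete gradient solves the heat equation with Neumann boundary
   conditions, since [z] has constant boundary values. *)
Lemma heat_gradient_bound (c a b M : R) (z : R -> nat -> R) : 0 <= c ->
  (forall (t : R) j, 0 <= t -> (0 < j <= m.+2)%N ->
     dv (z ^~ j) t (c * (z t j.+1 + z t j.-1 - 2 * z t j))) ->
  (forall t : R, z t 0%N = a) -> (forall t : R, z t m.+3 = b) ->
  (forall k, (k <= m.+2)%N -> `|z 0 k.+1 - z 0 k| <= M) ->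
  forall (t : R) k, 0 <= t -> (k <= m.+2)%N -> `|z t k.+1 - z t k| <= M.
Proof.
move=> c0 hz za zb hi.
pose dz (s : R) j : R := if (0 < j <= m.+2)%N then c * (z s j.+1 + z s j.-1 - 2 * z s j) else 0.
have hdz (s : R) j : 0 <= s -> (j <= m.+3)%N -> dv (z ^~ j) s (dz s j).
  move=> s0; rewrite leq_eqVlt => /predU1P[->|jn].
    by rewrite /dz /= ltnn; apply: dv_ext (dvc b s) => r; rewrite zb.
  case: j jn => [_|j jn]; first by apply: dv_ext (dvc a s) => r; rewrite za.
  by rewrite /dz ifT//; exact: hz.
suff main (sg : R) : `|sg| = 1 -> forall (t : R) k, 0 <= t -> (k <= m.+2)%N ->
    0 <= M - sg * (z t k.+1 - z t k).
  move=> t k t0 hk; rewrite ler_norml.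
  have := main 1 (normr1 _) t k t0 hk.
  have := main (-1) (normrN1 _) t k t0 hk; lra.
move=> sg1 t k t0 hk.
pose y (s : R) (i : 'I_m.+3) := M - sg * (z s i.+1 - z s i).
apply: (@comparison R 'I_m.+3 (2 * c) y
  (fun s i => - (sg * (dz s i.+1 - dz s i))) _ _ _ _ t (Ordinal (hk : (k < m.+3)%N)) t0).
- by rewrite mulr_ge0.
- move=> s i s0.
  have h1 := hdz s i.+1 s0 (ltn_ord i).
  have h2 := hdz s i s0 (ltnW (ltn_ord i)).
  by apply: (dv_eq (dvB (dvc M s) (dvZ sg (dvB h1 h2)))); rewrite sub0r.
- move=> s i B s0 hB yi.
  have B0 : 0 <= B by rewrite -oppr_le0; exact: le_trans (hB i) yi.
  have yB j : (j <= m.+2)%N -> - B <= M - sg * (z s j.+1 - z s j).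
    by move=> hj; have := hB (Ordinal (hj : (j < m.+3)%N)).
  (* At an end of the bond that is a reservoir there is no further gradient to compare with, but
     [dz] is 0 there; this is the Neumann condition. *)
  have q1 : - B <= M - sg * (z s i.+2 - z s i.+1) \/ ~~ (0 < i.+1 <= m.+2)%N.
    by case: (boolP (0 < i.+1 <= m.+2)%N); [left; exact: yB|right].
  have q2 : - B <= M - sg * (z s i - z s i.-1) \/ ~~ (0 < i <= m.+2)%N.
    case: (boolP (0 < i <= m.+2)%N); last by right.
    case: (nat_of_ord i) => // j /= hj; left; apply: yB; exact: ltnW.
  rewrite /y in yi.
  have hA : 0 <= sg * (z s i.+1 - z s i) - M by lra.
  have -> : - (2 * c * B) = - (c * B) - c * B by ring.
  have -> : - (sg * (dz s i.+1 - dz s i)) = - (sg * dz s i.+1) + sg * dz s i by ring.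
  apply: lerD.
  + rewrite /dz; case: ifP q1 => h1; last by rewrite mulr0 oppr0 oppr_le0 mulr_ge0.
    case=> // q1; rewrite /= -subr_ge0.
    rewrite [X in 0 <= X](_ : _ = c * ((M - sg * (z s i.+2 - z s i.+1) + B) + (sg * (z s i.+1 - z s i) - M))); last by ring.
    by rewrite mulr_ge0//; lra.
  + rewrite /dz; case: ifP q2 => h1; last by rewrite mulr0 oppr_le0 mulr_ge0.
    case=> // q2; rewrite -subr_ge0.
    rewrite [X in 0 <= X](_ : _ = c * ((M - sg * (z s i - z s i.-1) + B) + (sg * (z s i.+1 - z s i) - M))); last by ring.
    by rewrite mulr_ge0//; lra.
- move=> i; rewrite /y subr_ge0; apply: le_trans (ler_norm _) _.
  by rewrite normrM sg1 mul1r hi// -ltnS.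
Qed.

End HeatComparison.

(** * One- and two-point functions of the exclusion process *)

Section Correlations.
Context {R : realType}.
Variables (rho : R) (m : nat).
Local Notation n := m.+3.
Variable u : R -> nat -> R.
Hypothesis u_left : forall t, u t 0%N = rho.
Hypothesis u_right : forall t, u t m.+3 = rho.
Hypothesis u_heat : forall (t : R) j, (0 < j <= m.+2)%N ->
  dv (u ^~ j) t (n%:R ^+ 2 * (u t j.+1 + u t j.-1 - 2 * u t j)).
Local Notation mu0 := (bernoulli_product (profile (m := m) (u 0))).
Local Notation p := (law_at (@generator R rho n) mu0).

Let n2_ge0 : 0 <= n%:R ^+ 2 :> R. Proof. exact: sqr_ge0. Qed.

Let law0 eta : p 0 eta = mu0 eta.
Proof. by apply: law_at0; exact: generator_lin. Qed.

(** Both sides solve the same heat equation with the same initial and boundary values; [heat_bound]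
    with both bounds equal to 0 is uniqueness for their difference. *)
Lemma law_mean_V (t : R) j : 0 <= t -> (j <= m.+3)%N ->
  \sum_eta p t eta * V rho j eta = u t j - rho.
Proof.
move=> t0 hj.
pose a (s : R) k := \sum_eta p s eta * V rho k eta.
have ha (s : R) k : (0 < k <= m.+2)%N ->
    dv (a ^~ k) s (n%:R ^+ 2 * (a s k.+1 + a s k.-1 - 2 * a s k)).
  move=> hk; apply: (dv_eq (dv_law_at_mean (@generator_lin R rho m) mu0 (V rho k) s)).
  under eq_bigr do rewrite generator_V// mulrCA.
  rewrite -mulr_sumr; congr (_ * _); rewrite /a mulr_sumr -sumrN -!big_split /=.
  by apply: eq_bigr => eta _; ring.
have hl (s : R) : a s 0%N = 0 by apply: big1 => eta _; rewrite V_left mulr0.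
have hr (s : R) : a s m.+3 = 0 by apply: big1 => eta _; rewrite V_right mulr0.
have h0 k : (0 < k <= m.+2)%N -> a 0 k = u 0 k - rho.
  move=> hk; rewrite /a.
  under eq_bigr do rewrite law0.
  under eq_bigr do rewrite V_pos//.
  rewrite (bernoulli_mean1 (profile (u 0)) (pos m k) (fun b => b%:R - rho)) profile_pos//.
  by rewrite /=; ring.
have := @heat_bound R m (n%:R ^+ 2) 0 0 (fun s k => a s k - (u s k - rho)) n2_ge0.
have hd (s : R) k : (0 < k <= m.+2)%N -> dv (fun r => a r k - (u r k - rho)) s
   (n%:R ^+ 2 * ((a s k.+1 - (u s k.+1 - rho)) + (a s k.-1 - (u s k.-1 - rho))
     - 2 * (a s k - (u s k - rho)))).
  move=> hk; apply: (dv_eq (dvB (ha s k hk) (dvB (u_heat s hk) (dvc rho s)))); ring.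
move=> /(_ (fun s k _ => @hd s k)) H.
have /eqP : a t j - (u t j - rho) == 0.
  rewrite eq_le andbC; apply: H => //.
  - by move=> s _; rewrite hl u_left !subrr lexx.
  - by move=> s _; rewrite hr u_right !subrr lexx.
  - by move=> k hk; rewrite h0// subrr lexx.
by move/eqP; rewrite subr_eq0 => /eqP.
Qed.

Variable M : R.
Hypothesis u_grad : forall (t : R) k, 0 <= t -> (k <= m.+2)%N ->
  n%:R ^+ 2 * (u t k.+1 - u t k) ^+ 2 <= M.

(* [j (n - l)] is the Green function of the pair of exclusion particles against
   the nearest-neighbour source, up to a constant. *)
Lemma law_corr_ge (t : R) j l : 0 <= t -> (0 < j)%N -> (j < l)%N -> (l <= m.+2)%N ->
  (u t j - rho) * (u t l - rho) - M / (n%:R ^+ 2 * n.-1%:R) * (j%:R * (n%:R - l%:R))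
   <= \sum_eta p t eta * (V rho j eta * V rho l eta).
Proof.
move=> t0 j0 jl hl.
(* The reflected Laplacian of j (n - l) is -(n - 1) when l = j + 1 and 0 otherwise, so this [K]
   makes the Green term dominate the squared gradient of [u]. *)
pose K : R := M / (n%:R ^+ 2 * n.-1%:R); rewrite -/K.
have n1 : 0 < n%:R ^+ 2 * n.-1%:R :> R by rewrite mulr_gt0.
have KE : n%:R ^+ 2 * (K * n.-1%:R) = M.
  by rewrite mulrCA /K divfK// gt_eqF.
have M0 : 0 <= M.
  by apply: le_trans (u_grad (lexx 0) (leq0n _)); rewrite mulr_ge0// sqr_ge0.
have K0 : 0 <= K by rewrite divr_ge0// ltW.
pose a (s : R) j l := \sum_eta p s eta * (V rho j eta * V rho l eta).
pose v (s : R) j := u s j - rho.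
pose z (s : R) j l := K * (j%:R * (n%:R - l%:R)) - v s j * v s l + a s j l.
rewrite -subr_ge0 [X in 0 <= X](_ : _ = z t j l); last by rewrite /z /v /a; ring.
have v_dv (s : R) k : (0 < k <= m.+2)%N ->
   dv (v ^~ k) s (n%:R ^+ 2 * (v s k.+1 + v s k.-1 - 2 * v s k)).
  move=> hk; apply: (dv_eq (dvB (u_heat s hk) (dvc rho s))); rewrite /v; ring.
(* Away from neighbours this is the plane Laplacian; next to the diagonal the walk is reflected, and
   the source left over is [K * n.-1] minus the squared gradient. *)
pose dz (s : R) j l := n%:R ^+ 2 *
  (if l == j.+1 then z s j.-1 l + z s j l.+1 - 2 * z s j l + (K * n.-1%:R - (u s l - u s j) ^+ 2)
   else z s j.+1 l + z s j.-1 l + z s j l.+1 + z s j l.-1 - 4 * z s j l).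
have hz (s : R) j' l' : (0 < j')%N -> (j' < l')%N -> (l' <= m.+2)%N ->
    dv (fun r => z r j' l') s (dz s j' l').
  move=> j0' jl' hl'.
  have hj : (0 < j' <= m.+2)%N by rewrite j0' (leq_trans (ltnW jl')).
  have hl2 : (0 < l' <= m.+2)%N by rewrite (leq_trans _ jl').
  have h1 := dvB (dvc (K * (j'%:R * (n%:R - l'%:R))) s) (dvM (v_dv s j' hj) (v_dv s l' hl2)).
  have h2 := dv_law_at_mean (@generator_lin R rho m) mu0 (fun x => V rho j' x * V rho l' x) s.
  apply: (dv_eq (dvD h1 h2)).
  under eq_bigr do rewrite generator_VV//.
  rewrite /dz; have [e|ne] := eqVneq l' j'.+1.
  - subst l'; rewrite /=.
    rewrite [X in _ + X = _](_ : _ = n%:R ^+ 2 * (a s j'.-1 j'.+1 + a s j' j'.+2 - 2 * a s j' j'.+1)); last first.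
      rewrite /a !mulr_sumr -sumrN -!big_split mulr_sumr /=.
      by apply: eq_bigr => eta _; ring.
    case: j' j0' {jl' hl' hj hl2 h1 h2} => // i _ /=.
    rewrite /z /v -!natr1; ring.
  - rewrite /=.
    rewrite [X in _ + X = _](_ : _ = n%:R ^+ 2 * (a s j'.+1 l' + a s j'.-1 l' + a s j' l'.+1 + a s j' l'.-1 - 4 * a s j' l')); last first.
      rewrite /a !mulr_sumr -sumrN -!big_split mulr_sumr /=.
      by apply: eq_bigr => eta _; ring.
    case: j' j0' jl' {hl' hj hl2 h1 h2 ne} => // i _ jl' /=; case: l' jl' => // l' jl' /=.
    rewrite /z /v -!natr1; ring.
have z_left (s : R) l' : z s 0%N l' = 0.
  rewrite /z /v u_left subrr !mul0r mulr0 subr0 add0r /a.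
  by apply: big1 => eta _; rewrite V_left mul0r mulr0.
have z_right (s : R) j' : z s j' m.+3 = 0.
  rewrite /z /v u_right !subrr !mulr0 subr0 add0r /a.
  by apply: big1 => eta _; rewrite V_right !mulr0.
have hj : (0 < j <= m.+2)%N by rewrite j0 (leq_trans (ltnW jl)).
have hl2 : (0 < l <= m.+2)%N by rewrite (leq_trans _ jl).
(* Padding by 0 outside the triangle j < l lets [comparison] run over all pairs of sites. *)
pose y (s : R) (q : Lambda n * Lambda n) : R :=
  if (site q.1 < site q.2)%N then z s (site q.1) (site q.2) else 0.
pose dy (s : R) (q : Lambda n * Lambda n) : R :=
  if (site q.1 < site q.2)%N then dz s (site q.1) (site q.2) else 0.
have := @comparison R _ (4 * n%:R ^+ 2) y dy _ _ _ _ t (pos m j, pos m l) t0.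
rewrite /y !pos_site// jl; apply.
- by rewrite mulr_ge0.
- move=> s [q1 q2] s0; rewrite /y /dy /=; case: ifP => hq; last exact: dvc.
  by apply: hz => //; case/andP: (site_range q2).
- move=> s [q1 q2] B s0 hB; rewrite /y /dy /=; case: ifP => hq yq; last first.
    have B0 : 0 <= B by have := hB (q1, q2); rewrite /y /= hq oppr_le0.
    by rewrite oppr_le0 !mulr_ge0.
  have B0 : 0 <= B by have := hB (q2, q1); rewrite /y /= ltnNge (ltnW hq) oppr_le0.
  have zB j' l' : (j' < l')%N -> (l' <= m.+3)%N -> - B <= z s j' l'.
    move=> jl'; rewrite leq_eqVlt => /predU1P[->|ln]; first by rewrite z_right oppr_le0.
    case: j' jl' => [_|j' jl']; first by rewrite z_left oppr_le0.
    have := hB (pos m j'.+1, pos m l'); rewrite /y /= !pos_site ?jl'//.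
    + by rewrite (leq_trans _ jl').
    + by rewrite /= (leq_trans (ltnW jl')).
  have /andP[a1 a2] := site_range q1; have /andP[b1 b2] := site_range q2.
  move: (site q1) (site q2) hq yq a1 a2 b1 b2 => i k ik zik i1 i2 k1 k2.
  have ii : (i.-1 < k)%N by rewrite (leq_ltn_trans (leq_pred _)).
  have r1 := zB i.-1 k ii (leqW k2).
  have r2 := zB i k.+1 (leqW ik) k2.
  rewrite /dz -mulrA [4 * _]mulrC -mulrA -mulrN ler_wpM2l//.
  have [e|ne] := eqVneq k i.+1.
    have hM : (u s k - u s i) ^+ 2 <= K * n.-1%:R.
      by rewrite -(ler_pM2l (_ : 0 < n%:R ^+ 2 :> R)) ?KE ?e ?u_grad// exprn_gt0.
    lra.
  have ik2 : (i.+1 < k)%N by rewrite ltn_neqAle eq_sym ne.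
  have r3 := zB i.+1 k ik2 (leqW k2).
  have r4 : - B <= z s i k.-1.
    apply: zB; last exact: leq_trans (leq_pred _) (leqW k2).
    by rewrite -ltnS prednK.
  lra.
(* At time 0 the law is a product: the covariance vanishes and only the nonnegative Green term is
   left. *)
- move=> [q1 q2]; rewrite /y /=; case: ifP => // hq.
  have /andP[a1 a2] := site_range q1; have /andP[b1 b2] := site_range q2.
  have qq : q1 != q2 by apply/eqP => e; rewrite e ltnn in hq.
  rewrite /z /a.
  under eq_bigr do rewrite law0.
  under eq_bigr do rewrite !V_pos// !site_pos.
  rewrite (bernoulli_mean2 (profile (u 0)) (fun b => b%:R - rho) (fun b => b%:R - rho) qq).
  rewrite [X in 0 <= X](_ : _ = K * ((site q1)%:R * (n%:R - (site q2)%:R))).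
    by rewrite !mulr_ge0// subr_ge0 ler_nat (leq_trans b2).
  by rewrite /v /profile /=; ring.
Qed.

End Correlations.

(** * The log-Sobolev inequality *)

Section Averaging.
Context {R : realType} {n : nat}.
Variable q : Lambda n -> R.
Variable eps : R.
Hypothesis eps0 : 0 < eps.
Hypothesis hq : forall x, eps <= q x <= 1 - eps.
Local Notation psi := (bernoulli_product q).
Implicit Types (x y : Lambda n) (eta : Omega n) (f g h : Omega n -> R).

(** The conditional expectation of [f] under the product measure given the occupations of all sites
    other than [x]. *)
Definition average x f eta : R :=
  bweight (q x) (eta x) * f eta + bweight (q x) (~~ eta x) * f (flip x eta).

Definition flip_energy x g : R :=
  \sum_eta psi eta * (g (flip x eta) - g eta) ^+ 2.

Let bw_ge x b : eps <= bweight (q x) b.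
Proof. by rewrite /bweight; have /andP[h1 h2] := hq x; case: b => /=; lra. Qed.

Let bw_gt0 x b : 0 < bweight (q x) b.
Proof. exact: lt_le_trans (bw_ge x b). Qed.

Let bw_sum x b : bweight (q x) b + bweight (q x) (~~ b) = 1.
Proof. by rewrite /bweight; case: b => /=; ring. Qed.

Let psi_ge0 eta : 0 <= psi eta.
Proof.
apply/ltW; apply: bernoulli_gt0 => x.
by have /andP[h1 h2] := hq x; have h3 := eps0; apply/andP; split; lra.
Qed.

Lemma flipxx x eta : flip x eta x = ~~ eta x.
Proof. by rewrite flipE eqxx. Qed.

Lemma flip_comm x y eta : flip x (flip y eta) = flip y (flip x eta).
Proof. by apply/ffunP => z; rewrite !flipE; case: eqP; case: eqP. Qed.

Lemma average_flip x f eta : average x f (flip x eta) = average x f eta.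
Proof. by rewrite /average flipxx flipK negbK addrC. Qed.

Lemma average_gt0 x f : (forall eta, 0 < f eta) -> forall eta, 0 < average x f eta.
Proof. by move=> f0 eta; rewrite addr_gt0// mulr_gt0. Qed.

Lemma mean_average x f h : (forall eta, h (flip x eta) = h eta) ->
  \sum_eta psi eta * (h eta * average x f eta) = \sum_eta psi eta * (h eta * f eta).
Proof.
move=> hx.
transitivity (\sum_eta (psi eta * bweight (q x) (eta x) * (h eta * f eta)) +
  \sum_eta (psi eta * bweight (q x) (~~ eta x) * (h eta * f (flip x eta)))).
  by rewrite -big_split; apply: eq_bigr => eta _; rewrite /average /=; ring.
rewrite -[X in _ + X](sum_flip x) -big_split; apply: eq_bigr => eta _ /=.
rewrite flipxx negbK flipK hx bernoulli_flip.
by rewrite -mulrDl -mulrDr bw_sum mulr1.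
Qed.

Lemma mean_average1 x f : \sum_eta psi eta * average x f eta = \sum_eta psi eta * f eta.
Proof.
have := @mean_average x f (fun=> 1) (fun _ => erefl).
by under eq_bigr do rewrite mul1r; under [in RHS]eq_bigr do rewrite mul1r.
Qed.

(** Joint convexity of (sqrt x - sqrt y)^2: after expansion only the cross terms differ, and they
    are ordered by Cauchy-Schwarz. It ensures that averaging at one site does not raise the flip
    energy at another. *)
Lemma sqrtr_sub_sqr_convex (a b a1 b1 a2 b2 : R) : 0 <= a -> 0 <= b ->
  0 <= a1 -> 0 <= b1 -> 0 <= a2 -> 0 <= b2 ->
  (Num.sqrt (a * a1 + b * a2) - Num.sqrt (a * b1 + b * b2)) ^+ 2 <=
  a * (Num.sqrt a1 - Num.sqrt b1) ^+ 2 + b * (Num.sqrt a2 - Num.sqrt b2) ^+ 2.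
Proof.
move=> a0 b0 ha1 hb1 ha2 hb2.
have e1 : 0 <= a * a1 + b * a2 by rewrite addr_ge0// mulr_ge0.
have e2 : 0 <= a * b1 + b * b2 by rewrite addr_ge0// mulr_ge0.
have cs : a * (Num.sqrt a1 * Num.sqrt b1) + b * (Num.sqrt a2 * Num.sqrt b2) <=
   Num.sqrt (a * a1 + b * a2) * Num.sqrt (a * b1 + b * b2).
  rewrite -[leRHS]sqrtrM// -[leLHS]ger0_norm; last first.
    by rewrite addr_ge0// !mulr_ge0 ?sqrtr_ge0.
  rewrite -sqrtr_sqr ler_wsqrtr//.
  have -> : a * a1 + b * a2 = a * Num.sqrt a1 ^+ 2 + b * Num.sqrt a2 ^+ 2.
    by rewrite !sqr_sqrtr.
  have -> : a * b1 + b * b2 = a * Num.sqrt b1 ^+ 2 + b * Num.sqrt b2 ^+ 2.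
    by rewrite !sqr_sqrtr.
  move: (Num.sqrt a1) (Num.sqrt a2) (Num.sqrt b1) (Num.sqrt b2) => s t v w.
  rewrite -subr_ge0 [X in 0 <= X](_ : _ = a * b * (s * w - t * v) ^+ 2); last by ring.
  by rewrite mulr_ge0 ?sqr_ge0// mulr_ge0.
rewrite !sqrrB !sqr_sqrtr//; lra.
Qed.

Lemma flip_energy_average x y f : (forall eta, 0 < f eta) ->
  flip_energy y (fun eta => Num.sqrt (average x f eta)) <=
  flip_energy y (fun eta => Num.sqrt (f eta)).
Proof.
move=> f0; rewrite /flip_energy.
rewrite -(mean_average1 x (fun eta => (Num.sqrt (f (flip y eta)) - Num.sqrt (f eta)) ^+ 2)).
apply: ler_sum => eta _; rewrite ler_wpM2l//.
have [->|yx] := eqVneq y x.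
  rewrite average_flip subrr expr0n /= addr_ge0// mulr_ge0 ?sqr_ge0// ltW//.
rewrite /average flip_comm flipE eq_sym (negbTE yx).
by apply: sqrtr_sub_sqr_convex; rewrite ltW.
Qed.

(** Entropy is bounded by a chi-square through [ln x <= x - 1]. The factor 2 is (s + t)^2 <= 2 (s^2
    + t^2), and 1 / eps comes from the average being at least [eps * (f eta + f (flip x eta))]. *)
Lemma site_entropy x f : (forall eta, 0 < f eta) ->
  \sum_eta psi eta * (f eta * (ln (f eta) - ln (average x f eta))) <=
  2 / eps * flip_energy x (fun eta => Num.sqrt (f eta)).
Proof.
move=> f0; have Af0 := average_gt0 x f0.
apply: (@le_trans _ _ (\sum_eta psi eta * ((f eta - average x f eta) ^+ 2 / average x f eta
   + (f eta - average x f eta)))).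
  apply: ler_sum => eta _; rewrite ler_wpM2l//.
  have h : ln (f eta) - ln (average x f eta) <= f eta / average x f eta - 1.
    by rewrite -ln_div ?posrE//; apply: ln_le_subr1; rewrite divr_gt0.
  apply: (@le_trans _ _ (f eta * (f eta / average x f eta - 1))).
    by rewrite ler_wpM2l// ltW.
  rewrite le_eqVlt; apply/orP; left; apply/eqP; field.
  by rewrite gt_eqF.
under eq_bigr do rewrite mulrDr.
rewrite big_split /= -[leRHS]addr0; apply: lerD; last first.
  under eq_bigr do rewrite mulrBr.
  by rewrite sumrB mean_average1 subrr.
rewrite /flip_energy mulr_sumr; apply: ler_sum => eta _.
rewrite [leRHS]mulrCA ler_wpM2l//.
rewrite ler_pdivrMr//.
set b := bweight (q x) (~~ eta x).
have -> : f eta - average x f eta = b * (f eta - f (flip x eta)).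
  by rewrite /average -[f eta in X in X - _]mul1r -(bw_sum x (eta x)) -/b; ring.
have b1 : b <= 1 by have := bw_sum x (eta x); have := bw_gt0 x (eta x); rewrite -/b; lra.
have b0 : 0 < b by exact: bw_gt0.
have A1 : eps * (f eta + f (flip x eta)) <= average x f eta.
  rewrite mulrDr; apply: lerD; rewrite ler_pM2r// bw_ge//.
set s := Num.sqrt (f eta); set t := Num.sqrt (f (flip x eta)).
have sE : f eta = s ^+ 2 by rewrite sqr_sqrtr// ltW.
have tE : f (flip x eta) = t ^+ 2 by rewrite sqr_sqrtr// ltW.
rewrite sE tE in A1 *.
apply: (@le_trans _ _ (2 / eps * (t - s) ^+ 2 * (eps * (s ^+ 2 + t ^+ 2)))); last first.
  by rewrite ler_wpM2l// mulr_ge0 ?sqr_ge0// divr_ge0// ltW.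
have -> : 2 / eps * (t - s) ^+ 2 * (eps * (s ^+ 2 + t ^+ 2)) = (t - s) ^+ 2 * (2 * (s ^+ 2 + t ^+ 2)).
  by field; rewrite gt_eqF.
have -> : (b * (s ^+ 2 - t ^+ 2)) ^+ 2 = (t - s) ^+ 2 * (b ^+ 2 * (s + t) ^+ 2) by ring.
rewrite ler_wpM2l ?sqr_ge0//.
apply: (@le_trans _ _ (1 * (s + t) ^+ 2)).
  by rewrite ler_wpM2r ?sqr_ge0// expr_le1// ltW.
have := sqr_ge0 (s - t); rewrite mul1r; lra.
Qed.

Definition average_seq (s : seq (Lambda n)) f := foldl (fun f x => average x f) f s.

Lemma mean_average_seq s f :
  \sum_eta psi eta * average_seq s f eta = \sum_eta psi eta * f eta.
Proof. by elim: s f => //= x s ih f; rewrite ih mean_average1. Qed.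

(** Tensorisation: each averaging step loses a one-site entropy, and [flip_energy_average] replaces
    the energy of the partly averaged function by that of [f]. *)
Lemma average_seq_entropy s f : (forall eta, 0 < f eta) ->
  \sum_eta psi eta * (f eta * ln (f eta)) -
  \sum_eta psi eta * (average_seq s f eta * ln (average_seq s f eta)) <=
  2 / eps * \sum_(x <- s) flip_energy x (fun eta => Num.sqrt (f eta)).
Proof.
have e20 : 0 <= 2 / eps by rewrite divr_ge0// ltW.
elim: s f => [|x s ih] f f0; first by rewrite big_nil mulr0 subrr.
rewrite big_cons mulrDr /= .
have h1 := ih (average x f) (average_gt0 x f0).
have h2 := site_entropy x f0.
have h3 : \sum_(y <- s) flip_energy y (fun eta => Num.sqrt (average x f eta)) <=
          \sum_(y <- s) flip_energy y (fun eta => Num.sqrt (f eta)).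
  by apply: ler_sum => y _; exact: flip_energy_average.
have h4 := ler_wpM2l e20 h3.
have h5 : \sum_eta psi eta * (average x f eta * ln (average x f eta)) =
          \sum_eta psi eta * (f eta * ln (average x f eta)).
  under eq_bigr do rewrite [average x f _ * _]mulrC.
  rewrite (@mean_average x f (fun eta => ln (average x f eta))).
    by apply: eq_bigr => eta _; congr (_ * _); rewrite mulrC.
  by move=> eta; rewrite average_flip.
have h6 : \sum_eta psi eta * (f eta * (ln (f eta) - ln (average x f eta))) =
   \sum_eta psi eta * (f eta * ln (f eta)) - \sum_eta psi eta * (f eta * ln (average x f eta)).
  by rewrite -sumrB; apply: eq_bigr => eta _; ring.
rewrite {}h6 in h2; rewrite {}h5 in h1; rewrite /average_seq /= in h1 *.
lra.
Qed.

Lemma average_seq_flip s f x : x \in s ->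
  forall eta, average_seq s f (flip x eta) = average_seq s f eta.
Proof.
have keep y g : (forall eta, g (flip x eta) = g eta) ->
    forall eta, average y g (flip x eta) = average y g eta.
  move=> hg eta; have [->|yx] := eqVneq y x; first exact: average_flip.
  by rewrite /average flip_comm !hg flipE (negbTE yx).
have keeps r g : (forall eta, g (flip x eta) = g eta) ->
    forall eta, average_seq r g (flip x eta) = average_seq r g eta.
  by elim: r g => //= y r ih g hg; apply: ih; exact: keep.
elim: s f => //= y s ih f; rewrite inE => /predU1P[<-|]; last exact: ih.
exact: keeps (average_flip _ _).
Qed.

Lemma flip_invariant_cst f : (forall x eta, f (flip x eta) = f eta) ->
  forall eta eta', f eta = f eta'.
Proof.
move=> hf eta eta'.
have [z hz e] : exists2 z : Omega n, {in enum (Lambda n), forall x, z x = eta' x} & f z = f eta.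
  elim: (enum _) => [|x s [z hz e]]; first by exists eta.
  have [zx|zx] := eqVneq (z x) (eta' x).
    by exists z => // y; rewrite inE => /predU1P[->|/hz].
  exists (flip x z); last by rewrite hf.
  move=> y; rewrite inE flipE; have [->|yx] /= := eqVneq y x.
    by move: zx; case: (z x); case: (eta' x).
  by move=> /hz.
have -> : eta' = z by apply/ffunP => x; rewrite hz// mem_enum.
by [].
Qed.

(** Averaging over every site leaves the constant 1, whose entropy is 0, so the entropy lost on the
    way is the whole entropy. *)
Lemma product_entropy f : (forall eta, 0 < f eta) -> \sum_eta psi eta * f eta = 1 ->
  \sum_eta psi eta * (f eta * ln (f eta)) <=
  2 / eps * \sum_x flip_energy x (fun eta => Num.sqrt (f eta)).
Proof.
move=> f0 f1; pose F := average_seq (enum (Lambda n)) f.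
have F1 eta : F eta = 1.
  rewrite -f1 -(mean_average_seq (enum (Lambda n))) -/F.
  have hF eta' : F eta' = F eta.
    by apply: flip_invariant_cst => x z; apply: average_seq_flip; rewrite mem_enum.
  under eq_bigr do rewrite hF.
  by rewrite -mulr_suml bernoulli_sum1 mul1r.
have := average_seq_entropy (enum (Lambda n)) f0; rewrite -/F.
rewrite [X in _ - X]big1; last by move=> eta _; rewrite F1 ln1 !mulr0.
by rewrite subr0 big_enum.
Qed.

End Averaging.

(** * Transporting flips to the reservoir *)

Section LogSobolev.
Context {R : realType}.
Variables (rho : R) (m : nat) (U : nat -> R) (eps M : R).
Local Notation n := m.+3.
Hypothesis eps0 : 0 < eps.
Hypothesis U_adm : admissible rho m U.
Hypothesis U_eps : forall j, (j <= m.+3)%N -> eps <= U j <= 1 - eps.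
Hypothesis U_grad : forall k, (k <= m.+2)%N -> n%:R * `|U k.+1 - U k| <= M.
Local Notation psi := (bernoulli_product (profile (m := m) U)).
Implicit Types (eta : Omega n) (g : Omega n -> R).

Let K := 2 * M / eps + M ^+ 2 / eps ^+ 2.

Let M0 : 0 <= M.
Proof. by apply: le_trans (U_grad (leq0n _)); rewrite mulr_ge0. Qed.

Let K0 : 0 <= K.
Proof. by rewrite addr_ge0// divr_ge0 ?mulr_ge0 ?sqr_ge0// ltW. Qed.

Let psi0 eta : 0 < psi eta. Proof. exact: profile_gt0 U_adm. Qed.

Lemma W_bound j eta : `|W U j eta| <= eps^-1.
Proof.
have ei : 0 <= eps^-1 by rewrite invr_ge0 ltW.
rewrite /W; case: ifP => hj; last by rewrite normr0.
have /andP[h1 h2] : eps <= U j <= 1 - eps by apply: U_eps; case/andP: hj => _ /leqW.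
have e0 := eps0.
have a0 : 0 < U j by lra.
have a1 : 0 < 1 - U j by lra.
rewrite /omega; case: (eta _) => /=.
- rewrite [X in `|X|](_ : _ = (U j)^-1); last by field; rewrite !gt_eqF.
  by rewrite ger0_norm ?invr_ge0 ?(ltW a0)// lef_pV2 ?posrE.
- rewrite [X in `|X|](_ : _ = - (1 - U j)^-1); last by field; rewrite !gt_eqF.
  rewrite normrN ger0_norm ?invr_ge0 ?(ltW a1)// lef_pV2 ?posrE//; lra.
Qed.

(** Neighbouring densities differ by at most M / n and the scores are at most 1 / eps, so
    [bond_ratio] changes the weight by a factor 1 + O(1/n), harmless when repeated at most n
    times. *)
Lemma psi_jump k eta : (0 < k < m.+2)%N -> psi (jump k eta) <= (1 + K / n%:R) * psi eta.
Proof.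
move=> hk; have /andP[k0 km] := hk.
have := bond_ratio eta U_adm (ltnW km); rewrite !rate_bulk// !mulr1 => e.
have -> : psi (jump k eta) = psi eta + (psi (jump k eta) - psi eta) by ring.
rewrite e [leRHS]mulrDl mul1r lerD2l [leRHS]mulrC ler_wpM2l ?(ltW (psi0 _))//.
have hd := U_grad (ltnW km).
have n0 : 0 < n%:R :> R by [].
set d := U k.+1 - U k in hd *; set a := W U k eta; set b := W U k.+1 eta.
have ha : `|a| <= eps^-1 := W_bound k eta; have hb : `|b| <= eps^-1 := W_bound k.+1 eta.
have ei : 0 <= eps^-1 by rewrite invr_ge0 ltW.
have hd' : `|d| <= M / n%:R by rewrite ler_pdivlMr// mulrC.
have hM : 0 <= M / n%:R by rewrite divr_ge0 ?M0.
apply: le_trans (ler_norm _) _; apply: le_trans (ler_normB _ _) _.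
have -> : K / n%:R = M / n%:R * (eps^-1 + eps^-1) + (M / n%:R * M) * (eps^-1 * eps^-1).
  by rewrite /K; field; rewrite gt_eqF//= gt_eqF.
apply: lerD.
- by rewrite normrM ler_pM// (le_trans (ler_normB _ _))// lerD.
- rewrite !normrM; apply: ler_pM; rewrite ?mulr_ge0//.
  + apply: ler_pM => //; apply: le_trans hd' _.
    by rewrite ler_pdivrMr// ler_peMr ?M0// ler1n.
  + exact: ler_pM.
Qed.

Lemma psi_flip (x : Lambda n) eta : psi (flip x eta) <= eps^-1 * psi eta.
Proof.
have /andP[h1 h2] := U_eps (leqW (andP (site_range x)).2).
have h b : eps <= bweight (profile U x) b <= 1.
  by rewrite /bweight /profile; have e0 := eps0; case: b => /=; apply/andP; split; lra.
have /andP[b1 _] := h (eta x); have /andP[_ b2] := h (~~ eta x).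
have b0 := lt_le_trans eps0 b1.
have e := bernoulli_flip (profile U) x eta.
rewrite -(ler_pM2r b0) e.
apply: (@le_trans _ _ (psi eta)); first by rewrite ler_piMr// ltW.
rewrite [leRHS](_ : _ = psi eta * (bweight (profile U x) (eta x) / eps)); last by ring.
by rewrite ler_peMr ?(ltW (psi0 _))// ler_pdivlMr// mul1r.
Qed.

Lemma exchange_flip (x y : Lambda n) eta :
  exchange x y (flip x (exchange x y eta)) = flip y eta.
Proof.
have e z : (tperm x y z == x) = (z == y).
  by rewrite -(can_eq (tpermK x y) (tperm x y z)) tpermK tpermL.
by apply/ffunP => z; rewrite exchangeE !flipE exchangeE tpermK e.
Qed.

Definition bond_energy k g : R :=
  \sum_eta psi eta * (rate rho k eta * (g (jump k eta) - g eta) ^+ 2).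

Lemma flip_jump k eta : (0 < k < m.+2)%N ->
  flip (pos m k.+1) eta = jump k (flip (pos m k) (jump k eta)).
Proof.
by move=> /andP[k0 km]; rewrite /jump (gtn_eqF k0) (ltn_eqF km) exchange_flip.
Qed.

(** Young weights: 1 + 1/n on the flip that is carried along, at the price 1 + n on the two
    exchanges. *)
Let a1 : R := 1 + n%:R^-1.
Let a2 : R := 1 + n%:R.

Lemma sqr_add3 (a b c : R) : (a + b + c) ^+ 2 <= a1 * b ^+ 2 + 2 * a2 * (a ^+ 2 + c ^+ 2).
Proof.
have n0 : 0 < n%:R :> R by [].
have h1 : (b + (a + c)) ^+ 2 <= a1 * b ^+ 2 + a2 * (a + c) ^+ 2.
  rewrite -subr_ge0 [X in 0 <= X](_ : _ = n%:R^-1 * (b - n%:R * (a + c)) ^+ 2).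
    by rewrite mulr_ge0 ?sqr_ge0.
  by rewrite /a1 /a2; field; rewrite -natrD pnatr_eq0.
have h2 : a2 * (a + c) ^+ 2 <= a2 * (2 * (a ^+ 2 + c ^+ 2)).
  apply: ler_wpM2l; first exact: addr_ge0.
  by have h := sqr_ge0 (a - c); lra.
have -> : a + b + c = b + (a + c) by ring.
by rewrite [2 * a2]mulrC -mulrA; apply: le_trans h1 _; rewrite lerD2l.
Qed.

(** The flip at the next site is the flip at [pos m k] conjugated by an exchange. Changing variables
    costs 1 + K/n in the flip term, and a further 1/eps ([psi_flip]) for the exchange made after the
    flip. *)
Lemma flip_energy_step k g : (0 < k < m.+2)%N ->
  flip_energy (profile U) (pos m k.+1) g <=
  (1 + n%:R^-1) * (1 + K / n%:R) * flip_energy (profile U) (pos m k) g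
  + 2 * (1 + n%:R) * ((1 + K) / eps + 1) * bond_energy k g.
Proof.
move=> hk; have n0 : 0 < n%:R :> R by [].
pose S (eta : Omega n) := jump k eta; pose F (eta : Omega n) := flip (pos m k) eta.
have KK : 1 + K / n%:R <= 1 + K by rewrite lerD2l ler_pdivrMr// ler_peMr// ler1n.
have K1 : 0 <= 1 + K by rewrite addr_ge0.
have rK : 0 <= 1 + K / n%:R by rewrite addr_ge0// divr_ge0.
apply: (@le_trans _ _ (\sum_eta psi eta * (a1 * (g (F (S eta)) - g (S eta)) ^+ 2 +
  2 * a2 * ((g (S (F (S eta))) - g (F (S eta))) ^+ 2 + (g (S eta) - g eta) ^+ 2)))).
  apply: ler_sum => eta _; rewrite ler_wpM2l ?(ltW (psi0 _))// flip_jump//.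
  rewrite -/(S eta) -/(F (S eta)) -/(S (F (S eta))).
  rewrite [X in X ^+ 2](_ : _ = (g (S (F (S eta))) - g (F (S eta))) +
     (g (F (S eta)) - g (S eta)) + (g (S eta) - g eta)); last by ring.
  exact: sqr_add3.
have h1 : \sum_eta psi eta * (g (F (S eta)) - g (S eta)) ^+ 2 <=
    (1 + K / n%:R) * flip_energy (profile U) (pos m k) g.
  rewrite -(sum_jump k) /flip_energy mulr_sumr; apply: ler_sum => eta _.
  rewrite /S jumpK mulrA ler_wpM2r ?sqr_ge0//; exact: psi_jump.
have h2 : \sum_eta psi eta * (g (S (F (S eta))) - g (F (S eta))) ^+ 2 <=
    (1 + K) / eps * bond_energy k g.
  rewrite -(sum_jump k) -(sum_flip (pos m k)) /bond_energy mulr_sumr.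
  apply: ler_sum => eta _.
  rewrite /S /F jumpK flipK rate_bulk// mul1r mulrA ler_wpM2r ?sqr_ge0//.
  apply: le_trans (psi_jump _ hk) _; rewrite -mulrA.
  apply: ler_pM => //; first exact: ltW.
  exact: psi_flip.
have h3 : \sum_eta psi eta * (g (S eta) - g eta) ^+ 2 = bond_energy k g.
  by apply: eq_bigr => eta _; rewrite rate_bulk// mul1r.
rewrite [leLHS](_ : _ = a1 * \sum_eta psi eta * (g (F (S eta)) - g (S eta)) ^+ 2 +
   2 * a2 * (\sum_eta psi eta * (g (S (F (S eta))) - g (F (S eta))) ^+ 2 +
    \sum_eta psi eta * (g (S eta) - g eta) ^+ 2)); last first.
  by rewrite -big_split !mulr_sumr -big_split; apply: eq_bigr => eta _ /=; ring.
rewrite h3; apply: lerD; first by rewrite -mulrA ler_wpM2l// addr_ge0// invr_ge0.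
rewrite -[leRHS]mulrA ler_wpM2l//; first by rewrite mulr_ge0// addr_ge0.
by rewrite mulrDl mul1r lerD2r.
Qed.

Lemma bond_energy_ge0 k g : 0 < rho < 1 -> 0 <= bond_energy k g.
Proof.
move=> hr; apply: sumr_ge0 => eta _.
by rewrite mulr_ge0 ?(ltW (psi0 _))// mulr_ge0 ?rate_ge0// sqr_ge0.
Qed.

(** Start of the transport: the left reservoir flips site 1 at rate [rho] or [1 - rho], both at
    least [eps]. *)
Lemma flip_energy_first g : flip_energy (profile U) (pos m 1) g <= eps^-1 * bond_energy 0 g.
Proof.
rewrite mulrC ler_pdivlMr// mulrC /flip_energy /bond_energy mulr_sumr.
apply: ler_sum => eta _; rewrite mulrCA ler_wpM2l ?(ltW (psi0 _))//.
rewrite /jump /= ler_wpM2r ?sqr_ge0//.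
have [e _ _] := U_adm; have := U_eps (leq0n _); rewrite e rate_left /resv_rate.
by move=> /andP[e1 e2]; case: (eta _); lra.
Qed.

Let r : R := (1 + n%:R^-1) * (1 + K / n%:R).
Let C1 : R := 2 * (1 + n%:R) * ((1 + K) / eps + 1).

Let r1 : 1 <= r.
Proof.
have h1 : 0 <= n%:R^-1 :> R by [].
have h2 : 0 <= K / n%:R by rewrite divr_ge0.
rewrite /r mulrDl mul1r -addrA lerDl; apply: addr_ge0 => //; apply: mulr_ge0 => //; exact: addr_ge0.
Qed.

Let C10 : 0 <= C1.
Proof.
apply: mulr_ge0; first by apply: mulr_ge0 => //; exact: addr_ge0.
by apply: addr_ge0 => //; apply: divr_ge0; [exact: addr_ge0 | exact: ltW].
Qed.

Lemma flip_energy_bound j g : 0 < rho < 1 -> (j <= m.+1)%N ->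
  flip_energy (profile U) (pos m j.+1) g <=
  r ^+ j * (eps^-1 + C1) * \sum_(0 <= k < j.+1) bond_energy k g.
Proof.
move=> hr; elim: j => [|j ih] hj.
  rewrite expr0 mul1r big_nat1; apply: le_trans (flip_energy_first g) _.
  by rewrite ler_wpM2r ?bond_energy_ge0// lerDl.
apply: le_trans (flip_energy_step g (_ : (0 < j.+1 < m.+2)%N)) _ => //.
have S0 : 0 <= \sum_(0 <= k < j.+1) bond_energy k g.
  by apply: sumr_ge0 => k _; exact: bond_energy_ge0.
have B0 := bond_energy_ge0 j.+1 g hr.
rewrite [X in _ <= _ * X]big_nat_recr//= [leRHS]mulrDr; apply: lerD.
  rewrite exprS -[leRHS]mulrA -[leRHS]mulrA.
  by apply: ler_wpM2l; [exact: le_trans ler01 r1 | rewrite mulrA; apply: ih; exact: ltnW].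
rewrite -/C1 ler_wpM2r// -[leLHS]mul1r ler_pM ?exprn_ege1//.
by rewrite lerDr invr_ge0 ltW.
Qed.

(** One factor [n] comes from the Young weight in [C1], the other from the number of sites; the
    iterated factor obeys [r ^+ n <= expR (1 + K)]. *)
Lemma total_flip_energy g : 0 < rho < 1 ->
  \sum_x flip_energy (profile U) x g <=
  expR (1 + K) * (eps^-1 + 4 * ((1 + K) / eps + 1)) *
   (n%:R ^+ 2 * dirichlet rho psi g).
Proof.
move=> hr; have n0 : 0 < n%:R :> R by [].
have DE : dirichlet rho psi g = \sum_(0 <= k < n) bond_energy k g by [].
have D0 : 0 <= dirichlet rho psi g.
  by rewrite DE; apply: sumr_ge0 => k _; exact: bond_energy_ge0.
have rn : r ^+ n <= expR (1 + K).
  have h : r <= expR ((1 + K) / n%:R).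
    rewrite mulrDl mul1r expRD; apply: ler_pM.
    - by rewrite addr_ge0// invr_ge0.
    - by rewrite addr_ge0// divr_ge0.
    - exact: expR_ge1Dx.
    - exact: expR_ge1Dx.
  apply: (@le_trans _ _ (expR ((1 + K) / n%:R) ^+ n)).
    by rewrite lerXn2r// nnegrE ?expR_ge0// (le_trans ler01 r1).
  by rewrite -expRM_natl mulrC divfK// gt_eqF.
have cn : eps^-1 + C1 <= n%:R * (eps^-1 + 4 * ((1 + K) / eps + 1)).
  have e1 : 0 <= eps^-1 by rewrite invr_ge0 ltW.
  have e2 : 0 <= (1 + K) / eps + 1.
    by apply: addr_ge0 => //; apply: divr_ge0; [exact: addr_ge0 | exact: ltW].
  have n1 : 1 <= n%:R :> R by rewrite ler1n.
  rewrite mulrDr; apply: lerD; first by rewrite ler_peMl.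
  rewrite /C1 mulrA ler_wpM2r//; lra.
rewrite big_sites big_nat.
apply: (@le_trans _ _ (\sum_(1 <= j < n | (0 < j < n)%N)
   (expR (1 + K) * (n%:R * (eps^-1 + 4 * ((1 + K) / eps + 1))) * dirichlet rho psi g))).
  apply: ler_sum => j /andP[j0 jn].
  have e0 : 0 <= eps^-1 by rewrite invr_ge0 ltW.
  case: j j0 jn => // j _ jn.
  apply: le_trans (flip_energy_bound g hr (_ : (j <= m.+1)%N)) _ => //.
  apply: ler_pM.
  - by apply: mulr_ge0; [apply: exprn_ge0; exact: le_trans ler01 r1 | exact: addr_ge0].
  - by apply: sumr_ge0 => k _; exact: bond_energy_ge0.
  - apply: ler_pM => //; [by apply: exprn_ge0; exact: le_trans ler01 r1 | exact: addr_ge0 |].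
    by apply: le_trans rn; rewrite ler_weXn2l// ltnW// ltnW.
  - rewrite DE (@big_cat_nat _ _ _ j.+1 0 n)//=; last exact: ltnW.
    by rewrite lerDl; apply: sumr_ge0 => k _; exact: bond_energy_ge0.
rewrite -big_nat big_const_nat iter_addr_0 subSS subn0 -[leLHS]mulr_natl.
set c := expR (1 + K); set d := (eps^-1 + _).
have c0 : 0 <= c by exact: expR_ge0.
have d0 : 0 <= d.
  apply: addr_ge0; first by rewrite invr_ge0 ltW.
  apply: mulr_ge0 => //; apply: addr_ge0 => //.
  by apply: divr_ge0; [exact: addr_ge0 | exact: ltW].
rewrite [leRHS](_ : _ = n%:R * (c * (n%:R * d) * dirichlet rho psi g)); last by ring.
by rewrite ler_wpM2r ?ler_nat// mulr_ge0// mulr_ge0// mulr_ge0.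
Qed.

(* Uniform in the size [m]: the diffusive factor [n^2] compensates for the
   length of the path that carries a flip from a site to the reservoir. *)
Definition lsi_constant : R :=
  2 / eps * (expR (1 + K) * (eps^-1 + 4 * ((1 + K) / eps + 1))).

Lemma lsi_constant_gt0 : 0 < lsi_constant.
Proof.
rewrite /lsi_constant mulr_gt0 ?divr_gt0// mulr_gt0 ?expR_gt0//.
apply: ltr_pwDl; first by rewrite invr_gt0.
apply: mulr_ge0 => //; apply: addr_ge0 => //.
by apply: divr_ge0; [exact: addr_ge0 | exact: ltW].
Qed.

Lemma log_sobolev (f : Omega n -> R) : 0 < rho < 1 ->
  (forall eta, 0 < f eta) -> \sum_eta psi eta * f eta = 1 ->
  \sum_eta psi eta * (f eta * ln (f eta)) <=
  lsi_constant * (n%:R ^+ 2 * dirichlet rho psi (fun eta => Num.sqrt (f eta))).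
Proof.
move=> hr f0 f1.
apply: le_trans (@product_entropy R n (profile U) eps eps0 _ f f0 f1) _.
  by move=> x; apply: U_eps; exact: leqW (andP (site_range x)).2.
rewrite /lsi_constant -[leRHS]mulrA ler_wpM2l ?divr_ge0 ?(ltW eps0)//.
exact: total_flip_energy.
Qed.

End LogSobolev.

(** * Relaxation to the product measure *)

Section Hellinger.
Context {R : realType} {T : finType}.
Variables (p q : T -> R).
Hypothesis p0 : forall x, 0 < p x.
Hypothesis q0 : forall x, 0 < q x.
Hypothesis p1 : \sum_x p x = 1.
Hypothesis q1 : \sum_x q x = 1.

Let a x := Num.sqrt (p x).
Let b x := Num.sqrt (q x).
Let aE x : p x = a x ^+ 2. Proof. by rewrite sqr_sqrtr// ltW. Qed.
Let bE x : q x = b x ^+ 2. Proof. by rewrite sqr_sqrtr// ltW. Qed.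
Let a0 x : 0 < a x. Proof. by rewrite sqrtr_gt0. Qed.
Let b0 x : 0 < b x. Proof. by rewrite sqrtr_gt0. Qed.

(** Sum [ln_sqr_le] over the points; the linear terms cancel because both masses are 1. *)
Lemma hellinger_le_entropy :
  \sum_x (Num.sqrt (p x) - Num.sqrt (q x)) ^+ 2 <= \sum_x p x * (ln (p x) - ln (q x)).
Proof.
rewrite -/a -/b.
have e : \sum_x (a x - b x) ^+ 2 = \sum_x ((a x - b x) ^+ 2 + (p x - q x)).
  by rewrite big_split /= sumrB p1 q1 subrr addr0.
rewrite e; apply: ler_sum => x _.
have := ln_sqr_le (a0 x) (b0 x); rewrite -/(a x) -/(b x) -aE -bE => h.
have : (b x - a x) ^+ 2 = (a x - b x) ^+ 2 by ring.
lra.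
Qed.

Lemma sqr_sum_mul (f g : T -> R) :
  (\sum_x f x * g x) ^+ 2 <= (\sum_x f x ^+ 2) * (\sum_x g x ^+ 2).
Proof.
have h : 0 <= \sum_x \sum_y (f x * g y - f y * g x) ^+ 2.
  by apply: sumr_ge0 => x _; apply: sumr_ge0 => y _; exact: sqr_ge0.
have e : \sum_x \sum_y (f x * g y - f y * g x) ^+ 2 =
   2 * ((\sum_x f x ^+ 2) * (\sum_x g x ^+ 2)) - 2 * (\sum_x f x * g x) ^+ 2.
  transitivity (\sum_x (f x ^+ 2 * (\sum_y g y ^+ 2) + g x ^+ 2 * (\sum_y f y ^+ 2)
      - 2 * (f x * g x) * (\sum_y f y * g y))).
    apply: eq_bigr => x _; rewrite !mulr_sumr -sumrN -!big_split /=.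
    by apply: eq_bigr => y _; ring.
  by rewrite sumrB big_split /= -!mulr_suml -mulr_sumr; ring.
lra.
Qed.

(** Factor |p - q| as |a - b| (a + b) with a and b the square roots, then apply Cauchy-Schwarz. The
    sum of (a + b)^2 is at most 4, which offsets the half in [tv_fin]. *)
Lemma tv_le_entropy :
  tv_fin p q <= Num.sqrt (\sum_x p x * (ln (p x) - ln (q x))).
Proof.
have tv0 : 0 <= tv_fin p q by rewrite /tv_fin mulr_ge0 ?invr_ge0// sumr_ge0.
rewrite -[leLHS]ger0_norm// -sqrtr_sqr ler_wsqrtr//.
apply: le_trans _ hellinger_le_entropy; rewrite -/a -/b /tv_fin.
have -> : \sum_x `|p x - q x| = \sum_x `|a x - b x| * (a x + b x).
  apply: eq_bigr => x _.
  by rewrite -[X in _ * X]ger0_norm ?addr_ge0 ?sqrtr_ge0// -normrM aE bE; congr `|_|; ring.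
rewrite exprMn.
have h := sqr_sum_mul (fun x => `|a x - b x|) (fun x => a x + b x).
have h2 : \sum_x (a x + b x) ^+ 2 <= 4.
  apply: (@le_trans _ _ (\sum_x (2 * p x + 2 * q x))).
    by apply: ler_sum => x _; rewrite aE bE; have := sqr_ge0 (a x - b x); lra.
  by rewrite big_split /= -!mulr_sumr p1 q1; lra.
have e : \sum_x `|a x - b x| ^+ 2 = \sum_x (a x - b x) ^+ 2.
  by apply: eq_bigr => x _; rewrite real_normK ?num_real.
rewrite e in h.
have S0 : 0 <= \sum_x (a x - b x) ^+ 2 by apply: sumr_ge0 => x _; exact: sqr_ge0.
have h3 := ler_wpM2l S0 h2.
have -> : (2^-1 : R) ^+ 2 = 4^-1 by field.
rewrite ler_pdivrMl//; lra.
Qed.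

End Hellinger.

Section Relaxation.
Context {R : realType}.
Variables (rho : R) (m : nat) (u : R -> nat -> R) (eps M E0 c : R).
Local Notation n := m.+3.
Hypothesis eps0 : 0 < eps.
Hypothesis E00 : 0 <= E0.
Hypothesis u_left : forall t, u t 0%N = rho.
Hypothesis u_right : forall t, u t m.+3 = rho.
Hypothesis u_heat : forall (t : R) j, (0 < j <= m.+2)%N ->
  dv (u ^~ j) t (n%:R ^+ 2 * (u t j.+1 + u t j.-1 - 2 * u t j)).
Hypothesis u_eps : forall (t : R) j, 0 <= t -> (j <= m.+3)%N -> eps <= u t j <= 1 - eps.
Hypothesis u_grad : forall (t : R) k, 0 <= t -> (k <= m.+2)%N ->
  n%:R * `|u t k.+1 - u t k| <= M.
Hypothesis u_energy : forall t : R, 0 <= t ->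
  n%:R * (\sum_(0 <= k < n) (u t k.+1 - u t k) ^+ 2) <= E0 * expR (- c * t).
Hypothesis c_lsi : 2 * c * lsi_constant eps M <= 1.
Local Notation mu0 := (bernoulli_product (profile (m := m) (u 0))).
Local Notation p := (law_at (@generator R rho n) mu0).

Let u_adm (t : R) : 0 <= t -> admissible rho m (u t).
Proof.
move=> t0; split=> // j /andP[_ hj].
have /andP[h1 h2] := u_eps t0 (leqW hj); have e0 := eps0.
by apply/andP; split; lra.
Qed.

Let rho01 : 0 < rho < 1.
Proof.
have /andP[h1 h2] := u_eps (lexx 0) (leq0n _); have e0 := eps0.
by rewrite u_left in h1 h2; apply/andP; split; lra.
Qed.

Let mu0_gt0 eta : 0 < mu0 eta.
Proof. exact: profile_gt0 (u_adm (lexx 0)). Qed.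

Let p_gt0 (t : R) eta : 0 <= t -> 0 < p t eta.
Proof. by move=> t0; exact: law_gt0. Qed.

Let p_mass (t : R) : 0 <= t -> \sum_eta p t eta = 1.
Proof. by move=> t0; rewrite law_mass// bernoulli_sum1. Qed.

Let psi_mass (t : R) : \sum_eta psi (m := m) u t eta = 1.
Proof. exact: bernoulli_sum1. Qed.

Let psi_pos (t : R) (eta : Omega n) : 0 <= t -> 0 < psi u t eta :> R.
Proof. by move=> t0; apply: psi_gt0 t0; exact: u_adm. Qed.

Let Me0 : 0 <= M ^+ 2 / eps ^+ 4.
Proof. by apply: divr_ge0; [exact: sqr_ge0 | apply: exprn_ge0; exact: ltW]. Qed.

Lemma entropyE (t : R) : 0 <= t ->
  entropy rho mu0 u t = \sum_eta p t eta * (ln (p t eta) - ln (psi u t eta)).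
Proof. by move=> t0; apply: eq_bigr => eta _; rewrite (log_psiE u_adm). Qed.

Lemma entropy_lsi (t : R) : 0 <= t ->
  entropy rho mu0 u t <= lsi_constant eps M *
    (n%:R ^+ 2 * dirichlet rho (psi u t) (root_density rho mu0 u t)).
Proof.
move=> t0; pose f eta := p t eta / psi u t eta.
have f0 eta : 0 < f eta by rewrite divr_gt0 ?p_gt0 ?psi_pos.
have pE eta : psi u t eta * f eta = p t eta.
  by rewrite mulrC divfK// gt_eqF// psi_pos.
have f1 : \sum_eta psi u t eta * f eta = 1.
  by rewrite -(p_mass t0); apply: eq_bigr => eta _.
have := @log_sobolev R rho m (u t) eps M eps0 (u_adm t0) (fun j => @u_eps t j t0)
   (fun k => @u_grad t k t0) f rho01 f0 f1.
apply: le_trans; rewrite entropyE// le_eqVlt; apply/orP; left; apply/eqP.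
apply: eq_bigr => eta _; rewrite -/(psi u t eta) mulrA pE /f.
by rewrite ln_div ?posrE ?p_gt0 ?psi_pos.
Qed.

(** Passing from [V] to [W] divides by u (1 - u), at least eps^2, at both sites, whence eps^4. The
    Green term is at most n (n - 1), which turns [law_corr_ge] into an error M^2 / n. *)
Lemma law_corr_W (t : R) k : 0 <= t -> (k <= m.+2)%N ->
  - (M ^+ 2 / eps ^+ 4 / n%:R) <=
  \sum_eta p t eta * (W (u t) k eta * W (u t) k.+1 eta).
Proof.
move=> t0 hk.
have n0 : 0 < n%:R :> R by [].
have C0 : 0 <= M ^+ 2 / eps ^+ 4 / n%:R.
  by apply: divr_ge0 => //; exact: Me0.
case: k hk => [|k] hk.
  rewrite big1; first by rewrite oppr_le0.
  by move=> eta _; rewrite W_left mul0r mulr0.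
move: hk; rewrite leq_eqVlt => /predU1P[e|hk].
  rewrite big1; first by rewrite oppr_le0.
  by move=> eta _; rewrite e W_right !mulr0.
have hk1 : (0 < k.+1 <= m.+2)%N by exact: ltnW.
have hk2 : (0 < k.+2 <= m.+2)%N by [].
pose v j := u t j - rho.
pose x j := u t j * (1 - u t j).
have x_ge j : (j <= m.+3)%N -> eps ^+ 2 <= x j.
  move=> hj; have /andP[h1 h2] := u_eps t0 hj; have e0 := eps0.
  by rewrite expr2 /x; apply: ler_pM; rewrite ?(ltW eps0)//; lra.
have x_gt0 j : (j <= m.+3)%N -> 0 < x j.
  by move=> hj; apply: lt_le_trans (x_ge j hj); rewrite exprn_gt0.
have WE j (eta : Omega n) : (0 < j <= m.+2)%N -> W (u t) j eta = (V rho j eta - v j) / x j.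
  by move=> hj; rewrite W_pos// V_pos// /omega /v; congr (_ / _); ring.
have grad2 (s : R) j : 0 <= s -> (j <= m.+2)%N ->
    n%:R ^+ 2 * (u s j.+1 - u s j) ^+ 2 <= M ^+ 2.
  move=> s0 hj; rewrite -exprMn -real_normK ?num_real// normrM.
  rewrite [`|n%:R|]ger0_norm// lerXn2r ?nnegrE ?mulr_ge0 ?u_grad//.
  by apply: le_trans (u_grad s0 hj); rewrite mulr_ge0.
have := law_corr_ge u_left u_right u_heat grad2 t0 (ltn0Sn k) (ltnSn k.+1) hk.
have m1 := law_mean_V u_left u_right u_heat t0 (leqW (ltnW hk)).
have m2 := law_mean_V u_left u_right u_heat t0 (leqW hk).
set A := \sum_eta p t eta * (V rho k.+1 eta * V rho k.+2 eta) => hA.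
have -> : \sum_eta p t eta * (W (u t) k.+1 eta * W (u t) k.+2 eta) =
   (A - v k.+1 * v k.+2) / (x k.+1 * x k.+2).
  transitivity ((A - v k.+2 * (\sum_eta p t eta * V rho k.+1 eta)
     - v k.+1 * (\sum_eta p t eta * V rho k.+2 eta)
     + v k.+1 * v k.+2 * \sum_eta p t eta) / (x k.+1 * x k.+2)).
    rewrite /A !mulr_sumr -!sumrN -!big_split mulr_suml /=; apply: eq_bigr => eta _.
    by rewrite !WE//; field; rewrite !gt_eqF ?x_gt0// ltnW// ltnW.
  by rewrite m1 m2 p_mass// /v; congr (_ / _); ring.
have a1 := x_gt0 k.+1 (leqW (ltnW hk)); have a2 := x_gt0 k.+2 (leqW hk).
have b1 := x_ge k.+1 (leqW (ltnW hk)); have b2 := x_ge k.+2 (leqW hk).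
have a12 : 0 < x k.+1 * x k.+2 by exact: mulr_gt0 a1 a2.
rewrite ler_pdivlMr// mulNr.
have e4 : eps ^+ 4 <= x k.+1 * x k.+2.
  by rewrite (exprD _ 2 2) ler_pM ?sqr_ge0.
have h1 : M ^+ 2 / n%:R <= M ^+ 2 / eps ^+ 4 / n%:R * (x k.+1 * x k.+2).
  rewrite [leRHS](_ : _ = M ^+ 2 / n%:R * ((x k.+1 * x k.+2) / eps ^+ 4)); last by ring.
  rewrite ler_peMr ?divr_ge0 ?sqr_ge0//.
  by rewrite ler_pdivlMr ?exprn_gt0// mul1r.
have h2 : M ^+ 2 / (n%:R ^+ 2 * n.-1%:R) * (k.+1%:R * (n%:R - k.+2%:R)) <= M ^+ 2 / n%:R.
  rewrite [leRHS](_ : _ = M ^+ 2 / (n%:R ^+ 2 * n.-1%:R) * (n.-1%:R * n%:R)); last first.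
    by field; rewrite -!natrD !pnatr_eq0.
  rewrite ler_wpM2l ?divr_ge0 ?sqr_ge0//.
  have k3 : (k.+2%:R : R) <= n%:R by rewrite ler_nat leqW.
  by rewrite ler_pM// ?subr_ge0// ?lerBlDr ?lerDl// ler_nat /= ltnW.
rewrite -/(v k.+1) -/(v k.+2) in hA.
rewrite lerBrDr addrC; apply: le_trans hA; rewrite lerD2l lerN2; exact: le_trans h2 h1.
Qed.

(** The correlation error summed over bonds is a multiple of the decaying energy of the profile, and
    the log-Sobolev inequality supplies damping at rate 1 / L. The entropy starts at 0 since the
    initial law is the reference itself. *)
Lemma entropy_decay (t : R) : 0 <= t ->
  entropy rho mu0 u t <=
  2 * lsi_constant eps M * (M ^+ 2 / eps ^+ 4 * E0) * expR (- c * t).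
Proof.
move=> t0; pose L := lsi_constant eps M; rewrite -/L.
have L0 : 0 < L.
  apply: (lsi_constant_gt0 (m := m) eps0 (fun k => @u_grad 0 k (lexx 0))).
pose A := M ^+ 2 / eps ^+ 4 * E0.
have A0 : 0 <= A by apply: mulr_ge0 => //; exact: Me0.
have n0 : 0 < n%:R :> R by [].
pose H := entropy rho mu0 u.
have key (s : R) : 0 <= s -> exists2 d, dv H s d & d <= - L^-1 * H s + A * expR (- c * s).
  move=> s0; eexists; first exact: (entropy_derivative rho01 mu0_gt0 u_adm
     (fun t j _ => @u_heat t j) s0).
  apply: le_trans (entropy_production rho01 mu0_gt0 u_adm s0) _.
  rewrite mulNr -addrC [leRHS]addrC; apply: lerD.
  - rewrite lerNl; apply: (@le_trans _ _ (- (\sum_(0 <= k < n)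
       (n%:R * (u s k.+1 - u s k) ^+ 2 * (M ^+ 2 / eps ^+ 4))))).
      rewrite lerN2 -mulr_suml -mulr_sumr [A]mulrC -/A /A.
      rewrite [leRHS](_ : _ = (E0 * expR (- c * s)) * (M ^+ 2 / eps ^+ 4)); last by ring.
      by apply: ler_wpM2r; [exact: Me0 | exact: u_energy].
    rewrite -sumrN mulr_sumr big_nat [leRHS]big_nat; apply: ler_sum => k /andP[_ hk].
    have := law_corr_W s0 hk; set Q := \sum_eta _ => hQ.
    rewrite [leLHS](_ : _ = (n%:R ^+ 2 * (u s k.+1 - u s k) ^+ 2) * - (M ^+ 2 / eps ^+ 4 / n%:R)).
      by rewrite mulrA; apply: ler_wpM2l hQ; rewrite mulr_ge0 ?sqr_ge0.
    by field; rewrite -natrD pnatr_eq0 /= gt_eqF.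
  - rewrite !mulNr lerN2 ler_pdivrMl//; exact: entropy_lsi.
have H0 : H 0 = 0.
  rewrite /H entropyE//; apply: big1 => eta _.
  by rewrite law_at0 ?subrr ?mulr0//; exact: generator_lin.
(* With this choice [L^-1 * B = 2 * A], and [c_lsi] gives [c * B <= A]; hence [B * expR (- c * t)]
   is a supersolution of the entropy inequality. *)
pose B := 2 * L * A.
suff : H t - B * expR (- c * t) <= expR (- L^-1 * t) * (H 0 - B * expR (- c * 0)).
  rewrite H0 mulr0 expR0 mulr1 sub0r mulrN => h; rewrite -subr_le0; apply: le_trans h _.
  by rewrite oppr_le0 mulr_ge0 ?expR_ge0// mulr_ge0// mulr_ge0// ltW.
have [d hd] : {d : R -> R | forall s : R, 0 <= s -> dv H s (d s) /\ d s <= - L^-1 * H s + A * expR (- c * s)}.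
  apply: cid; have /choice[d hd] : forall s : R, exists d, 0 <= s -> dv H s d /\ d <= - L^-1 * H s + A * expR (- c * s).
    move=> s; have [s0|s0] := leP 0 s; last by exists 0.
    by have [d d1 d2] := key s s0; exists d.
  by exists d.
apply: (gronwall (y := fun s => H s - B * expR (- c * s))
   (dy := fun s => d s - B * (expR (- c * s) * (- c * 1)))) t0.
- move=> s s0; have [h _] := hd s s0.
  exact: (dvB h (dvZ B (dv_exp (dvZ (- c) (dvid s))))).
- move=> s s0; have [_ h] := hd s s0.
  have e0 := expR_gt0 (- c * s).
  have hB : L^-1 * B = 2 * A by rewrite /B; field; rewrite gt_eqF.
  have hcB : c * B <= A.
    have := ler_wpM2r A0 c_lsi; rewrite -/L /B mul1r.
    by rewrite [c * _](_ : _ = 2 * c * L * A)//; ring.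
  have := ler_wpM2r (ltW e0) hcB.
  have : - L^-1 * (H s - B * expR (- c * s)) = - L^-1 * H s + 2 * A * expR (- c * s).
    by rewrite -hB; ring.
  move=> ->; rewrite mulr1; lra.
Qed.

Lemma tv_relaxation (t : R) : 0 <= t ->
  tv_fin (p t) (psi u t) <=
  Num.sqrt (2 * lsi_constant eps M * (M ^+ 2 / eps ^+ 4 * E0) * expR (- c * t)).
Proof.
move=> t0; apply: le_trans (tv_le_entropy _ _ (p_mass t0) (psi_mass t)) _.
- by move=> eta; exact: p_gt0.
- by move=> eta; exact: psi_pos.
by rewrite ler_wsqrtr// -entropyE//; exact: entropy_decay.
Qed.

End Relaxation.

(** * Total variation between product measures *)

Section NormalCdf.
Context {R : realType}.
Implicit Types (m x y : R).

Definition gauss_pdf : R -> R := normal_pdf 0 1.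

Definition normal_cdf m x : R := fine (normal_prob m 1 `]-oo, x]).

Local Notation Phi := (normal_cdf 0).

Lemma normal_pdf1E m x :
  normal_pdf m 1 x = normal_peak 1 * expR (- (x - m) ^+ 2 / 2).
Proof. by rewrite normal_pdfE ?oner_neq0// /normal_fun expr1n. Qed.

Lemma normal_pdf_shift m x : normal_pdf m 1 x = gauss_pdf (x - m).
Proof. by rewrite /gauss_pdf !normal_pdf1E subr0. Qed.

Lemma gauss_pdf_ge0 x : 0 <= gauss_pdf x.
Proof. exact: normal_pdf_ge0. Qed.

Lemma gauss_pdf_le x : gauss_pdf x <= normal_peak 1.
Proof. by apply: normal_pdf_ub; exact: oner_neq0. Qed.

Lemma dv_gauss_pdf x : dv gauss_pdf x (- x * gauss_pdf x).
Proof.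
have e y : normal_peak 1 * expR (2^-1 * - (y * y)) = gauss_pdf y.
  by rewrite /gauss_pdf normal_pdf1E subr0; congr (_ * expR _); ring.
apply: (dv_ext e).
apply: (dv_eq (dvZ _ (dv_exp (dvZ _ (dvN (dvM (dvid x) (dvid x))))))).
by rewrite -e; field.
Qed.

Lemma gauss_pdf_lip x y : `|gauss_pdf x - gauss_pdf y| <= normal_peak 1 * `|x - y|.
Proof.
wlog xy : x y / y <= x.
  move=> H; have [h|/ltW h] := leP y x; first exact: H.
  by rewrite distrC [`|x - y|]distrC; exact: H.
rewrite [`|x - y|]ger0_norm ?subr_ge0//.
apply: (mvt_lip xy (fun z _ => dv_gauss_pdf z)) => z _.
rewrite normrM normrN [`|gauss_pdf z|]ger0_norm ?gauss_pdf_ge0//.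
have p0 : 0 <= normal_peak 1 :> R by exact: normal_peak_ge0.
rewrite /gauss_pdf normal_pdf1E subr0 mulrCA -[leRHS]mulr1 ler_wpM2l//.
(* What remains is |z| <= 1 + z^2 / 2 <= exp (z^2 / 2). *)
rewrite mulNr expRN -ler_pdivlMr ?invr_gt0 ?expR_gt0// invrK mul1r.
apply: (@le_trans _ _ (1 + z ^+ 2 / 2)); last exact: expR_ge1Dx.
rewrite -[z ^+ 2]real_normK ?num_real//.
by have := sqr_ge0 (`|z| - 1); lra.
Qed.

Lemma dv_normal_cdf m x : dv (normal_cdf m) x (normal_pdf m 1 x).
Proof.
have [||||h1 h2] := @continuous_FTC1 R (normal_pdf m 1) -oo%O x (x + 1).
- by rewrite ltrDl.
- apply: integrableS (integrable_normal_pdf m 1) => //.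
- by rewrite ltNyr.
- by apply: continuous_normal_pdf; exact: oner_neq0.
by split; [exact: h1 | rewrite -h2 derive1E].
Qed.

Let idR : measurableTypeR R -> R := idfun.
#[local] HB.instance Definition _ :=
  @isMeasurableFun.Build _ _ _ _ idR (@measurable_id _ _ setT).

Let cdfE m x : (normal_cdf m x)%:E = cdf (idR : {RV (normal_prob m 1) >-> R}) x.
Proof. by rewrite /normal_cdf fineK ?fin_num_measure. Qed.

Let cdf_fine m : normal_cdf m = fine \o cdf (idR : {RV (normal_prob m 1) >-> R}).
Proof. by apply/funext => x /=; rewrite -[LHS]/(fine (normal_cdf m x)%:E) cdfE. Qed.

Lemma normal_cdf_cvgy m : normal_cdf m x @[x --> +oo] --> (1 : R).
Proof. by rewrite cdf_fine; apply: fine_cvg; exact: cvg_cdfy1. Qed.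

Lemma normal_cdf_cvgNy m : normal_cdf m x @[x --> -oo] --> (0 : R).
Proof. by rewrite cdf_fine; apply: fine_cvg; exact: cvg_cdfNy0. Qed.

(** Both sides have the same derivative and the same limit at -oo; no change of variables in the
    integral is made. *)
Lemma normal_cdf_shift m x : normal_cdf m x = Phi (x - m).
Proof.
pose d x := normal_cdf m x - Phi (x - m).
have hd y : dv d y 0.
  have h : dv (fun y => y - m) y (1 - 0) by exact: dvB (dvid y) (dvc m y).
  have h2 : dv (fun y => Phi (y - m)) y (normal_pdf 0 1 (y - m) * (1 - 0)).
    exact: (dv_comp (f := Phi) (g := fun y => y - m) (dv_normal_cdf 0 (y - m)) h).
  apply: (dv_eq (dvB (dv_normal_cdf m y) h2)).
  by rewrite normal_pdf_shift /gauss_pdf subr0 mulr1 subrr.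
have dc y z : y <= z -> d y = d z.
  move=> yz; have [c _ e] := mvt yz (fun w _ => hd w).
  by apply/esym/eqP; rewrite -subr_eq0 e mul0r.
have h0 : d y @[y --> -oo] --> (0 : R).
  rewrite -[X in _ --> X](subr0 0); apply: cvgB; first exact: normal_cdf_cvgNy.
  apply: (cvg_comp (fun y => y - m) Phi _ (normal_cdf_cvgNy 0)).
  exact: cvg_addrr_Ny.
have h1 : d y @[y --> -oo] --> d x.
  apply: cvg_near_cst; near=> y; apply: dc.
  by near: y; apply: nbhs_ninfty_le; rewrite num_real.
have : d x = 0 by apply: cvg_unique h1 h0.
by move/eqP; rewrite subr_eq0 => /eqP.
Unshelve. all: by end_near. Qed.

Lemma fine_measureI d (T : measurableType d) (mu : probability T R) (A B : set T) :
  measurable A -> measurable B ->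
  fine (mu A) = fine (mu (A `&` B)) + fine (mu (A `&` ~` B)).
Proof.
move=> mA mB.
have m1 : measurable (A `&` B) by exact: measurableI.
have m2 : measurable (A `&` ~` B) by apply: measurableI => //; exact: measurableC.
have e : mu A = (mu (A `&` B) + mu (A `&` ~` B))%E.
  by rewrite -measureU// -?setIUr ?setUCr ?setIT// setIACA setICr setI0.
by rewrite e fineD// fin_num_measure.
Qed.

(** [S] is a Hahn set for Q - P. Any event is compared with [S] or with its complement by splitting
    along both sets. *)
Lemma tv_dominating_set d (T : measurableType d) (P Q : probability T R) (S : set T) :
  measurable S ->
  (forall B, measurable B -> B `<=` S -> fine (P B) <= fine (Q B)) ->
  (forall B, measurable B -> B `<=` ~` S -> fine (Q B) <= fine (P B)) ->
  tv P Q = fine (Q S) - fine (P S).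
Proof.
move=> mS monoPQ monoQP.
have ub (A : set T) : measurable A -> `|fine (P A) - fine (Q A)| <= fine (Q S) - fine (P S).
  move=> mA.
  have mS' : measurable (~` S) by exact: measurableC.
  have mA' : measurable (~` A) by exact: measurableC.
  have sP := @fine_measureI _ _ P A S mA mS; have sQ := @fine_measureI _ _ Q A S mA mS.
  have tP := @fine_measureI _ _ P S A mS mA; have tQ := @fine_measureI _ _ Q S A mS mA.
  have cP := @fine_measureI _ _ P setT S measurableT mS; have cQ := @fine_measureI _ _ Q setT S measurableT mS.
  rewrite !setTI !probability_setT /= in cP cQ.
  have dP := @fine_measureI _ _ P (~` S) A mS' mA; have dQ := @fine_measureI _ _ Q (~` S) A mS' mA.
  rewrite ![S `&` A]setIC in tP tQ; rewrite ![~` S `&` A]setIC in dP dQ.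
  have h1 := monoPQ (A `&` S) (measurableI _ _ mA mS) (@subIsetr _ _ _).
  have h2 := monoPQ (S `&` ~` A) (measurableI _ _ mS mA') (@subIsetl _ _ _).
  have h3 := monoQP (A `&` ~` S) (measurableI _ _ mA mS') (@subIsetr _ _ _).
  have h4 := monoQP (~` S `&` ~` A) (measurableI _ _ mS' mA') (@subIsetl _ _ _).
  rewrite ler_norml; apply/andP; split; lra.
rewrite /tv; apply/eqP; rewrite eq_le; apply/andP; split.
- apply: ge_sup; first by exists (`|fine (P S) - fine (Q S)|), S.
  by move=> _ [A mA <-]; exact: ub.
- apply: ub_le_sup; last first.
    exists S => //; rewrite distrC ger0_norm// subr_ge0; exact: monoPQ.
  by exists (fine (Q S) - fine (P S)) => _ [A mA <-]; exact: ub.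
Qed.

(** The two densities cross at m / 2, so the half-line to its left is the Hahn set. *)
Lemma G_normal_cdf m : 0 <= m -> G m = Phi (m / 2) - Phi (- (m / 2)).
Proof.
move=> m0; rewrite /G.
set P := normal_prob m 1; set Q := normal_prob 0 1.
have fP A : measurable A -> P A \is a fin_num by move=> mA; exact: fin_num_measure.
have fQ A : measurable A -> Q A \is a fin_num by move=> mA; exact: fin_num_measure.
pose S : set (measurableTypeR R) := [set` `]-oo, (m / 2)]].
have mS : measurable S by exact: measurable_itv.
have val : fine (Q S) - fine (P S) = Phi (m / 2) - Phi (- (m / 2)).
  have -> : fine (P S) = normal_cdf m (m / 2) by [].
  by rewrite normal_cdf_shift; congr (_ - Phi _); field.
have le_pdf x : x <= m / 2 -> normal_pdf m 1 x <= normal_pdf 0 1 x.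
  move=> hx; rewrite !normal_pdf1E ler_wpM2l ?normal_peak_ge0// ler_expR.
  by rewrite subr0 ler_wpM2r// lerN2; nra.
have ge_pdf x : m / 2 <= x -> normal_pdf 0 1 x <= normal_pdf m 1 x.
  move=> hx; rewrite !normal_pdf1E ler_wpM2l ?normal_peak_ge0// ler_expR.
  by rewrite subr0 ler_wpM2r// lerN2; nra.
have monoPQ (B : set (measurableTypeR R)) : measurable B -> B `<=` S -> fine (P B) <= fine (Q B).
  move=> mB BS; apply: fine_le; [exact: fP|exact: fQ|].
  apply: ge0_le_integral => //.
  - by move=> x _; rewrite lee_fin normal_pdf_ge0.
  - by apply/measurable_realfun.measurable_EFinP; apply: measurable_funTS; exact: measurable_normal_pdf.
  - by apply/measurable_realfun.measurable_EFinP; apply: measurable_funTS; exact: measurable_normal_pdf.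
  - by move=> x /BS; rewrite /S /= in_itv /= => hx; rewrite lee_fin le_pdf.
have monoQP (B : set (measurableTypeR R)) : measurable B -> B `<=` ~` S -> fine (Q B) <= fine (P B).
  move=> mB BS; apply: fine_le; [exact: fQ|exact: fP|].
  apply: ge0_le_integral => //.
  - by move=> x _; rewrite lee_fin normal_pdf_ge0.
  - by apply/measurable_realfun.measurable_EFinP; apply: measurable_funTS; exact: measurable_normal_pdf.
  - by apply/measurable_realfun.measurable_EFinP; apply: measurable_funTS; exact: measurable_normal_pdf.
  - move=> x /BS; rewrite /S /= in_itv /= => /negP; rewrite -ltNge => /ltW hx.
    by rewrite lee_fin ge_pdf.
rewrite -val; exact: (tv_dominating_set mS monoPQ monoQP).
Qed.

End NormalCdf.

(** * Black-Scholes prices and their sensitivities *)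

Section BlackScholes.
Context {R : realType}.
Implicit Types (s y z : R).
Local Notation Phi := (@normal_cdf R 0).
Local Notation phi := (@gauss_pdf R).
Local Notation c0 := (normal_peak 1 : R).

(* Expectation of [(y exp(s X - s^2/2) - 1)_+] for a standard Gaussian [X]. *)
Definition call s y : R := y * Phi (ln y / s + s / 2) - Phi (ln y / s - s / 2).

Let c00 : 0 <= c0. Proof. exact: normal_peak_ge0. Qed.

Lemma dv_Phi (f : R -> R) (t a : R) : dv f t a ->
  dv (fun r => Phi (f r)) t (phi (f t) * a).
Proof. by move=> h; exact: (dv_comp (f := Phi) (g := f) (dv_normal_cdf 0 (f t)) h). Qed.

(** This classical identity cancels most density terms in [dv_call], leaving the delta [Phi (d1)]
    and the vega [y * phi (d1)], with d1 = ln y / s + s / 2. *)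
Lemma gauss_pdf_d2 s y : 0 < s -> 0 < y ->
  phi (ln y / s - s / 2) = y * phi (ln y / s + s / 2).
Proof.
move=> s0 y0; rewrite /gauss_pdf !normal_pdf1E !subr0 mulrCA; congr (_ * _).
rewrite -{2}(lnK (y0 : y \is Num.pos)) -expRD; congr expR.
by field; rewrite gt_eqF.
Qed.

Lemma dv_call (s y : R -> R) (t ds dy : R) : 0 < s t -> 0 < y t ->
  dv s t ds -> dv y t dy ->
  dv (fun r => call (s r) (y r)) t
    (dy * Phi (ln (y t) / s t + s t / 2)
     + y t * phi (ln (y t) / s t + s t / 2) * ds).
Proof.
move=> s0 y0 hs hy.
have s1 : s t != 0 by rewrite gt_eqF.
have hl := dvM (dv_ln y0 hy) (dvV s1 hs).
have hh : dv (fun r => s r / 2) t (ds * 2^-1 + s t * 0) by exact: dvM hs (dvc _ _).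
have h1 := dv_Phi (dvD hl hh); have h2 := dv_Phi (dvB hl hh).
apply: (dv_eq (dvB (dvM hy h1) h2)).
by rewrite gauss_pdf_d2//; field; rewrite !gt_eqF.
Qed.

Lemma call_lip_s s1 s2 y : 0 < s1 -> 0 < s2 -> 0 < y ->
  `|call s1 y - call s2 y| <= c0 * y * `|s1 - s2|.
Proof.
move=> h1 h2 y0.
wlog s12 : s1 s2 h1 h2 / s2 <= s1.
  move=> H; have [h|/ltW h] := leP s2 s1; first exact: H.
  by rewrite distrC [`|s1 - s2|]distrC; exact: H.
rewrite [`|s1 - s2|]ger0_norm ?subr_ge0//.
apply: (mvt_lip (f := fun s => call s y)
  (df := fun s => 0 * Phi (ln y / s + s / 2) + y * phi (ln y / s + s / 2) * 1) s12).
- move=> s /andP[hs _]; have s0 : 0 < s by exact: lt_le_trans hs.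
  exact: (dv_call (y := fun=> y) s0 y0 (dvid s) (dvc y s)).
- move=> s _; rewrite mul0r add0r mulr1 ger0_norm ?mulr_ge0 ?(ltW y0) ?gauss_pdf_ge0//.
  by rewrite mulrC ler_wpM2r ?(ltW y0)// gauss_pdf_le.
Qed.

Lemma normal_cdf_lip (x y : R) : `|Phi x - Phi y| <= c0 * `|x - y|.
Proof.
wlog xy : x y / y <= x.
  move=> H; have [h|/ltW h] := leP y x; first exact: H.
  by rewrite distrC [`|x - y|]distrC; exact: H.
rewrite [`|x - y|]ger0_norm ?subr_ge0//.
apply: (mvt_lip xy (fun z _ => dv_normal_cdf 0 z)) => z _.
by rewrite ger0_norm; [exact: gauss_pdf_le | exact: gauss_pdf_ge0].
Qed.

(** The argument tends to +oo or -oo with the sign of [ln y]; at y = 1 the prefactor is 0. *)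
Lemma Phi_div_cvg0 y : 0 < y ->
  (y - 1) * Phi (ln y / s) @[s --> 0^'+] --> Num.max (y - 1) 0.
Proof.
move=> y0.
have hinv : s^-1 @[s --> (0:R)^'+] --> +oo.
  apply/gtr0_cvgV0; first by near=> s; rewrite invr_gt0.
  rewrite (_ : unstable.inv_fun _ = fun s => s); last by apply/funext => s; exact: invrK.
  exact: cvg_within.
have [y1|y1|->] := ltgtP y 1; last first.
- rewrite subrr maxxx; under eq_cvg do rewrite mul0r; exact: cvg_cst.
- rewrite (max_idPl _) ?subr_ge0 ?ltW// -[X in _ --> X]mulr1.
  apply: cvgM; first exact: cvg_cst.
  apply: (cvg_comp (fun s => ln y / s) Phi _ (normal_cdf_cvgy 0)).
  by apply: gt0_cvgMry => //; exact: ln_gt0.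
- rewrite (max_idPr _) ?subr_le0 ?ltW// -[X in _ --> X](mulr0 (y - 1)).
  apply: cvgM; first exact: cvg_cst.
  apply: (cvg_comp (fun s => ln y / s) Phi _ (normal_cdf_cvgNy 0)).
  apply/cvgNry; rewrite (_ : - _ = fun s => - ln y * s^-1); last first.
    by apply/funext => s; rewrite mulNr.
  apply: gt0_cvgMry => //.
  by rewrite oppr_gt0 ln_lt0 ?y0.
Unshelve. all: by end_near. Qed.

(** The vega is at most [c0 * y], so the price moves by at most [c0 * y * s] as the volatility
    decreases to 0, where the price tends to the payoff. *)
Lemma call_payoff s y : 0 < s -> 0 < y ->
  `|call s y - Num.max (y - 1) 0| <= c0 * y * s.
Proof.
move=> s0 y0.
have h z : 0 < z -> `|call z y - (y - 1) * Phi (ln y / z)| <= c0 * (1 + y) * z.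
  move=> z0; rewrite /call.
  have h1 := normal_cdf_lip (ln y / z + z / 2) (ln y / z).
  have h2 := normal_cdf_lip (ln y / z - z / 2) (ln y / z).
  have e1 : `|ln y / z + z / 2 - ln y / z| = z / 2.
    by rewrite addrAC subrr add0r ger0_norm// divr_ge0// ltW.
  have e2 : `|ln y / z - z / 2 - ln y / z| = z / 2.
    by rewrite addrAC subrr add0r normrN ger0_norm// divr_ge0// ltW.
  rewrite e1 in h1; rewrite e2 in h2.
  rewrite [X in `|X|](_ : _ = y * (Phi (ln y / z + z / 2) - Phi (ln y / z)) -
    (Phi (ln y / z - z / 2) - Phi (ln y / z))); last by ring.
  apply: le_trans (ler_normB _ _) _; rewrite normrM [`|y|]gtr0_norm//.
  have := ler_wpM2l (ltW y0) h1.
  have := mulr_ge0 c00 (ltW z0); nra.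
apply/ler_addgt0Pr => e e0.
have hc := Phi_div_cvg0 y0.
have : \forall z \near (0:R)^'+, `|(y - 1) * Phi (ln y / z) - Num.max (y - 1) 0| <= e / 2.
  by move/cvgrPdist_le : hc => /(_ (e / 2) (divr_gt0 e0 (ltr0Sn _ _)));
     apply: filterS => z; rewrite distrC.
move=> hn.
have : \forall z \near (0:R)^'+, c0 * (1 + y) * z <= e / 2 /\ 0 < z /\ z <= s.
  have d0 : 0 < c0 * (1 + y).
    by rewrite mulr_gt0 ?normal_peak_gt0 ?oner_neq0// addr_gt0.
  near=> z; split; last first.
    by split; near: z; [exact: nbhs_right_gt | exact: nbhs_right_le].
  by rewrite mulrC -ler_pdivlMr//; near: z; apply: nbhs_right_le; rewrite divr_gt0// divr_gt0.
move=> hn2.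
have [z [hz1 [hz2 [hz3 hz4]]]] := filter_ex (filterI hn hn2).
have h3 := h z hz3.
have h4 : `|call s y - call z y| <= c0 * y * s.
  apply: le_trans (call_lip_s s0 hz3 y0) _; rewrite ler_wpM2l//.
    by rewrite mulr_ge0 // ltW.
  by rewrite ger0_norm ?subr_ge0// lerBlDr lerDl ltW.
rewrite [X in `|X|](_ : _ = (call s y - call z y) + ((call z y - (y - 1) * Phi (ln y / z)) +
  ((y - 1) * Phi (ln y / z) - Num.max (y - 1) 0))); last by ring.
apply: le_trans (ler_normD _ _) _; apply: lerD => //.
apply: le_trans (ler_normD _ _) _.
by rewrite [leRHS](splitr e); apply: lerD => //; exact: le_trans h3 hz2.
Unshelve. all: by end_near. Qed.

Lemma ln_abs_le (r : R) : 1 / 2 <= r -> `|ln r| <= 2 * `|r - 1|.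
Proof.
move=> hr; have r0 : 0 < r by lra.
have h1 : ln r <= r - 1 := ln_le_subr1 r0.
have h2 : - ln r <= r^-1 - 1.
  by rewrite -lnV ?posrE//; apply: ln_le_subr1; rewrite invr_gt0.
have h3 : r^-1 - 1 <= 2 * `|r - 1|.
  have -> : r^-1 - 1 = r^-1 * - (r - 1) by field; rewrite gt_eqF.
  apply: (@le_trans _ _ (r^-1 * `|r - 1|)).
    by apply: ler_wpM2l; [rewrite invr_ge0 ltW | rewrite -normrN ler_norm].
  by rewrite ler_wpM2r// -[leRHS]invrK lef_pV2 ?posrE ?invr_gt0//; lra.
have h4 := ler_norm (r - 1); have h5 := normr_ge0 (r - 1).
by rewrite ler_norml; apply/andP; split; lra.
Qed.

(* One step of the Lindeberg replacement: the two-point return [r] is traded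
   for the increment [q] of the squared volatility. Along the interpolation
   [th], the drift of [h] cancels to first order by the Black-Scholes
   equation. *)
Lemma call_step (rho v s y : R) (q := v ^+ 2 / (rho * (1 - rho))) :
  0 < rho < 1 -> 2 * `|v| <= rho -> 2 * `|v| <= 1 - rho -> 0 < s -> 0 < y ->
  `|rho * call s (y * (1 + v / rho)) + (1 - rho) * call s (y * (1 - v / (1 - rho)))
    - call (Num.sqrt (s ^+ 2 + q)) y| <=
  y * (q * `|v| * (c0 / (rho * (1 - rho)) * (3 / s + 4 / s ^+ 2))).
Proof.
move=> /andP[r0 r1'] hv1 hv2 s0 y0.
have r1 : 0 < 1 - rho by rewrite subr_gt0.
have q0 : 0 <= q by rewrite divr_ge0 ?sqr_ge0// ltW// mulr_gt0.
(* The return shrunk by [th] has variance th^2 q, and the Gaussian part receives the other (1 -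
   th^2) q: total variance is constant along the path. *)
pose sg (th : R) : R := Num.sqrt (s ^+ 2 + (1 - th * th) * q).
pose rp (th : R) : R := 1 + th * (v / rho).
pose rm (th : R) : R := 1 - th * (v / (1 - rho)).
pose delta : R := `|v| / (rho * (1 - rho)).
have d0 : 0 <= delta by rewrite divr_ge0// ltW// mulr_gt0.
have vp : `|v / rho| <= 1 / 2 /\ `|v / rho| <= delta.
  rewrite normrM normfV [`|rho|]gtr0_norm//; split.
    by rewrite ler_pdivrMr//; lra.
  rewrite /delta invfM mulrA ler_peMr ?divr_ge0 ?(ltW r0)//.
  by rewrite invf_ge1//; lra.
have vm : `|v / (1 - rho)| <= 1 / 2 /\ `|v / (1 - rho)| <= delta.
  rewrite normrM normfV [`|1 - rho|]gtr0_norm//; split.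
    by rewrite ler_pdivrMr//; lra.
  rewrite /delta invfM mulrA mulrAC ler_peMr ?divr_ge0 ?(ltW r1)//.
  by rewrite invf_ge1//; lra.
have rpd (th : R) : 0 <= th <= 1 -> `|rp th - 1| <= delta /\ 1 / 2 <= rp th.
  move=> /andP[t0 t1]; have [h1 h2] := vp.
  have h3 : `|rp th - 1| <= `|v / rho|.
    by rewrite /rp addrAC subrr add0r normrM ger0_norm// ler_piMl.
  split; first exact: le_trans h3 h2.
  by have := le_trans h3 h1; rewrite ler_norml => /andP[]; lra.
have rmd (th : R) : 0 <= th <= 1 -> `|rm th - 1| <= delta /\ 1 / 2 <= rm th.
  move=> /andP[t0 t1]; have [h1 h2] := vm.
  have h3 : `|rm th - 1| <= `|v / (1 - rho)|.
    by rewrite /rm addrAC subrr add0r normrN normrM ger0_norm// ler_piMl.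
  split; first exact: le_trans h3 h2.
  by have := le_trans h3 h1; rewrite ler_norml => /andP[]; lra.
have sgs (th : R) : 0 <= th <= 1 -> s <= sg th.
  move=> /andP[t0 t1]; rewrite -[leLHS](ger0_norm (ltW s0)) -sqrtr_sqr ler_wsqrtr//.
  by rewrite lerDl mulr_ge0// subr_ge0 mulr_ile1.
pose d (r th : R) : R := ln (y * r) / sg th + sg th / 2.
pose h (th : R) : R := rho * call (sg th) (y * rp th) + (1 - rho) * call (sg th) (y * rm th).
pose dsg (th : R) : R := - (th * q) / sg th.
pose dh (th : R) : R :=
  rho * (y * (v / rho) * Phi (d (rp th) th) + y * rp th * phi (d (rp th) th) * dsg th) +
  (1 - rho) * (y * - (v / (1 - rho)) * Phi (d (rm th) th) + y * rm th * phi (d (rm th) th) * dsg th).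
have hdv (th : R) : 0 <= th <= 1 -> dv h th (dh th).
  move=> ht.
  have sg0 : 0 < sg th by apply: lt_le_trans (sgs th ht).
  have rp0 : 0 < y * rp th by have [_ ?] := rpd th ht; rewrite mulr_gt0//; lra.
  have rm0 : 0 < y * rm th by have [_ ?] := rmd th ht; rewrite mulr_gt0//; lra.
  have hsg : dv sg th (dsg th).
    have e : dv (fun t => s ^+ 2 + (1 - t * t) * q) th (0 + ((0 - (1 * th + th * 1)) * q + (1 - th * th) * 0)).
      exact: (dvD (dvc _ _) (dvM (dvB (dvc _ _) (dvM (dvid _) (dvid _))) (dvc _ _))).
    have p0 : 0 < s ^+ 2 + (1 - th * th) * q by rewrite -sqrtr_gt0.
    apply: (dv_eq (dv_sqrt (f := fun t => s ^+ 2 + (1 - t * t) * q) p0 e)).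
    by rewrite /dsg /sg; field; rewrite gt_eqF.
  have hrp : dv (fun t => y * rp t) th (y * (v / rho)).
    apply: (dv_eq (dvZ y (dvD (dvc 1 th) (dvM (dvid th) (dvc (v / rho) th))))).
    by rewrite mulr0 addr0 add0r mul1r.
  have hrm : dv (fun t => y * rm t) th (y * - (v / (1 - rho))).
    apply: (dv_eq (dvZ y (dvB (dvc 1 th) (dvM (dvid th) (dvc (v / (1 - rho)) th))))).
    by rewrite mulr0 addr0 sub0r mul1r.
  exact: (dvD (dvZ rho (dv_call sg0 rp0 hsg hrp)) (dvZ (1 - rho) (dv_call sg0 rm0 hsg hrm))).
have phid (th r : R) : 0 <= th <= 1 -> 1 / 2 <= r -> `|r - 1| <= delta ->
    `|phi (d r th) - phi (d 1 th)| <= c0 * (2 * delta / s).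
  move=> ht hr hrd; have sg0 : 0 < sg th by apply: lt_le_trans (sgs th ht).
  apply: le_trans (gauss_pdf_lip _ _) _; rewrite ler_wpM2l//.
  have rr0 : 0 < r by lra.
  have -> : d r th - d 1 th = ln r / sg th.
    by rewrite /d mulr1 lnM ?posrE//; ring.
  rewrite normrM normfV [`|sg th|]gtr0_norm//.
  apply: ler_pM => //; first by rewrite invr_ge0 ltW.
    by apply: le_trans (ln_abs_le hr) _; rewrite ler_wpM2l.
  by rewrite lef_pV2 ?posrE ?sgs.
have hbound (th : R) : 0 <= th <= 1 ->
    `|dh th| <= y * (q * `|v| * (c0 / (rho * (1 - rho)) * (3 / s + 4 / s ^+ 2))).
  move=> ht.
  have sg0 : 0 < sg th by apply: lt_le_trans (sgs th ht).
  have [rp1 rp2] := rpd th ht; have [rm1 rm2] := rmd th ht.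
  pose kap (r : R) : R := Phi (d r th).
  have dk (r : R) : 1 / 2 <= r -> dv kap r (phi (d r th) * (r^-1 / sg th)).
    move=> hr; have r2 : 0 < r by lra.
    apply: dv_Phi.
    have yr : 0 < y * r by rewrite mulr_gt0.
    have h1 : dv (fun z => ln (y * z)) r ((y * 1) / (y * r)).
      exact: (dv_ln (f := fun z => y * z) yr (dvZ y (dvid r))).
    apply: (dv_eq (dvD (dvM h1 (dvc (sg th)^-1 r)) (dvc (sg th / 2) r))).
    by field; rewrite !gt_eqF.
  (* The mean value theorem turns the difference of deltas into a density at an intermediate return
     times rp - rm = th v / (rho (1 - rho)), which has the same factor th q / sg as the vega term
     once multiplied by [v]. *)
  have [rs [rs1 rs2 e]] : exists rs, [/\ 1 / 2 <= rs, `|rs - 1| <= delta &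
      kap (rp th) - kap (rm th) = phi (d rs th) * (rs^-1 / sg th) * (rp th - rm th)].
    have gen (a b : R) : a <= b -> 1 / 2 <= a -> `|a - 1| <= delta -> `|b - 1| <= delta ->
        exists c, [/\ 1 / 2 <= c, `|c - 1| <= delta & kap b - kap a = phi (d c th) * (c^-1 / sg th) * (b - a)].
      move=> ab ha ha1 hb1.
      have [c /andP[c1 c2] e] := mvt (f := kap) ab (fun x hx => dk x (le_trans ha (andP hx).1)).
      exists c; split=> //; first exact: le_trans c1.
      by move: ha1 hb1; rewrite !ler_norml => /andP[? ?] /andP[? ?]; apply/andP; split; lra.
    have [hle|/ltW hle] := leP (rm th) (rp th).
      exact: (gen _ _ hle rm2 rm1 rp1).
    have [c [c1 c2 c3]] := gen _ _ hle rp2 rp1 rm1.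
    by exists c; split=> //; rewrite -opprB c3; ring.
  have rs0 : 0 < rs by lra.
  pose f1 := phi (d 1 th).
  (* The common value [f1] enters with total weight -1 + rho + (1 - rho) = 0: this is the
     first-order cancellation, and each bracket left is of order [delta]. *)
  have -> : dh th = y * (th * q / sg th) * ((phi (d rs th) / rs - f1)
     - rho * (rp th * phi (d (rp th) th) - f1) - (1 - rho) * (rm th * phi (d (rm th) th) - f1)).
    have -> : dh th = y * v * (kap (rp th) - kap (rm th)) +
       dsg th * (rho * (y * rp th * phi (d (rp th) th)) + (1 - rho) * (y * rm th * phi (d (rm th) th))).
      by rewrite /dh /kap; field; rewrite !gt_eqF.
    rewrite e /dsg.
    have -> : rp th - rm th = th * (v / (rho * (1 - rho))).
      by rewrite /rp /rm; field; rewrite !gt_eqF.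
    by rewrite /q; field; rewrite !gt_eqF.
  have b1 : `|phi (d rs th) / rs - f1| <= c0 * (2 * delta) + c0 * (2 * delta / s).
    rewrite [X in `|X|](_ : _ = phi (d rs th) * (rs^-1 - 1) + (phi (d rs th) - f1)); last by ring.
    apply: le_trans (ler_normD _ _) _; apply: lerD; last exact: phid.
    rewrite normrM [`|phi _|]ger0_norm ?gauss_pdf_ge0//.
    apply: ler_pM; rewrite ?gauss_pdf_ge0 ?gauss_pdf_le//.
    have -> : rs^-1 - 1 = rs^-1 * - (rs - 1) by field; rewrite gt_eqF.
    rewrite normrM normrN gtr0_norm ?invr_gt0//.
    apply: ler_pM => //; first by rewrite invr_ge0 ltW.
    by rewrite -[leRHS]invrK lef_pV2 ?posrE ?invr_gt0//; lra.
  have b2 (r : R) : 1 / 2 <= r -> `|r - 1| <= delta ->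
      `|r * phi (d r th) - f1| <= c0 * delta + c0 * (2 * delta / s).
    move=> hr hrd.
    rewrite [X in `|X|](_ : _ = phi (d r th) * (r - 1) + (phi (d r th) - f1)); last by ring.
    apply: le_trans (ler_normD _ _) _; apply: lerD; last exact: phid.
    rewrite normrM [`|phi _|]ger0_norm ?gauss_pdf_ge0//.
    by apply: ler_pM; rewrite ?gauss_pdf_ge0 ?gauss_pdf_le.
  have b3 := b2 _ rp2 rp1; have b4 := b2 _ rm2 rm1.
  rewrite normrM.
  have q1 : `|y * (th * q / sg th)| <= y * (q / s).
    rewrite normrM [`|y|]gtr0_norm//; apply: ler_wpM2l; first exact: ltW.
    have /andP[t0 t1] := ht.
    rewrite ger0_norm; last by apply: divr_ge0; [exact: mulr_ge0 | exact: ltW].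
    apply: ler_pM; [exact: mulr_ge0 | by rewrite invr_ge0 ltW | by rewrite ler_piMl |].
    by rewrite lef_pV2 ?posrE ?sgs.
  have S1 : `|(phi (d rs th) / rs - f1) - rho * (rp th * phi (d (rp th) th) - f1)
      - (1 - rho) * (rm th * phi (d (rm th) th) - f1)| <=
      (c0 * (2 * delta) + c0 * (2 * delta / s)) + (c0 * delta + c0 * (2 * delta / s)).
    apply: le_trans (ler_normB _ _) _.
    apply: le_trans (lerD (ler_normB _ _) (lexx _)) _.
    rewrite !normrM [`|rho|]gtr0_norm// [`|1 - rho|]gtr0_norm// -addrA; apply: lerD => //.
    have := ler_wpM2l (ltW r0) b3; have := ler_wpM2l (ltW r1) b4; lra.
  apply: le_trans (ler_pM (normr_ge0 _) (normr_ge0 _) q1 S1) _.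
  rewrite le_eqVlt; apply/orP; left; apply/eqP.
  by rewrite /delta; field; rewrite !gt_eqF.
have [c hc e] := mvt ler01 (fun th ht => hdv th ht).
have -> : rho * call s (y * (1 + v / rho)) + (1 - rho) * call s (y * (1 - v / (1 - rho)))
    - call (Num.sqrt (s ^+ 2 + q)) y = h 1 - h 0.
  have e1 : sg 1 = s by rewrite /sg mulr1 subrr mul0r addr0 sqrtr_sqr gtr0_norm.
  have e2 : sg 0 = Num.sqrt (s ^+ 2 + q) by rewrite /sg mul0r subr0 mul1r.
  by rewrite /h e1 e2 /rp /rm !mul0r !mul1r addr0 subr0 mulr1; ring.
by rewrite e subr0 mulr1 hbound.
Qed.

End BlackScholes.

(** * Lindeberg replacement for the likelihood ratio *)

Section Lindeberg.
Context {R : realType} {n : nat}.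
Variables (rho : R) (v : Lambda n -> R).
Hypothesis hrho : 0 < rho < 1.
Hypothesis hv1 : forall x, 2 * `|v x| <= rho.
Hypothesis hv2 : forall x, 2 * `|v x| <= 1 - rho.
Local Notation psi := (bernoulli_product (fun _ : Lambda n => rho)).
Local Notation chi := (rho * (1 - rho)).
Local Notation c0 := (normal_peak 1 : R).
Implicit Types (s : seq (Lambda n)) (eta : Omega n) (x : Lambda n).

(** For [s] without repetition, the density relative to [psi] of the product measure with density
    [rho + v] on [s] and [rho] elsewhere. The list lets sites be removed one by one. *)
Definition likelihood s eta : R := \prod_(x <- s) (1 + v x * omega rho (eta x)).

Definition lindeberg_rate (e0 : R) : R := c0 / chi * (3 / e0 + 4 / e0 ^+ 2).

Let r0 : 0 < rho. Proof. by case/andP: hrho. Qed.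
Let r1 : 0 < 1 - rho. Proof. by case/andP: hrho; rewrite subr_gt0. Qed.

Let omega_true : omega rho true = rho^-1.
Proof. by rewrite /omega /=; field; rewrite !gt_eqF. Qed.

Let omega_false : omega rho false = - (1 - rho)^-1.
Proof. by rewrite /omega /=; field; rewrite !gt_eqF. Qed.

Let factor_gt0 x b : 0 < 1 + v x * omega rho b.
Proof.
have h1 : `|v x| / rho <= 1 / 2 by rewrite ler_pdivrMr//; have := hv1 x; lra.
have h2 : `|v x| / (1 - rho) <= 1 / 2 by rewrite ler_pdivrMr//; have := hv2 x; lra.
have h3 : `|v x * omega rho b| <= 1 / 2.
  case: b; rewrite ?omega_true ?omega_false normrM ?normrN normfV.
    by rewrite [`|rho|]gtr0_norm.
  by rewrite [`|1 - rho|]gtr0_norm.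
by move: h3; rewrite ler_norml => /andP[? _]; lra.
Qed.

Lemma likelihood_gt0 s eta : 0 < likelihood s eta.
Proof. by rewrite /likelihood; apply: prodr_gt0 => x _; exact: factor_gt0. Qed.

Lemma likelihood_flip s x eta : x \notin s -> likelihood s (flip x eta) = likelihood s eta.
Proof.
move=> xs; rewrite /likelihood big_seq [RHS]big_seq; apply: eq_bigr => y ys.
by rewrite flipE; case: eqP => // e; rewrite -e ys in xs.
Qed.

(** Conditioning on all sites but [x] exposes the two-point return of [call_step], since the rest of
    the likelihood does not see [x]. *)
Lemma average_cons s x (F : R -> R) eta : x \notin s ->
  average (fun=> rho) x (fun eta => F (likelihood (x :: s) eta)) eta =
  rho * F (likelihood s eta * (1 + v x / rho)) +
  (1 - rho) * F (likelihood s eta * (1 - v x / (1 - rho))).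
Proof.
move=> xs; rewrite /average /likelihood !big_cons flipE eqxx.
rewrite -/(likelihood s eta) -/(likelihood s (flip x eta)) likelihood_flip//.
rewrite /bweight; case: (eta x) => /=; rewrite omega_true omega_false mulrN.
  by congr (_ * F _ + _ * F _); ring.
by rewrite addrC; congr (_ * F _ + _ * F _); ring.
Qed.

Lemma likelihood_mean s : uniq s -> \sum_eta psi eta * likelihood s eta = 1.
Proof.
elim: s => [|x s ih] /=.
  move=> _; under eq_bigr do rewrite /likelihood big_nil mulr1.
  exact: bernoulli_sum1.
move=> /andP[xs us]; rewrite -(mean_average1 (fun=> rho) x) -(ih us).
apply: eq_bigr => eta _; rewrite (average_cons (fun z => z) eta xs); congr (_ * _).
by field; rewrite !gt_eqF.
Qed.

Let K0 (e0 : R) : 0 < e0 -> 0 <= lindeberg_rate e0.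
Proof.
move=> e00; apply: mulr_ge0.
  by apply: divr_ge0; [exact: normal_peak_ge0 | rewrite ltW// mulr_gt0].
by apply: addr_ge0; apply: divr_ge0 => //; [exact: ltW | exact: sqr_ge0].
Qed.

(** Removing a site raises the squared volatility by its variance, so the volatility stays above
    [e0] and the rate is uniform. The error in [call_step] is proportional to the current
    likelihood, whose mean is 1. *)
Lemma lindeberg (e0 : R) s (sg : R) : 0 < e0 -> e0 <= sg -> uniq s ->
  `|\sum_eta psi eta * call sg (likelihood s eta)
     - call (Num.sqrt (sg ^+ 2 + \sum_(x <- s) v x ^+ 2 / chi)) 1| <=
  lindeberg_rate e0 * \sum_(x <- s) v x ^+ 2 / chi * `|v x|.
Proof.
move=> e00; elim: s sg => [|x s ih] sg hsg /=.
  move=> _; rewrite !big_nil addr0 mulr0 sqrtr_sqr [`|sg|]gtr0_norm; last exact: lt_le_trans hsg.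
  under eq_bigr do rewrite /likelihood big_nil.
  by rewrite -mulr_suml bernoulli_sum1 mul1r subrr normr0.
move=> /andP[xs us].
have sg0 : 0 < sg by exact: lt_le_trans hsg.
pose q := v x ^+ 2 / chi.
have q0 : 0 <= q by rewrite divr_ge0 ?sqr_ge0// ltW// mulr_gt0.
pose sg1 := Num.sqrt (sg ^+ 2 + q).
have sg1E : sg1 ^+ 2 = sg ^+ 2 + q by rewrite sqr_sqrtr// addr_ge0 ?sqr_ge0.
have hsg1 : e0 <= sg1.
  apply: le_trans hsg _; rewrite -[leLHS](gtr0_norm sg0) -sqrtr_sqr ler_wsqrtr//.
  by rewrite lerDl.
have := ih sg1 hsg1 us; rewrite sg1E.
rewrite !big_cons addrA -/q => h1.
have h2 : `|\sum_eta psi eta * call sg (likelihood (x :: s) eta) -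
    \sum_eta psi eta * call sg1 (likelihood s eta)| <= lindeberg_rate e0 * (q * `|v x|).
  rewrite -(mean_average1 (fun=> rho) x (fun eta => call sg (likelihood (x :: s) eta))).
  rewrite -sumrB; apply: le_trans (ler_norm_sum _ _ _) _.
  rewrite -[leRHS]mul1r -(likelihood_mean us) mulr_suml; apply: ler_sum => eta _.
  rewrite -mulrBr normrM ger0_norm; last first.
    by apply/ltW/bernoulli_gt0.
  rewrite -mulrA; apply: ler_wpM2l; first by apply/ltW/bernoulli_gt0.
  rewrite (average_cons (call sg) eta xs).
  have L0 := likelihood_gt0 s eta.
  apply: le_trans (call_step hrho (hv1 x) (hv2 x) sg0 L0) _.
  apply: ler_wpM2l; first exact: ltW.
  rewrite -/q [leRHS]mulrC; apply: ler_wpM2l; first exact: mulr_ge0.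
  apply: ler_wpM2l.
    by apply: divr_ge0; [exact: normal_peak_ge0 | rewrite ltW// mulr_gt0].
  have i1 : sg^-1 <= e0^-1 by rewrite lef_pV2.
  apply: lerD; first by rewrite ler_wpM2l.
  by rewrite ler_wpM2l// lef_pV2 ?posrE ?exprn_gt0// lerXn2r// nnegrE ltW.
rewrite [leRHS]mulrDr.
rewrite [X in `|X|](_ : _ = (\sum_eta psi eta * call sg (likelihood (x :: s) eta) -
    \sum_eta psi eta * call sg1 (likelihood s eta)) +
   (\sum_eta psi eta * call sg1 (likelihood s eta) -
    call (Num.sqrt (sg ^+ 2 + q + \sum_(j <- s) v j ^+ 2 / chi)) 1)); last by ring.
by apply: le_trans (ler_normD _ _) _; exact: lerD.
Qed.

Let bernoulli_likelihood eta :
  bernoulli_product (fun x => rho + v x) eta =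
  psi eta * likelihood (enum (Lambda n)) eta.
Proof.
rewrite !bernoulli_productE /likelihood big_enum -big_split; apply: eq_bigr => x _ /=.
rewrite /bweight; case: (eta x); rewrite ?omega_true ?omega_false.
  by field; rewrite gt_eqF.
by field; rewrite gt_eqF.
Qed.

(** Use |x| = 2 max(x, 0) - x with x = L - 1, whose mean is 0. *)
Lemma tv_call_payoff :
  tv_fin (bernoulli_product (fun x => rho + v x)) psi =
  \sum_eta psi eta * Num.max (likelihood (enum (Lambda n)) eta - 1) 0.
Proof.
rewrite /tv_fin; set L := likelihood _.
have psi0 eta : 0 < psi eta by apply: bernoulli_gt0.
have e eta : `|bernoulli_product (fun x => rho + v x) eta - psi eta| =
    2 * (psi eta * Num.max (L eta - 1) 0) - (psi eta * L eta - psi eta).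
  rewrite bernoulli_likelihood -/L.
  have -> : psi eta * L eta - psi eta = psi eta * (L eta - 1) by ring.
  rewrite normrM gtr0_norm//.
  by have [h|h] := leP (L eta - 1) 0; [rewrite ler0_norm//|rewrite gtr0_norm//]; ring.
under eq_bigr do rewrite e.
rewrite sumrB -mulr_sumr sumrB likelihood_mean ?enum_uniq// bernoulli_sum1 subrr subr0.
by rewrite mulrA mulVf ?mul1r.
Qed.

(** The smoothing volatility [e0] is paid for twice: on replacing the payoff by a price, and on
    replacing sqrt(e0^2 + Q) by sqrt Q. *)
Lemma tv_call (e0 vmax Q m : R) : 0 < e0 -> 0 < m ->
  Q = \sum_x v x ^+ 2 / chi -> (forall x, `|v x| <= vmax) ->
  `|tv_fin (bernoulli_product (fun x => rho + v x)) psi - call m 1| <=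
  c0 * (e0 + e0 + `|Num.sqrt Q - m|) + lindeberg_rate e0 * (Q * vmax).
Proof.
move=> e00 m0 QE hvm.
have Q0 : 0 <= Q by rewrite QE sumr_ge0// => x _; rewrite divr_ge0 ?sqr_ge0// ltW// mulr_gt0.
have c00 : 0 <= c0 by exact: normal_peak_ge0.
pose L := likelihood (enum (Lambda n)).
have h1 : `|\sum_eta psi eta * Num.max (L eta - 1) 0 - \sum_eta psi eta * call e0 (L eta)| <= c0 * e0.
  have -> : c0 * e0 = \sum_eta psi eta * L eta * (c0 * e0).
    by rewrite -mulr_suml likelihood_mean ?enum_uniq// mul1r.
  rewrite -sumrB; apply: le_trans (ler_norm_sum _ _ _) _.
  apply: ler_sum => eta _.
  rewrite -mulrBr normrM gtr0_norm; last by apply: bernoulli_gt0.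
  rewrite -mulrA; apply: ler_wpM2l; first by apply/ltW/bernoulli_gt0.
  rewrite distrC; apply: le_trans (call_payoff e00 (likelihood_gt0 _ _)) _.
  by rewrite -/L mulrCA mulrA.
have h2 := lindeberg e00 (lexx e0) (enum_uniq (Lambda n)).
rewrite !big_enum -QE -/L in h2.
have h3 : lindeberg_rate e0 * \sum_x v x ^+ 2 / chi * `|v x| <= lindeberg_rate e0 * (Q * vmax).
  apply: ler_wpM2l; first exact: K0.
  rewrite QE mulr_suml; apply: ler_sum => x _; apply: ler_wpM2l => //.
  by rewrite divr_ge0 ?sqr_ge0// ltW// mulr_gt0.
have s0 : 0 < Num.sqrt (e0 ^+ 2 + Q) by rewrite sqrtr_gt0 ltr_pwDl// exprn_gt0.
have h4 := call_lip_s s0 m0 (ltr01 : (0:R) < 1).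
have h5 : `|Num.sqrt (e0 ^+ 2 + Q) - m| <= e0 + `|Num.sqrt Q - m|.
  rewrite [X in `|X|](_ : _ = (Num.sqrt (e0 ^+ 2 + Q) - Num.sqrt Q) + (Num.sqrt Q - m)); last by ring.
  apply: le_trans (ler_normD _ _) _; rewrite lerD2r ger0_norm; last first.
    by rewrite subr_ge0 ler_wsqrtr// lerDr sqr_ge0.
  rewrite lerBlDr -[leRHS]ger0_norm ?addr_ge0 ?sqrtr_ge0 ?(ltW e00)// -sqrtr_sqr ler_wsqrtr//.
  rewrite sqrrD sqr_sqrtr// -addrA lerD2l lerDr mulrn_wge0// mulr_ge0 ?sqrtr_ge0// ltW//.
rewrite mulr1 in h4; have h6 := ler_wpM2l c00 h5.
rewrite tv_call_payoff -/L.
rewrite [X in `|X|](_ : _ =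
  (\sum_eta psi eta * Num.max (L eta - 1) 0 - \sum_eta psi eta * call e0 (L eta)) +
  (\sum_eta psi eta * call e0 (L eta) - call (Num.sqrt (e0 ^+ 2 + Q)) 1) +
  (call (Num.sqrt (e0 ^+ 2 + Q)) 1 - call m 1)); last by ring.
apply: le_trans (ler_normD _ _) _; apply: le_trans (lerD (ler_normD _ _) (lexx _)) _.
have h7 := le_trans h2 h3; have h8 := le_trans h4 h6.
lra.
Qed.

End Lindeberg.

(** * The heat profile *)

Section Trig.
Context {R : realType}.
Implicit Types x : R.

Lemma sin_pi_nat (l : nat) : sin (pi * l%:R) = 0 :> R.
Proof.
elim: l => [|l ih]; first by rewrite mulr0 sin0.
by rewrite -natr1 mulrDr mulr1 sinD ih sinpi mulr0 mul0r addr0.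
Qed.

(** This and the next three bounds form a ladder: the derivative of each difference is controlled by
    the preceding bound. *)
Lemma sin_le x : 0 <= x -> sin x <= x.
Proof.
move=> x0; rewrite -subr_le0.
have hd (y : R) : dv (fun y => sin y - y) y (cos y - 1).
  exact: (dvB (is_derive_sin y) (dvid y)).
have := dv_le x0 (fun y _ => hd y); rewrite sin0 subrr; apply.
by move=> y _; rewrite subr_le0 cos_le1.
Qed.

Lemma cos_ge x : 0 <= x -> 1 - x ^+ 2 / 2 <= cos x.
Proof.
move=> x0; rewrite -subr_le0.
have hd (y : R) : dv (fun y => 1 - y * y / 2 - cos y) y (sin y - y).
  apply: (dv_eq (dvB (dvB (dvc 1 y) (dvM (dvM (dvid y) (dvid y)) (dvc 2^-1 y))) (is_derive_cos y))).
  by field.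
have := dv_le x0 (fun y _ => hd y); rewrite cos0 mulr0 mul0r subr0 subrr expr2; apply.
by move=> y /andP[y0 _]; rewrite subr_le0 sin_le.
Qed.

Lemma sin_ge x : 0 <= x -> x - x ^+ 3 / 6 <= sin x.
Proof.
move=> x0; rewrite -subr_le0.
have -> : x ^+ 3 = x * x * x by ring.
have hd (y : R) : dv (fun y => y - y * y * y / 6 - sin y) y (1 - y ^+ 2 / 2 - cos y).
  apply: (dv_eq (dvB (dvB (dvid y) (dvM (dvM (dvM (dvid y) (dvid y)) (dvid y)) (dvc 6^-1 y))) (is_derive_sin y))).
  by field.
have := dv_le x0 (fun y _ => hd y); rewrite sin0 !(mulr0, mul0r) !subr0; apply.
by move=> y /andP[y0 _]; rewrite subr_le0 cos_ge.
Qed.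

Lemma cos_le x : 0 <= x -> cos x <= 1 - x ^+ 2 / 2 + x ^+ 4 / 24.
Proof.
move=> x0; rewrite -subr_le0.
have -> : x ^+ 4 = x * x * x * x by ring.
have -> : x ^+ 2 = x * x by ring.
have hd (y : R) : dv (fun y => cos y - (1 - y * y / 2 + y * y * y * y / 24)) y
    (y - y ^+ 3 / 6 - sin y).
  apply: (dv_eq (dvB (is_derive_cos y) (dvD (dvB (dvc 1 y) (dvM (dvM (dvid y) (dvid y)) (dvc 2^-1 y)))
    (dvM (dvM (dvM (dvM (dvid y) (dvid y)) (dvid y)) (dvid y)) (dvc 24^-1 y))))).
  by field.
have := dv_le x0 (fun y _ => hd y).
rewrite cos0 !(mulr0, mul0r) subr0 addr0 subrr; apply.
by move=> y /andP[y0 _]; rewrite subr_le0 sin_ge.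
Qed.

End Trig.

Lemma sum_by_parts (R : realType) (n : nat) (g h : nat -> R) : (0 < n)%N ->
  g 0%N = 0 -> g n = 0 ->
  \sum_(1 <= j < n) g j * (h j.+1 + h j.-1 - 2 * h j) =
  - \sum_(0 <= k < n) (g k.+1 - g k) * (h k.+1 - h k).
Proof.
case: n => // n _ g0 gn.
under [X in - X]eq_bigr do rewrite mulrBl.
rewrite sumrB [X in - (X - _)]big_nat_recr//= gn mul0r addr0 [X in - (_ - X)]big_nat_recl//= g0 mul0r add0r.
rewrite big_add1 /= -sumrB -sumrN; apply: eq_bigr => k _; ring.
Qed.

(** * Discrete sine basis and spectral form of the heat flow *)

Section SineBasis.
Context {R : realType}.
Variable n : nat.
Hypothesis n0 : (0 < n)%N.
Local Notation N := (n%:R : R).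
Implicit Types j k l : nat.

Definition sine l j : R := sin (pi * l%:R * (j%:R / N)).
Definition sine_eigenvalue l : R := 2 * N ^+ 2 * (1 - cos (pi * l%:R / N)).

Let N0 : N != 0. Proof. by rewrite pnatr_eq0 -lt0n. Qed.
Let Npos : 0 < N. Proof. by rewrite ltr0n. Qed.

Lemma sine_sym l j : sine l j = sine j l.
Proof. by rewrite /sine; congr sin; ring. Qed.

Lemma sine0 l : sine l 0 = 0.
Proof. by rewrite /sine mul0r mulr0 sin0. Qed.

Lemma sine_n l : sine l n = 0.
Proof. by rewrite /sine divff// mulr1 sin_pi_nat. Qed.

Lemma sine_lap l j : (0 < j)%N ->
  N ^+ 2 * (sine l j.+1 + sine l j.-1 - 2 * sine l j) = - sine_eigenvalue l * sine l j.
Proof.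
case: j => // j _ /=; rewrite /sine /sine_eigenvalue.
set a := pi * l%:R * (j.+1%:R / N); set b := pi * l%:R / N.
have -> : pi * l%:R * (j.+2%:R / N) = a + b by rewrite /a /b -[j.+2%:R]natr1; ring.
have -> : pi * l%:R * (j%:R / N) = a - b by rewrite /a /b -[j.+1%:R]natr1; ring.
by rewrite sinD sinB; ring.
Qed.

Lemma sine_eigenvalue_lt k l : (k < l)%N -> (l <= n)%N -> sine_eigenvalue k < sine_eigenvalue l.
Proof.
move=> kl ln; rewrite /sine_eigenvalue ltr_pM2l; last by rewrite mulr_gt0// exprn_gt0.
rewrite ltrD2l ltrN2.
have h i : (i <= n)%N -> pi * i%:R / N \in `[0, pi]%R.
  move=> hi; rewrite in_itv /= divr_ge0 ?mulr_ge0 ?pi_ge0//=.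
  by rewrite ler_pdivrMr// ler_wpM2l ?pi_ge0// ler_nat.
rewrite ltr_cos ?h//; last by rewrite (leq_trans (ltnW kl)).
by rewrite ltr_pM2r ?invr_gt0// ltr_pM2l ?pi_gt0// ltr_nat.
Qed.

Lemma sine_eigenvalue_le k l : (k <= l)%N -> (l <= n)%N -> sine_eigenvalue k <= sine_eigenvalue l.
Proof.
by rewrite leq_eqVlt => /predU1P[->//|kl] ln; apply/ltW/sine_eigenvalue_lt.
Qed.

(** The discrete Laplacian is symmetric by summation by parts, and eigenvalues at distinct
    frequencies are distinct. *)
Lemma sine_orthogonal k l : (0 < k < n)%N -> (0 < l < n)%N -> k != l ->
  \sum_(1 <= j < n) sine k j * sine l j = 0.
Proof.
move=> /andP[k0 kn] /andP[l0 ln] kl.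
pose S := \sum_(1 <= j < n) sine k j * sine l j; rewrite -/S.
have e a b : \sum_(1 <= j < n) sine a j * (sine b j.+1 + sine b j.-1 - 2 * sine b j) =
    - sine_eigenvalue b / N ^+ 2 * \sum_(1 <= j < n) sine a j * sine b j.
  rewrite mulr_sumr; apply: eq_big_nat => j /andP[j0 _].
  have -> : sine b j.+1 + sine b j.-1 - 2 * sine b j =
     N ^+ 2 * (sine b j.+1 + sine b j.-1 - 2 * sine b j) / N ^+ 2.
    by field.
  by rewrite sine_lap//; ring.
have h1 := e k l; have h2 := e l k.
rewrite sum_by_parts ?sine0 ?sine_n// in h1.
rewrite sum_by_parts ?sine0 ?sine_n// in h2.
have h3 : \sum_(1 <= j < n) sine l j * sine k j = S by apply: eq_bigr => j _; rewrite mulrC.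
have h4 : \sum_(0 <= i < n) (sine l i.+1 - sine l i) * (sine k i.+1 - sine k i) =
   \sum_(0 <= i < n) (sine k i.+1 - sine k i) * (sine l i.+1 - sine l i).
  by apply: eq_bigr => j _; rewrite mulrC.
rewrite h3 h4 h1 -/S in h2.
have : (sine_eigenvalue l - sine_eigenvalue k) * S = 0.
  transitivity (N ^+ 2 * (- sine_eigenvalue k / N ^+ 2 * S - - sine_eigenvalue l / N ^+ 2 * S)).
    by field.
  by rewrite -h2 subrr mulr0.
move/eqP; rewrite mulf_eq0 => /orP[|/eqP//].
rewrite subr_eq0 => /eqP e2; exfalso.
move: kl; rewrite neq_ltn => /orP[/sine_eigenvalue_lt|/sine_eigenvalue_lt] H.
  by have := H (ltnW ln); rewrite e2 ltxx.
by have := H (ltnW kn); rewrite e2 ltxx.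
Qed.

Lemma sine_norm l : (0 < l < n)%N -> \sum_(1 <= j < n) sine l j ^+ 2 = N / 2.
Proof.
move=> /andP[l0 ln].
pose h := pi * l%:R / N.
have sh : sin h != 0.
  rewrite gt_eqF// sin_gt0_pi// /h divr_gt0 ?mulr_gt0 ?pi_gt0 ?ltr0n//=.
  by rewrite ltr_pdivrMr// ltr_pM2l ?pi_gt0// ltr_nat.
(* Multiplication by [2 * sin h] makes the cosine sum telescope; its ends agree because 2 h N = 2 pi
   l is a multiple of the period. *)
have tel : \sum_(0 <= j < n) cos (2 * h * j%:R) * (2 * sin h) = 0.
  have -> : \sum_(0 <= j < n) cos (2 * h * j%:R) * (2 * sin h) =
     \sum_(0 <= j < n) (sin (2 * h * j.+1%:R - h) - sin (2 * h * j%:R - h)).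
    apply: eq_bigr => j _.
    have -> : 2 * h * j.+1%:R - h = 2 * h * j%:R + h by rewrite -natr1; ring.
    by rewrite sinD sinB; ring.
  rewrite telescope_sumr// mulr0 add0r.
  have -> : 2 * h * N - h = pi * (l * 2)%:R - h by rewrite /h natrM; field.
  by rewrite sinB sin_pi_nat mul0r sub0r sinN opprK; rewrite mulrC natrM mulrA;
     have := cos2Dsin2 (pi * l%:R : R); rewrite sin_pi_nat expr0n /= addr0 => c2;
     rewrite mulr_natr cos_mulr2n c2; ring.
have cs : \sum_(0 <= j < n) cos (2 * h * j%:R) = 0.
  apply: (mulIf (_ : 2 * sin h != 0)); first by rewrite mulf_neq0.
  by rewrite mul0r mulr_suml.
have e : \sum_(0 <= j < n) sine l j ^+ 2 = N / 2.
  transitivity (\sum_(0 <= j < n) (2^-1 - 2^-1 * cos (2 * h * j%:R))).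
    apply: eq_bigr => j _.
    have -> : 2 * h * j%:R = (pi * l%:R * (j%:R / N)) *+ 2.
      by rewrite /h -mulr_natr; ring.
    by rewrite cos_mulr2n /sine sin2cos2 -[X in _ = _ - _ * (X - 1)]mulr_natr; field.
  by rewrite sumrB -mulr_sumr cs mulr0 subr0 big_const_nat iter_addr_0 subn0 -[LHS]mulr_natl.
by rewrite -e [in RHS]big_ltn// sine0 expr0n add0r.
Qed.

Lemma sine_gram k l : (0 < k < n)%N -> (0 < l < n)%N ->
  \sum_(1 <= j < n) sine k j * sine l j = (k == l)%:R * (N / 2).
Proof.
move=> hk hl; have [<-|kl] := eqVneq k l; last by rewrite sine_orthogonal// mul0r.
by rewrite mul1r -(sine_norm hk); apply: eq_bigr => j _; rewrite expr2.
Qed.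

Lemma sum_nat_delta (F : nat -> R) l : (0 < l < n)%N ->
  \sum_(1 <= k < n) (k == l)%:R * F k = F l.
Proof.
move=> /andP[l0 ln]; rewrite (bigD1_seq l)/= ?mem_index_iota ?l0 ?iota_uniq//.
by rewrite eqxx mul1r big1 ?addr0// => k /negbTE ->; rewrite mul0r.
Qed.

Lemma parseval (a : nat -> R) :
  \sum_(1 <= j < n) (\sum_(1 <= l < n) a l * sine l j) ^+ 2 =
  N / 2 * \sum_(1 <= l < n) a l ^+ 2.
Proof.
transitivity (\sum_(1 <= l < n) \sum_(1 <= k < n) a l * a k *
   \sum_(1 <= j < n) sine l j * sine k j).
  under eq_bigr do rewrite expr2 mulr_suml.
  rewrite exchange_big /=; apply: eq_bigr => l _.
  under eq_bigr do rewrite mulr_sumr.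
  rewrite exchange_big /=; apply: eq_bigr => k _.
  by rewrite mulr_sumr; apply: eq_bigr => j _; ring.
rewrite mulr_sumr; apply: eq_big_nat => l hl.
rewrite (eq_big_nat _ _ (F2 := fun k => (k == l)%:R * (a l * a k * (N / 2)))).
  by rewrite sum_nat_delta//; ring.
by move=> k hk; rewrite sine_gram// eq_sym; ring.
Qed.

Variable f : nat -> R.
Hypothesis f0 : f 0%N = 0.
Hypothesis fn : f n = 0.

Definition sine_coef l : R := 2 / N * \sum_(1 <= j < n) f j * sine l j.

Definition heat (t : R) j : R :=
  \sum_(1 <= l < n) sine_coef l * expR (- sine_eigenvalue l * t) * sine l j.

Lemma heat_0 t : heat t 0 = 0.
Proof. by apply: big1 => l _; rewrite sine0 mulr0. Qed.

Lemma heat_n t : heat t n = 0.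
Proof. by apply: big1 => l _; rewrite sine_n mulr0. Qed.

(* The sine matrix is symmetric, so its completeness is its orthogonality. *)
Lemma heat_initial j : (j <= n)%N -> heat 0 j = f j.
Proof.
rewrite leq_eqVlt => /predU1P[->|jn]; first by rewrite heat_n fn.
case: j jn => [_|j jn]; first by rewrite heat_0 f0.
have hj : (0 < j.+1 < n)%N by [].
transitivity (\sum_(1 <= i < n) 2 / N * f i * \sum_(1 <= l < n) sine i l * sine j.+1 l).
  rewrite /heat /sine_coef; under eq_bigr do rewrite mulr0 expR0 mulr1 mulr_sumr mulr_suml.
  rewrite exchange_big /=; apply: eq_bigr => i _; rewrite mulr_sumr; apply: eq_bigr => l _.
  by rewrite (sine_sym i) (sine_sym j.+1); ring.
rewrite (eq_big_nat _ _ (F2 := fun i => (i == j.+1)%:R * f i)).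
  by rewrite sum_nat_delta.
by move=> i hi; rewrite sine_gram//; field.
Qed.

Lemma heat_equation (t : R) j : (0 < j)%N ->
  dv (heat ^~ j) t (N ^+ 2 * (heat t j.+1 + heat t j.-1 - 2 * heat t j)).
Proof.
move=> j0.
have h : dv (heat ^~ j) t (\sum_(1 <= l < n)
    (sine_coef l * (expR (- sine_eigenvalue l * t) * (- sine_eigenvalue l * 1)) * sine l j
     + sine_coef l * expR (- sine_eigenvalue l * t) * 0)).
  apply: dv_sum => l.
  exact: (dvM (dvZ _ (dv_exp (dvZ (- sine_eigenvalue l) (dvid t)))) (dvc (sine l j) t)).
apply: (dv_eq h); rewrite /heat [2 * _]mulr_sumr -sumrN -!big_split mulr_sumr.
apply: eq_bigr => l _ /=.
transitivity (sine_coef l * expR (- sine_eigenvalue l * t) *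
    (N ^+ 2 * (sine l j.+1 + sine l j.-1 - 2 * sine l j))); last by ring.
by rewrite sine_lap//; ring.
Qed.

Lemma heat_sqr_sum t : \sum_(1 <= j < n) heat t j ^+ 2 =
  N / 2 * \sum_(1 <= l < n) (sine_coef l * expR (- sine_eigenvalue l * t)) ^+ 2.
Proof. exact: parseval. Qed.

Lemma heat_energy t : N * \sum_(0 <= k < n) (heat t k.+1 - heat t k) ^+ 2 =
  2^-1 * \sum_(1 <= l < n) sine_eigenvalue l * (sine_coef l * expR (- sine_eigenvalue l * t)) ^+ 2.
Proof.
have := @sum_by_parts R n (heat t) (heat t) n0 (heat_0 t) (heat_n t).
have -> : \sum_(0 <= k < n) (heat t k.+1 - heat t k) * (heat t k.+1 - heat t k) =
  \sum_(0 <= k < n) (heat t k.+1 - heat t k) ^+ 2 by apply: eq_bigr => k _; rewrite expr2.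
move=> /(congr1 (fun z => - z)); rewrite opprK => <-.
pose a l := sine_coef l * expR (- sine_eigenvalue l * t).
have lapE j : (0 < j)%N -> heat t j.+1 + heat t j.-1 - 2 * heat t j =
    - N ^- 2 * \sum_(1 <= l < n) sine_eigenvalue l * a l * sine l j.
  move=> j0; rewrite /heat [2 * _]mulr_sumr -sumrN -!big_split mulr_sumr.
  apply: eq_bigr => l _ /=; rewrite -/(a l).
  transitivity (a l * N ^- 2 * (N ^+ 2 * (sine l j.+1 + sine l j.-1 - 2 * sine l j))).
    by field.
  by rewrite sine_lap//; ring.
rewrite (eq_big_nat _ _ (F2 := fun j => - N ^- 2 * \sum_(1 <= l < n) \sum_(1 <= k < n)
   sine_eigenvalue l * a l * a k * (sine l j * sine k j))); last first.
  move=> j /andP[j0 _]; rewrite lapE// mulrCA; congr (_ * _).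
  rewrite mulr_sumr; apply: eq_bigr => l _; rewrite /heat mulr_suml.
  by apply: eq_bigr => k _; rewrite -/(a k); ring.
rewrite -mulr_sumr exchange_big /=.
rewrite (eq_big_nat _ _ (F2 := fun l => N / 2 * (sine_eigenvalue l * a l ^+ 2))); last first.
  move=> l hl; rewrite exchange_big /=.
  rewrite (eq_big_nat _ _ (F2 := fun k => (k == l)%:R * (sine_eigenvalue l * a l * a k * (N / 2)))).
    by rewrite sum_nat_delta//; ring.
  by move=> k hk; rewrite -mulr_sumr sine_gram// eq_sym; ring.
by rewrite -mulr_sumr; field.
Qed.

Lemma sine_eigenvalue_ge0 l : 0 <= sine_eigenvalue l.
Proof.
by rewrite /sine_eigenvalue mulr_ge0// ?mulr_ge0 ?sqr_ge0// subr_ge0 cos_le1.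
Qed.

Lemma heat_energy_decay t : 0 <= t ->
  N * \sum_(0 <= k < n) (heat t k.+1 - heat t k) ^+ 2 <=
  (N * \sum_(0 <= k < n) (f k.+1 - f k) ^+ 2) * expR (- (2 * sine_eigenvalue 1) * t).
Proof.
move=> t0.
have -> : \sum_(0 <= k < n) (f k.+1 - f k) ^+ 2 = \sum_(0 <= k < n) (heat 0 k.+1 - heat 0 k) ^+ 2.
  by apply: eq_big_nat => k /andP[_ kn]; rewrite !heat_initial// ltnW.
rewrite !heat_energy -mulrA ler_wpM2l// mulr_suml.
rewrite big_nat [leRHS]big_nat; apply: ler_sum => l /andP[l0 ln].
rewrite -mulrA; apply: ler_wpM2l; first exact: sine_eigenvalue_ge0.
rewrite mulr0 expR0 mulr1 exprMn; apply: ler_wpM2l; first exact: sqr_ge0.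
rewrite -expRM_natl ler_expR.
have := ler_wpM2r t0 (sine_eigenvalue_le l0 (ltnW ln)); lra.
Qed.

(** A discrete Poincare bound: telescope from the boundary value 0 and apply Cauchy-Schwarz to the
    at most [n] increments. *)
Lemma heat_sqr_le t j : (j <= n)%N ->
  heat t j ^+ 2 <= N * \sum_(0 <= k < n) (heat t k.+1 - heat t k) ^+ 2.
Proof.
move=> jn.
have e : heat t j = \sum_(i < j) (heat t i.+1 - heat t i) * 1.
  under eq_bigr do rewrite mulr1.
  by rewrite -(big_mkord xpredT (fun i => heat t i.+1 - heat t i)) telescope_sumr// heat_0 subr0.
have cs := @sqr_sum_mul R _ (fun i : 'I_j => heat t i.+1 - heat t i) (fun=> 1).
rewrite -e in cs; apply: le_trans cs _.
rewrite [X in _ * X](_ : _ = j%:R); last first.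
  under eq_bigr do rewrite expr1n.
  by rewrite sumr_const card_ord.
rewrite mulrC; apply: ler_pM => //; rewrite ?ler_nat//.
  by apply: sumr_ge0 => i _; exact: sqr_ge0.
rewrite -(big_mkord xpredT (fun i => (heat t i.+1 - heat t i) ^+ 2)).
rewrite [leRHS](@big_cat_nat _ _ _ j)//= lerDl.
by apply: sumr_ge0 => i _; exact: sqr_ge0.
Qed.

Lemma sine_coef_sqr_sum : \sum_(1 <= l < n) sine_coef l ^+ 2 = 2 / N * \sum_(1 <= j < n) f j ^+ 2.
Proof.
have := heat_sqr_sum 0.
under [in X in _ = X -> _]eq_bigr do rewrite mulr0 expR0 mulr1.
rewrite (eq_big_nat _ _ (F2 := fun j => f j ^+ 2)) => [->|j /andP[_ jn]].
  by field.
by rewrite heat_initial// ltnW.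
Qed.

End SineBasis.

Section RiemannSum.
Context {R : realType}.
Variable g : R -> R.
Hypothesis g_cont : continuous g.
Local Notation leb := (@lebesgue_measure R).

(** The primitive starts at -1 so that 0 is an interior point and has a two-sided derivative. *)
Let F (x : R) : R := \int[leb]_(t in `[-1, x]) g t.

Let dvF (x : R) : -1 < x -> dv F x (g x).
Proof.
move=> x1.
have [||||h1 h2] := @continuous_FTC1 R g (BLeft (-1)) x (x + 1).
- by rewrite ltrDl.
- apply: (@continuous_compact_integrable R g); first exact: segment_compact.
  exact: continuous_subspaceT.
- by rewrite /= lte_fin.
- exact: g_cont.
by split; [exact: h1 | rewrite -h2 derive1E].
Qed.

Let integralE : \int[leb]_(x in `[0, 1]) g x = F 1 - F 0.
Proof.
rewrite /Rintegral (@continuous_FTC2 R g F 0 1)//.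
- exact: continuous_subspaceT.
- split.
  + move=> x; rewrite in_itv /= => /andP[x0 _].
    have x1 : -1 < x by lra.
    by have [] := dvF x1.
  + by apply: cvg_at_right_filter; apply: (dv_continuous (dvF _)); lra.
  + by apply: cvg_at_left_filter; apply: (dv_continuous (dvF _)); lra.
- move=> x; rewrite in_itv /= => /andP[x0 _].
  have x1 : -1 < x by lra.
  by rewrite derive1E; have [_ ->] := dvF x1.
Qed.

Lemma riemann_sum (A : R) (n : nat) : (0 < n)%N ->
  (forall x y, 0 <= x <= 1 -> 0 <= y <= 1 -> `|g x - g y| <= A * `|x - y|) ->
  `|n%:R^-1 * (\sum_(0 <= j < n) g (j%:R / n%:R)) - \int[leb]_(x in `[0, 1]) g x| <= A / n%:R.
Proof.
move=> n0 hA; rewrite integralE.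
have N0 : 0 < n%:R :> R by rewrite ltr0n.
have A0 : 0 <= A.
  have h01 : 0 <= (1:R) <= 1 by rewrite ler01 lexx.
  have h00 : 0 <= (0:R) <= 1 by rewrite ler01 lexx.
  by have := hA 1 0 h01 h00; rewrite subr0 normr1 mulr1; apply: le_trans.
pose x j : R := j%:R / n%:R.
have xS j : x j.+1 = x j + n%:R^-1 by rewrite /x -natr1 mulrDl mul1r.
have x0 j : 0 <= x j by rewrite divr_ge0.
have x1 j : (j <= n)%N -> x j <= 1 by move=> hj; rewrite ler_pdivrMr// mul1r ler_nat.
have -> : F 1 - F 0 = \sum_(0 <= j < n) (F (x j.+1) - F (x j)).
  by rewrite telescope_sumr// /x mul0r divff// gt_eqF.
rewrite mulr_sumr -sumrB; apply: le_trans (ler_norm_sum _ _ _) _.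
apply: (@le_trans _ _ (\sum_(0 <= j < n) A / n%:R ^+ 2)).
  rewrite big_nat [leRHS]big_nat; apply: ler_sum => j /andP[_ hj].
  have xx : x j <= x j.+1 by rewrite xS lerDl invr_ge0.
  have hz (z : R) : x j <= z <= x j.+1 -> -1 < z.
    by move=> /andP[h _]; have := x0 j; lra.
  have [c /andP[c0 c1] ->] := mvt xx (fun z h => dvF (hz z h)).
  rewrite -/(x j) {1}xS [X in `|X|](_ : _ = (g (x j) - g c) * n%:R^-1); last by ring.
  rewrite normrM.
  rewrite [`|n%:R^-1|]gtr0_norm ?invr_gt0// expr2 invfM mulrA ler_wpM2r ?invr_ge0//.
  apply: le_trans (hA _ _ _ _) _.
  - by rewrite x0 x1// ltnW.
  - by rewrite (le_trans (x0 j) c0) (le_trans c1)// x1.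
  rewrite ler_wpM2l// distrC ger0_norm ?subr_ge0//.
  by rewrite xS in c1; lra.
rewrite big_const_nat iter_addr_0 subn0 -[leLHS]mulr_natl.
by rewrite le_eqVlt; apply/orP; left; apply/eqP; field; rewrite gt_eqF.
Qed.

End RiemannSum.

Section Profile01.
Context {R : realType}.
Variable u0 : R -> R.
Hypothesis hu : bounded_derivative01 u0.

Definition clamp01 (x : R) : R := Num.max 0 (Num.min 1 x).

Lemma clamp01_itv x : 0 <= clamp01 x <= 1.
Proof.
rewrite /clamp01 le_max lexx /=.
by rewrite ge_max ler01 ge_min lexx.
Qed.

Lemma clamp01_id x : 0 <= x <= 1 -> clamp01 x = x.
Proof. by move=> /andP[x0 x1]; rewrite /clamp01 (min_idPr x1) (max_idPr x0). Qed.

Lemma clamp01_lip x y : `|clamp01 x - clamp01 y| <= `|x - y|.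
Proof.
rewrite /clamp01; wlog xy : x y / y <= x.
  move=> H; have [h|/ltW h] := leP y x; first exact: H.
  by rewrite distrC [`|x - y|]distrC; exact: H.
rewrite [`|x - y|]ger0_norm ?subr_ge0//.
have [h1|h1] := leP 1 x; have [h2|h2] := leP 1 y; have [h3|h3] := leP 0 x;
  have [h4|h4] := leP 0 y; rewrite ?(max_idPr _)// ?(max_idPl _)//;
  rewrite ler_norml; apply/andP; split; lra.
Qed.

(** Constant extension from [0, 1] to the line: [u0] is uncontrolled outside the interval, while
    this function is globally continuous and Lipschitz. *)
Definition clamped (x : R) : R := u0 (clamp01 x).

Lemma local_expansion (du0 : R -> R) (c : R) : has_derivative01 u0 du0 ->
  0 <= c <= 1 -> forall e, 0 < e -> exists2 d, 0 < d &
  forall y, 0 <= y <= 1 -> `|y - c| < d -> `|u0 y - u0 c - du0 c * (y - c)| <= e * `|y - c|.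
Proof.
move=> hd hc e e0.
have hc' : c \in `[0, 1]%R by rewrite in_itv.
have /cvgrPdist_le /(_ e e0) := hd c hc'.
rewrite near_withinE near_withinE => /nbhs_ballP[d /= d0 hb].
exists d => // y hy yc.
have [->|ync] := eqVneq y c; first by rewrite !subrr mulr0 subr0 normr0 mulr0.
have := hb y; rewrite /ball /= distrC => /(_ yc ync).
rewrite /= in_itv /= => /(_ hy) h.
have yc0 : y - c != 0 by rewrite subr_eq0.
rewrite [X in `|X|](_ : _ = - (du0 c - (u0 y - u0 c) / (y - c)) * (y - c)); last by field.
by rewrite normrM normrN ler_wpM2r.
Qed.

Lemma clamped_continuous : continuous clamped.
Proof.
have [du0 [M [hd hM]]] := hu => x.
pose c := clamp01 x; have hc : 0 <= c <= 1 := clamp01_itv x.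
have [d d0 hdd] := local_expansion hd hc ltr01.
apply/cvgrPdist_le => /= e e0.
pose L := `|du0 c| + 1.
have L0 : 0 < L by rewrite ltr_pwDr.
near=> y.
have yx : `|y - x| < d by rewrite distrC; near: y; apply: cvgr_dist_lt => //; exact: cvg_id.
have yx2 : `|y - x| <= e / L.
  by rewrite distrC; near: y; apply: cvgr_dist_le; [exact: cvg_id | rewrite divr_gt0].
have h := hdd (clamp01 y) (clamp01_itv y) (le_lt_trans (clamp01_lip y x) yx).
rewrite mul1r in h.
rewrite /clamped distrC -/c.
apply: (@le_trans _ _ (L * `|clamp01 y - c|)).
  rewrite [X in `|X|](_ : _ = (u0 (clamp01 y) - u0 c - du0 c * (clamp01 y - c)) +
    du0 c * (clamp01 y - c)); last by ring.
  apply: le_trans (ler_normD _ _) _; rewrite /L mulrDl mul1r addrC normrM.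
  by rewrite lerD2l.
apply: (@le_trans _ _ (L * `|y - x|)); first by rewrite ler_wpM2l ?clamp01_lip// ltW.
by rewrite mulrC -ler_pdivlMr.
Unshelve. all: by end_near. Qed.

(** At interior points [clamped] has the two-sided derivative [du0]; the mean value theorem asks
    only for continuity at the ends, and [clamp01] is a contraction. *)
Lemma profile_lipschitz : exists2 M, 0 <= M & forall x y,
  `|clamped x - clamped y| <= M * `|x - y|.
Proof.
have [du0 [M [hd hM]]] := hu.
have M0 : 0 <= M.
  have h0 : (0:R) \in `[0, 1]%R by rewrite in_itv /= lexx ler01.
  by apply: le_trans (hM 0 h0).
exists M => // x y.
have key a b : a <= b -> 0 <= a -> b <= 1 -> `|u0 b - u0 a| <= M * (b - a).
  move=> ab a0 b1.
  have ea z : 0 <= z <= 1 -> clamped z = u0 z by move=> hz; rewrite /clamped clamp01_id.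
  rewrite -ea; last by rewrite b1 (le_trans a0).
  rewrite -(ea a); last by rewrite a0 (le_trans ab).
  have [||c hc ->] := @MVT_segment R clamped du0 a b ab.
  - move=> z; rewrite in_itv /= => /andP[za zb].
    have hz : 0 <= z <= 1 by rewrite (le_trans a0 (ltW za)) (le_trans (ltW zb) b1).
    have cv : h^-1 *: (clamped (h *: (1:R) + z) - clamped z) @[h --> (0:R)^'] --> du0 z.
      apply/cvgrPdist_le => /= e e0.
      have [d d0 hdd] := local_expansion hd hz e0.
      near=> h.
      have h0 : h != 0 by near: h; exact: nbhs_dnbhs_neq.
      have h1 : `|h| < d by near: h; exact: dnbhs0_lt.
      have h2 : `|h| < z - a by near: h; apply: dnbhs0_lt; rewrite subr_gt0.
      have h3 : `|h| < b - z by near: h; apply: dnbhs0_lt; rewrite subr_gt0.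
      have hw : 0 <= z + h <= 1.
        by move: h2 h3; rewrite !ltr_norml => /andP[? ?] /andP[? ?]; apply/andP; split; lra.
      rewrite /GRing.scale /= mulr1 [h + z]addrC !ea//.
      have := hdd (z + h) hw; rewrite addrAC subrr add0r => /(_ h1) hh.
      have -> : du0 z - h^-1 * (u0 (z + h) - u0 z) = - h^-1 * (u0 (z + h) - u0 z - du0 z * h).
        by field.
      by rewrite normrM normrN normfV ler_pdivrMl ?normr_gt0// [leRHS]mulrC.
    apply: DeriveDef; first by apply/cvg_ex; exists (du0 z).
    exact: cvg_lim.
  - exact: continuous_subspaceT clamped_continuous.
  rewrite normrM [`|b - a|]ger0_norm ?subr_ge0// ler_wpM2r ?subr_ge0// hM//.
  move: hc; rewrite !in_itv /= => /andP[h1 h2].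
  by rewrite (le_trans a0 h1) (le_trans h2 b1).
have key2 a b : 0 <= a <= 1 -> 0 <= b <= 1 -> `|u0 b - u0 a| <= M * `|b - a|.
  move=> /andP[a0 a1] /andP[b0 b1]; have [ab|/ltW ab] := leP a b.
    by rewrite [`|b - a|]ger0_norm ?subr_ge0//; exact: key.
  by rewrite distrC [`|b - a|]distrC [`|a - b|]ger0_norm ?subr_ge0//; exact: key.
apply: le_trans (key2 _ _ (clamp01_itv y) (clamp01_itv x)) _.
by rewrite ler_wpM2l// clamp01_lip.
Unshelve. all: by end_near. Qed.

Lemma profile_margin : (forall x, x \in `[0, 1]%R -> 0 < u0 x < 1) ->
  exists2 eps, 0 < eps & forall x, eps <= clamped x <= 1 - eps.
Proof.
move=> h01.
have hc : {within `[0, 1], continuous clamped}.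
  exact: continuous_subspaceT clamped_continuous.
have [a ha hmin] := EVT_min ler01 hc.
have [b hb hmax] := EVT_max ler01 hc.
have hx z : 0 < clamped z < 1.
  by apply: h01; rewrite in_itv /= clamp01_itv.
have ext z : clamped (clamp01 z) = clamped z.
  by rewrite /clamped clamp01_id// clamp01_itv.
exists (Num.min (clamped a) (1 - clamped b)).
  have /andP[? _] := hx a; have /andP[_ ?] := hx b.
  by rewrite lt_min; apply/andP; split; lra.
move=> x.
have hxi : clamp01 x \in `[0, 1]%R by rewrite in_itv /= clamp01_itv.
have h1 := hmin _ hxi; have h2 := hmax _ hxi.
rewrite ext in h1; rewrite ext in h2.
apply/andP; split; first by rewrite ge_min h1.
have : Num.min (clamped a) (1 - clamped b) <= 1 - clamped b by rewrite ge_min lexx orbT.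
lra.
Qed.

End Profile01.

Lemma tv_fin_sub (R : realType) (T : finType) (p q r : T -> R) :
  `|tv_fin p r - tv_fin q r| <= tv_fin p q.
Proof.
rewrite /tv_fin -mulrBr normrM ger0_norm ?invr_ge0// ler_wpM2l ?invr_ge0// -sumrB.
apply: le_trans (ler_norm_sum _ _ _) _; apply: ler_sum => x _.
apply: le_trans (ler_dist_dist _ _) _.
by rewrite opprB addrA subrK.
Qed.

(** A spectral gap uniform in the size; the constant 1 is crude, obtained from [cos_le] with pi >= 2
    and pi / N <= 4 / 3. *)
Lemma sine_eigenvalue1_ge1 (R : realType) (m : nat) : 1 <= sine_eigenvalue m.+3 1 :> R.
Proof.
rewrite /sine_eigenvalue mulr1; set N : R := m.+3%:R; set x := pi / N.
have N3 : 3 <= N by rewrite ler_nat.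
have N0 : 0 < N by lra.
have p2 : 2 <= pi :> R := pi_ge2 R.
have p4 : pi <= 4 :> R by have := @pihalf_lt2 R; lra.
have x0 : 0 <= x by rewrite divr_ge0// ltW// (lt_le_trans _ p2).
have xN : x * N = pi by rewrite divfK// gt_eqF.
have hc := cos_le x0.
have h1 : N ^+ 2 * (x ^+ 2 - x ^+ 4 / 12) <= 2 * N ^+ 2 * (1 - cos x).
  have := ler_wpM2l (sqr_ge0 N) hc; nra.
apply: le_trans h1.
have -> : N ^+ 2 * (x ^+ 2 - x ^+ 4 / 12) = pi ^+ 2 * (1 - x ^+ 2 / 12).
  by rewrite -xN; ring.
have x2 : x <= 4 / 3 by rewrite ler_pdivrMr//; nra.
have x3 : x ^+ 2 / 12 <= 1 / 6 by nra.
nra.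
Qed.

(** * Relaxation estimate at a fixed size, with constants independent of it *)

Section FixedSize.
Context {R : realType}.
Variables (rho : R) (u0 : R -> R) (M eps : R).
Hypothesis M0 : 0 <= M.
Hypothesis eps0 : 0 < eps.
Hypothesis u0_lip : forall x y, `|clamped u0 x - clamped u0 y| <= M * `|x - y|.
Hypothesis u0_eps : forall x, eps <= clamped u0 x <= 1 - eps.
Hypothesis u0_left : u0 0 = rho.
Hypothesis u0_right : u0 1 = rho.

Definition deviation (n j : nat) : R := clamped u0 (j%:R / n%:R) - rho.

Let ext_in (x : R) : 0 <= x <= 1 -> clamped u0 x = u0 x.
Proof. by move=> hx; rewrite /clamped clamp01_id. Qed.

Lemma deviation0 n : deviation n 0 = 0.
Proof. by rewrite /deviation mul0r ext_in ?lexx ?ler01// u0_left subrr. Qed.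

Lemma deviation_n n : (0 < n)%N -> deviation n n = 0.
Proof.
move=> n0; rewrite /deviation divff ?pnatr_eq0 -?lt0n//.
by rewrite ext_in ?lexx ?ler01// u0_right subrr.
Qed.

Let rho_eps : eps <= rho <= 1 - eps.
Proof. by have := u0_eps 0; rewrite ext_in ?lexx ?ler01// u0_left. Qed.

Lemma deviation_grad n k : (0 < n)%N -> n%:R * `|deviation n k.+1 - deviation n k| <= M.
Proof.
move=> n0; have N0 : 0 < n%:R :> R by rewrite ltr0n.
rewrite mulrC -ler_pdivlMr//.
have -> : deviation n k.+1 - deviation n k =
  clamped u0 (k.+1%:R / n%:R) - clamped u0 (k%:R / n%:R) by rewrite /deviation; ring.
apply: le_trans (u0_lip _ _) _; rewrite -mulrBl -natr1 addrAC subrr add0r mul1r.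
by rewrite ger0_norm// invr_ge0 ltW.
Qed.

Definition density_profile (n : nat) (t : R) (j : nat) : R :=
  rho + heat n (deviation n) t j.

Lemma deviation_energy n : (0 < n)%N ->
  n%:R * \sum_(0 <= k < n) (deviation n k.+1 - deviation n k) ^+ 2 <= M ^+ 2.
Proof.
move=> n0; have N0 : 0 < n%:R :> R by rewrite ltr0n.
apply: (@le_trans _ _ (n%:R * \sum_(0 <= k < n) (M / n%:R) ^+ 2)).
  rewrite ler_wpM2l// ?ler0n//; apply: ler_sum => k _.
  rewrite -real_normK ?num_real// lerXn2r ?nnegrE ?divr_ge0//.
  by rewrite ler_pdivlMr// mulrC deviation_grad.
rewrite big_const_nat iter_addr_0 subn0 -[_ *+ n]mulr_natl.
by rewrite le_eqVlt; apply/orP; left; apply/eqP; field; rewrite gt_eqF.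
Qed.

(** The energy controls the supremum and decays at rate at least 2, so the square root leaves
    [expR (- t)]. This is the uniform smallness that the Lindeberg step needs. *)
Lemma heat_max_le m (t : R) j : 0 <= t -> (j <= m.+3)%N ->
  `|heat m.+3 (deviation m.+3) t j| <= M * expR (- t).
Proof.
move=> t0 hj.
have h1 := heat_sqr_le (n := m.+3) (deviation m.+3) t hj.
have h2 := heat_energy_decay (n := m.+3) isT (deviation0 _) (deviation_n (isT : (0 < m.+3)%N)) t0.
have h3 := le_trans h1 h2.
rewrite -sqrtr_sqr -[leRHS]ger0_norm ?mulr_ge0 ?expR_ge0// -sqrtr_sqr ler_wsqrtr//.
apply: le_trans h3 _; rewrite exprMn -expRM_natl; apply: ler_pM; rewrite ?expR_ge0//.
- by rewrite mulr_ge0// sumr_ge0// => k _; exact: sqr_ge0.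
- exact: deviation_energy.
- rewrite ler_expR; have := ler_wpM2r t0 (sine_eigenvalue1_ge1 R m); lra.
Qed.

Let u := density_profile.

Lemma initialE m : @initial R u0 m.+3 = bernoulli_product (profile (m := m) (u m.+3 0)).
Proof.
rewrite /initial; congr bernoulli_product; apply/funext => x.
rewrite /profile /u /density_profile.
have hx : (site x <= m.+3)%N by case/andP: (site_range x) => _ /leqW.
rewrite heat_initial ?deviation0 ?deviation_n// /deviation addrC subrK ext_in//.
by rewrite divr_ge0//= ler_pdivrMr ?ltr0n// mul1r ler_nat.
Qed.

(** The 1 keeps the rate below that of the energy of the profile; the second term is the constraint
    [c_lsi] of the entropy estimate. *)
Definition relax_rate : R := Num.min 1 (2 * lsi_constant eps M)^-1.

Let lsi_gt0 : 0 < lsi_constant eps M.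
Proof.
apply: (@lsi_constant_gt0 R 0 (fun=> 0) eps M eps0) => k _.
by rewrite subrr normr0 mulr0.
Qed.

Lemma relax_rate_gt0 : 0 < relax_rate.
Proof. by rewrite lt_min ltr01 invr_gt0 mulr_gt0. Qed.

(** The margins and gradients of the profile are preserved by the maximum principles and its energy
    decays spectrally, so [tv_relaxation] applies with constants free of [m]. *)
Lemma D_near_product m (t : R) : 0 <= t ->
  `|D rho u0 m.+3 t - tv_fin (bernoulli_product (fun x : Lambda m.+3 =>
       rho + heat m.+3 (deviation m.+3) t (site x))) (@stationary R rho m.+3)| <=
  Num.sqrt (2 * lsi_constant eps M * (M ^+ 2 / eps ^+ 4 * M ^+ 2) * expR (- relax_rate * t)).
Proof.
move=> t0; apply: le_trans (tv_fin_sub _ _ _) _; rewrite initialE.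
pose n := m.+3.
have uheat (s : R) j : (0 < j <= m.+2)%N ->
    dv (u n ^~ j) s (n%:R ^+ 2 * (u n s j.+1 + u n s j.-1 - 2 * u n s j)).
  move=> /andP[j0 _].
  have hd := dvD (dvc rho s) (@heat_equation R n (deviation n) s j j0).
  apply: (@dv_eq R (u n ^~ j) _ _ _ hd).
  by rewrite /u /density_profile; ring.
have uleft s : u n s 0%N = rho by rewrite /u /density_profile heat_0 addr0.
have uright s : u n s m.+3 = rho by rewrite /u /density_profile heat_n// addr0.
have u_0 j : (j <= n)%N -> u n 0 j = clamped u0 (j%:R / n%:R).
  move=> hj; rewrite /u /density_profile heat_initial ?deviation0 ?deviation_n//.
  by rewrite /deviation addrC subrK.
have n2 : 0 <= n%:R ^+ 2 :> R by exact: sqr_ge0.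
have L0 := lsi_gt0.
have H := @tv_relaxation R rho m (u n) eps M (M ^+ 2) relax_rate eps0 (sqr_ge0 _) uleft uright uheat.
apply: H => //.
- move=> s j s0 hj.
  apply: (@heat_bound R m _ eps (1 - eps) (u n) n2 (fun s j _ => uheat s j)) => //.
  + by move=> r _; rewrite uleft.
  + by move=> r _; rewrite uright.
  + by move=> i /andP[_ hi]; rewrite u_0// leqW.
- move=> s k s0 hk; rewrite mulrC -ler_pdivlMr ?ltr0n//.
  apply: (@heat_gradient_bound R m _ rho rho (M / n%:R) (u n) n2 (fun s j _ => uheat s j)) => //.
  move=> i hi; rewrite !u_0//; last exact: leqW.
  have := @deviation_grad n i isT; rewrite mulrC -ler_pdivlMr ?ltr0n//.
  by rewrite /deviation opprB addrA subrK.
- move=> s s0.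
  rewrite (eq_bigr (fun k => (heat n (deviation n) s k.+1 - heat n (deviation n) s k) ^+ 2)); last first.
    by move=> k _; rewrite /u /density_profile; congr (_ ^+ 2); ring.
  apply: le_trans (heat_energy_decay (n := m.+3) isT (deviation0 _) (deviation_n (isT : (0 < m.+3)%N)) s0) _.
  apply: ler_pM; rewrite ?expR_ge0 ?deviation_energy//.
    by rewrite mulr_ge0// sumr_ge0// => k _; exact: sqr_ge0.
  rewrite ler_expR !mulNr lerN2 ler_wpM2r//.
  have h1 : relax_rate <= 1 by rewrite ge_min lexx.
  by have := sine_eigenvalue1_ge1 R m; rewrite -/n; lra.
- have h1 : relax_rate <= (2 * lsi_constant eps M)^-1 by rewrite ge_min lexx orbT.
  have L2 : 0 < 2 * lsi_constant eps M by exact: mulr_gt0.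
  rewrite (_ : 2 * relax_rate * lsi_constant eps M = relax_rate * (2 * lsi_constant eps M)); last by ring.
  by rewrite -ler_pdivlMr// div1r.
Qed.

End FixedSize.

(** * Asymptotics at the cutoff time *)

Section EigenvalueAsymptotics.
Context {R : realType}.
Variables (l0 : nat) (b : R).
Hypothesis hl0 : (0 < l0)%N.
Local Notation P2 := (pi ^+ 2 * l0%:R ^+ 2 : R).
Local Notation t_ := (cutoff_time l0 b).

Let l0_gt0 : 0 < l0%:R :> R. Proof. by rewrite ltr0n. Qed.
Let P2_gt0 : 0 < P2. Proof. by rewrite mulr_gt0// exprn_gt0// pi_gt0. Qed.

Lemma sine_eigenvalue_bounds (n l : nat) : (0 < n)%N ->
  pi ^+ 2 * l%:R ^+ 2 * (1 - pi ^+ 2 * l%:R ^+ 2 / (12 * n%:R ^+ 2)) <= (sine_eigenvalue n l : R)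
  <= pi ^+ 2 * l%:R ^+ 2.
Proof.
move=> n0; have N0 : 0 < n%:R :> R by rewrite ltr0n.
pose x : R := pi * l%:R / n%:R.
have x0 : 0 <= x by apply: divr_ge0 => //; apply: mulr_ge0 => //; exact: pi_ge0.
have N2 : 0 <= 2 * n%:R ^+ 2 :> R by rewrite mulr_ge0// sqr_ge0.
have e : pi ^+ 2 * l%:R ^+ 2 = 2 * n%:R ^+ 2 * (x ^+ 2 / 2) :> R.
  by rewrite /x; field; rewrite gt_eqF.
apply/andP; split; rewrite /sine_eigenvalue -/x.
- have -> : pi ^+ 2 * l%:R ^+ 2 * (1 - pi ^+ 2 * l%:R ^+ 2 / (12 * n%:R ^+ 2)) =
    2 * n%:R ^+ 2 * (x ^+ 2 / 2 - x ^+ 4 / 24) :> R.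
    by rewrite /x; field; rewrite gt_eqF.
  by rewrite ler_wpM2l//; have := cos_le x0; lra.
- by rewrite e ler_wpM2l//; have := cos_ge x0; lra.
Qed.

Lemma cvg_ln_nat : ln (n%:R : R) @[n --> \oo] --> +oo.
Proof.
apply/cvgryPge => A; near=> n.
have h : expR A <= n%:R by near: n; exact: nbhs_infty_ger.
have h0 : 0 < n%:R :> R by apply: lt_le_trans h; exact: expR_gt0.
by rewrite -[leLHS]expRK ler_ln ?posrE ?expR_gt0.
Unshelve. all: by end_near. Qed.

Lemma cutoff_timeE (n : nat) : t_ n = (ln n%:R + 2 * b) / (2 * P2).
Proof.
rewrite /cutoff_time; move: (@pi R) (@pi_gt0 R) => p p0; field.
by rewrite !gt_eqF.
Qed.

Lemma cvg_cutoff_time : t_ n @[n --> \oo] --> +oo.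
Proof.
have -> : t_ = fun n => (ln n%:R + 2 * b) / (2 * P2).
  by apply/funext => n; exact: cutoff_timeE.
have h0 : 0 < (2 * P2)^-1 by rewrite invr_gt0 mulr_gt0.
apply: (cvg_comp (fun n : nat => ln (n%:R : R)) (fun x => (x + 2 * b) / (2 * P2)) cvg_ln_nat).
exact: gt0_cvgMly h0 (cvg_addrr _).
Qed.

(** The cutoff time makes 2 pi^2 l0^2 t equal to ln n + 2 b. The lattice eigenvalue has relative
    error O(1/n^2), too small to matter against ln n. *)
Lemma cvg_mode_l0 :
  n%:R * expR (- sine_eigenvalue n l0 * t_ n) ^+ 2 @[n --> \oo] --> (expR (- (2 * b)) : R).
Proof.
pose X (n : nat) : R := ln n%:R - 2 * sine_eigenvalue n l0 * t_ n.
have hX : X n @[n --> \oo] --> - (2 * b).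
  apply/cvgrPdist_le => /= e e0.
  pose K : R := P2 * (1 + 2 * `|b|) / 12.
  near=> n.
  have n0 : (0 < n)%N by near: n; exact: nbhs_infty_gt.
  have N0 : 0 < n%:R :> R by rewrite ltr0n.
  have N1 : 1 <= n%:R :> R by rewrite ler1n.
  have hK : K / e <= n%:R by near: n; exact: nbhs_infty_ger.
  have /andP[h1 h2] := @sine_eigenvalue_bounds n l0 n0.
  have -> : - (2 * b) - X n = - ((ln n%:R + 2 * b) * (1 - sine_eigenvalue n l0 / P2)).
    rewrite /X cutoff_timeE; move: (sine_eigenvalue n l0) (@pi R) (@pi_gt0 R) => z p p0.
    by field; rewrite !gt_eqF.
  have r0 : 0 <= 1 - sine_eigenvalue n l0 / P2.
    by rewrite subr_ge0 ler_pdivrMr// mul1r.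
  have r1 : 1 - sine_eigenvalue n l0 / P2 <= P2 / (12 * n%:R ^+ 2).
    have : 1 - P2 / (12 * n%:R ^+ 2) <= sine_eigenvalue n l0 / P2.
      by rewrite ler_pdivlMr// mulrC.
    lra.
  rewrite normrN normrM [`|1 - _|]ger0_norm//.
  have hl : `|ln n%:R + 2 * b| <= n%:R * (1 + 2 * `|b|).
    apply: le_trans (ler_normD _ _) _.
    rewrite ger0_norm; last exact: ln_ge0.
    rewrite normrM [`|2|]ger0_norm// mulrDr mulr1; apply: lerD.
      exact: ltW (ln_sublinear N0).
    by rewrite ler_peMl// mulr_ge0.
  apply: le_trans (ler_pM (normr_ge0 _) r0 hl r1) _.
  rewrite (_ : n%:R * (1 + 2 * `|b|) * (P2 / (12 * n%:R ^+ 2)) = K / n%:R); last first.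
    by rewrite /K; field; rewrite gt_eqF.
  by rewrite ler_pdivrMr// mulrC -ler_pdivrMr.
have -> : (fun n : nat => n%:R * expR (- sine_eigenvalue n l0 * t_ n) ^+ 2 : R) =
          (fun n => if n == 0%N then 0 else expR (X n)).
  apply/funext => n; case: eqP => [->|/eqP]; first by rewrite mul0r.
  rewrite -lt0n => n0; rewrite /X expRD lnK ?posrE ?ltr0n//; congr (_ * _).
  by rewrite -expRM_natl; congr expR; ring.
have hE : expR (X n) @[n --> \oo] --> (expR (- (2 * b)) : R).
  exact: continuous_cvg (@continuous_expR R _) hX.
apply: cvg_trans hE; apply: near_eq_cvg; near=> n.
have n0 : (0 < n)%N by near: n; exact: nbhs_infty_gt.
by rewrite gtn_eqF.
Unshelve. all: by end_near. Qed.

(** Eventually the eigenvalue at [l0.+1] is at least 1 + 1/l0 times pi^2 l0^2, which leaves a decay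
    of order n^(-1/l0). *)
Lemma cvg_mode_gt_l0 :
  n%:R * expR (- sine_eigenvalue n l0.+1 * t_ n) ^+ 2 @[n --> \oo] --> (0 : R).
Proof.
pose k : R := l0%:R^-1.
have k0 : 0 < k by rewrite invr_gt0.
pose Y (n : nat) : R := expR (- (2 * b * (1 + k))) * expR (- (k * ln n%:R)).
have hY : Y n @[n --> \oo] --> (0 : R).
  rewrite -[X in _ --> X](mulr0 (expR (- (2 * b * (1 + k))))).
  have h1 : (k * ln (n%:R : R)) @[n --> \oo] --> +oo.
    by apply: (cvg_comp (fun n : nat => ln (n%:R : R)) (fun x => k * x) cvg_ln_nat);
      apply: gt0_cvgMry.
  have h2 : expR (- (k * ln (n%:R : R))) @[n --> \oo] --> (0 : R).
    exact: (cvg_comp _ _ h1 (@cvgr_expR R)).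
  exact: cvgM (cvg_cst _) h2.
have /cvgryPge /(_ (- (2 * b))) hev := @cvg_ln_nat.
apply: (@squeeze_cvgr _ _ _ _ (fun=> 0) Y) hY; last exact: cvg_cst.
near=> n.
have n0 : (0 < n)%N by near: n; exact: nbhs_infty_gt.
have N0 : 0 < n%:R :> R by rewrite ltr0n.
have N1 : 1 <= n%:R :> R by rewrite ler1n.
rewrite mulr_ge0 ?sqr_ge0//=.
have hln : 0 <= ln n%:R + 2 * b.
  have : - (2 * b) <= ln n%:R by near: n; exact: hev.
  lra.
pose C : R := pi ^+ 2 * l0.+1%:R ^+ 2 / 12.
have hC : C * (1 + k) / k <= n%:R by near: n; exact: nbhs_infty_ger.
have /andP[h1 _] := @sine_eigenvalue_bounds n l0.+1 n0.
have kS : l0.+1%:R = l0%:R * (1 + k) by rewrite -natr1 mulrDr mulr1 divff// gt_eqF.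
have hr : P2 * (1 + k) <= sine_eigenvalue n l0.+1.
  apply: le_trans h1.
  (* The exact ratio is (1 + k)^2; one factor 1 + k is given up to absorb the lattice correction, as
     1 - k / (1 + k) = 1 / (1 + k). *)
  have y1 : pi ^+ 2 * l0.+1%:R ^+ 2 / (12 * n%:R ^+ 2) <= k / (1 + k).
    have -> : pi ^+ 2 * l0.+1%:R ^+ 2 / (12 * n%:R ^+ 2) = C / n%:R / n%:R.
      by rewrite /C; field; rewrite gt_eqF.
    have C0 : 0 <= C by rewrite divr_ge0// mulr_ge0// sqr_ge0.
    apply: (@le_trans _ _ (C / n%:R)).
      by rewrite ler_pdivrMr// ler_peMr// divr_ge0// ltW.
    have k1 : 0 < 1 + k by lra.
    rewrite ler_pdivrMr// mulrAC ler_pdivlMr//.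
    by move: hC; rewrite ler_pdivrMr// [leRHS]mulrC.
  set Yt : R := pi ^+ 2 * l0.+1%:R ^+ 2 / (12 * n%:R ^+ 2) in y1 *.
  rewrite kS (_ : _ * (1 - Yt) = P2 * ((1 + k) ^+ 2 * (1 - Yt))); last by ring.
  apply: ler_wpM2l; first exact: ltW.
  have k1 : 0 < 1 + k by lra.
  have : (1 + k) ^+ 2 * (1 - k / (1 + k)) <= (1 + k) ^+ 2 * (1 - Yt).
    by rewrite ler_wpM2l ?sqr_ge0//; lra.
  apply: le_trans; rewrite le_eqVlt; apply/orP; left; apply/eqP; field.
  by rewrite gt_eqF.
have -> : n%:R * expR (- sine_eigenvalue n l0.+1 * t_ n) ^+ 2 =
   expR (ln n%:R - (ln n%:R + 2 * b) * (sine_eigenvalue n l0.+1 / P2)) :> R.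
  rewrite expRD lnK ?posrE//; congr (_ * _); rewrite -expRM_natl; congr expR.
  rewrite cutoff_timeE; move: (sine_eigenvalue n l0.+1) (@pi R) (@pi_gt0 R) => z p p0.
  by field; rewrite !gt_eqF.
rewrite /Y -expRD ler_expR.
have h2 : 1 + k <= sine_eigenvalue n l0.+1 / P2 by rewrite ler_pdivlMr// mulrC.
have := ler_wpM2l hln h2; lra.
Unshelve. all: by end_near. Qed.

End EigenvalueAsymptotics.

Section Asymptotics.
Context {R : realType}.
Variables (rho : R) (u0 : R -> R) (M eps : R).
Hypothesis M0 : 0 <= M.
Hypothesis eps0 : 0 < eps.
Hypothesis u0_cont : continuous (clamped u0).
Hypothesis u0_lip : forall x y, `|clamped u0 x - clamped u0 y| <= M * `|x - y|.
Hypothesis u0_eps : forall x, eps <= clamped u0 x <= 1 - eps.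
Hypothesis u0_left : u0 0 = rho.
Hypothesis u0_right : u0 1 = rho.
Variables (l0 : nat) (b : R).
Hypothesis hl0 : (0 < l0)%N.
Hypothesis hl0_min : forall l : nat, (0 < l < l0)%N -> coef rho u0 l = 0.

Definition mode (l : nat) (x : R) : R := (clamped u0 x - rho) * sin (pi * l%:R * x).

Definition mode_integral l : R := \int[lebesgue_measure]_(x in `[0, 1]) mode l x.

Definition mode_sum n l : R := n%:R^-1 * \sum_(0 <= j < n) mode l (j%:R / n%:R).

Lemma coefE l : coef rho u0 l = Num.sqrt 2 * mode_integral l.
Proof.
rewrite /coef; congr (_ * _); apply: eq_Rintegral => x.
by rewrite inE /= in_itv /= => hx; rewrite /mode /clamped clamp01_id.
Qed.

Let deviation_bound x : `|clamped u0 x - rho| <= 1.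
Proof.
have h0 : clamped u0 0 = rho by rewrite /clamped clamp01_id ?lexx ?ler01.
have /andP[h1 h2] := u0_eps x; have /andP[h3 h4] := u0_eps 0; rewrite h0 in h3 h4.
have e0 := eps0.
by rewrite ler_norml; apply/andP; split; lra.
Qed.

Let dv_sin_mode (l : nat) (x : R) :
  dv (fun y => sin (pi * l%:R * y)) x (cos (pi * l%:R * x) * (pi * l%:R * 1)).
Proof.
exact: (dv_comp (f := sin) (g := fun y => pi * l%:R * y) (is_derive_sin _) (dvZ (pi * l%:R) (dvid x))).
Qed.

Lemma mode_continuous l : continuous (mode l).
Proof.
move=> x; apply: cvgM; last exact: dv_continuous (dv_sin_mode l x).
by apply: cvgB; [exact: u0_cont | exact: cvg_cst].
Qed.

Lemma sin_mode_lip (l : nat) (x y : R) :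
  `|sin (pi * l%:R * x) - sin (pi * l%:R * y)| <= pi * l%:R * `|x - y|.
Proof.
wlog xy : x y / y <= x.
  move=> H; have [h|/ltW h] := leP y x; first exact: H.
  by rewrite distrC [`|x - y|]distrC; exact: H.
rewrite [`|x - y|]ger0_norm ?subr_ge0//.
apply: (mvt_lip xy (fun z _ => dv_sin_mode l z)) => z _.
have pl : 0 <= pi * l%:R :> R by apply: mulr_ge0 => //; exact: pi_ge0.
by rewrite mulr1 normrM [`|pi * _|]ger0_norm// ler_piMl// cos_max.
Qed.

Lemma mode_lip (l : nat) (x y : R) :
  `|mode l x - mode l y| <= (M + pi * l%:R) * `|x - y|.
Proof.
rewrite [X in `|X|](_ : _ = (clamped u0 x - clamped u0 y) * sin (pi * l%:R * x) +
  (clamped u0 y - rho) * (sin (pi * l%:R * x) - sin (pi * l%:R * y))); last first.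
  by rewrite /mode; ring.
apply: le_trans (ler_normD _ _) _; rewrite !normrM [leRHS]mulrDl; apply: lerD.
- by rewrite -[leRHS]mulr1; apply: ler_pM => //; exact: sin_max.
- by rewrite -[leRHS]mul1r; apply: ler_pM => //; exact: sin_mode_lip.
Qed.

Lemma mode_sum_near n l : (0 < n)%N ->
  `|mode_sum n l - mode_integral l| <= (M + pi * l%:R) / n%:R.
Proof.
by move=> n0; apply: riemann_sum => // [|x y _ _]; [exact: mode_continuous | exact: mode_lip].
Qed.

Lemma sine_coefE n l : (0 < n)%N ->
  sine_coef n (deviation rho u0 n) l = 2 * mode_sum n l.
Proof.
move=> n0; rewrite /sine_coef /mode_sum -mulrA; congr (_ * (_ * _)).
rewrite [RHS]big_ltn//.
have -> : mode l (0%:R / n%:R) = 0 by rewrite /mode mul0r mulr0 sin0 mulr0.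
by rewrite add0r.
Qed.

Let A : R := M + pi * l0%:R.
Let A0 : 0 <= A. Proof. by apply: addr_ge0 => //; apply: mulr_ge0 => //; exact: pi_ge0. Qed.

(** The continuum coefficient vanishes, so only the Riemann sum error is left; its square times [n]
    is still O(1/n), even without any decay in time. *)
Lemma low_mode n l : (0 < n)%N -> (0 < l < l0)%N -> mode_sum n l ^+ 2 <= (A / n%:R) ^+ 2.
Proof.
move=> n0 hl; have h := mode_sum_near l n0.
have : mode_integral l = 0.
  have := hl0_min hl; rewrite coefE => /eqP; rewrite mulf_eq0 gt_eqF ?sqrtr_gt0//=.
  by move=> /eqP.
move=> e; rewrite e subr0 in h.
have N0 : 0 < n%:R :> R by rewrite ltr0n.
rewrite -real_normK ?num_real// lerXn2r ?nnegrE ?divr_ge0//.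
apply: le_trans h _; rewrite ler_wpM2r ?invr_ge0 ?ler0n// /A lerD2l ler_wpM2l ?pi_ge0//.
by rewrite ler_nat ltnW//; case/andP: hl.
Qed.

Definition heat_norm n (t : R) : R :=
  \sum_(1 <= j < n) heat n (deviation rho u0 n) t j ^+ 2.

(** Modes below [l0] are bounded by [low_mode]. Those above decay at least as fast as mode [l0.+1],
    and Parseval bounds the sum of all squared coefficients by 2. *)
Lemma heat_norm_near n (t : R) : (l0.+1 < n)%N -> 0 <= t ->
  `|heat_norm n t - 2 * mode_sum n l0 ^+ 2 * (n%:R * expR (- sine_eigenvalue n l0 * t) ^+ 2)|
  <= 2 * l0%:R * A ^+ 2 / n%:R + n%:R * expR (- sine_eigenvalue n l0.+1 * t) ^+ 2.
Proof.
move=> ln t0.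
have n0 : (0 < n)%N by exact: leq_ltn_trans ln.
have N0 : 0 < n%:R :> R by rewrite ltr0n.
pose w l : R := n%:R / 2 * (sine_coef n (deviation rho u0 n) l * expR (- sine_eigenvalue n l * t)) ^+ 2.
have w0 l : 0 <= w l by rewrite mulr_ge0 ?sqr_ge0// divr_ge0.
have -> : heat_norm n t = \sum_(1 <= l < n) w l by rewrite /heat_norm heat_sqr_sum// mulr_sumr.
have wE : w l0 = 2 * mode_sum n l0 ^+ 2 * (n%:R * expR (- sine_eigenvalue n l0 * t) ^+ 2).
  by rewrite /w sine_coefE//; field.
rewrite -wE (@big_cat_nat _ _ _ l0)//=; last exact: ltnW (ltnW ln).
rewrite [\sum_(l0 <= _ < n) _]big_ltn; last exact: ltnW.
rewrite addrCA [w l0 + _]addrC addrK.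
have e1 l : expR (- sine_eigenvalue n l * t) ^+ 2 <= 1 :> R.
  rewrite expr_le1// ?expR_ge0// -expR0 ler_expR mulNr oppr_le0 mulr_ge0//.
  exact: sine_eigenvalue_ge0.
rewrite ger0_norm; last by rewrite addr_ge0// sumr_ge0.
apply: lerD.
- apply: (@le_trans _ _ (\sum_(1 <= l < l0) (2 * A ^+ 2 / n%:R))).
    rewrite big_nat [leRHS]big_nat; apply: ler_sum => l hl.
    have h1 := low_mode n0 hl.
    rewrite /w sine_coefE// exprMn (exprMn _ 2).
    have -> : 2 * A ^+ 2 / n%:R = n%:R / 2 * (2 ^+ 2 * (A / n%:R) ^+ 2 * 1).
      by field; rewrite gt_eqF.
    apply: ler_wpM2l; first by rewrite divr_ge0.
    apply: ler_pM; [by apply: mulr_ge0; exact: sqr_ge0 | exact: sqr_ge0 | | exact: e1].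
    by rewrite ler_wpM2l// sqr_ge0.
  rewrite big_const_nat iter_addr_0 -[leLHS]mulr_natl.
  rewrite (_ : 2 * l0%:R * A ^+ 2 / n%:R = l0%:R * (2 * A ^+ 2 / n%:R)); last by ring.
  apply: ler_wpM2r; first by rewrite divr_ge0// mulr_ge0// sqr_ge0.
  by rewrite ler_nat leq_subr.
- set E := expR (- sine_eigenvalue n l0.+1 * t).
  apply: (@le_trans _ _ (\sum_(l0.+1 <= l < n) (n%:R / 2 * E ^+ 2 * sine_coef n (deviation rho u0 n) l ^+ 2))).
    rewrite big_nat [leRHS]big_nat; apply: ler_sum => l /andP[h1 h2].
    rewrite /w exprMn mulrCA [leRHS]mulrC; apply: ler_wpM2l; first exact: sqr_ge0.
    apply: ler_wpM2l; first by rewrite divr_ge0.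
    rewrite lerXn2r ?nnegrE ?expR_ge0// ler_expR !mulNr lerN2 ler_wpM2r//.
    by apply: sine_eigenvalue_le => //; exact: ltnW.
  rewrite -mulr_sumr.
  have hs : \sum_(l0.+1 <= l < n) sine_coef n (deviation rho u0 n) l ^+ 2 <= 2.
    apply: (@le_trans _ _ (\sum_(1 <= l < n) sine_coef n (deviation rho u0 n) l ^+ 2)).
      rewrite [leRHS](@big_cat_nat _ _ _ l0.+1)//=; last exact: ltnW.
      by rewrite lerDr sumr_ge0// => l _; exact: sqr_ge0.
    rewrite sine_coef_sqr_sum ?deviation0 ?deviation_n//.
    apply: (@le_trans _ _ (2 / n%:R * n%:R)); last by rewrite divfK// gt_eqF.
    apply: ler_wpM2l; first by rewrite divr_ge0.
    apply: (@le_trans _ _ (\sum_(1 <= j < n) 1)).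
      apply: ler_sum => j _; rewrite -real_normK ?num_real// expr_le1//.
      exact: deviation_bound.
    by rewrite big_const_nat iter_addr_0 ler_nat leq_subr.
  apply: (@le_trans _ _ (n%:R / 2 * E ^+ 2 * 2)).
    by apply: ler_wpM2l => //; rewrite mulr_ge0 ?sqr_ge0// divr_ge0.
  by rewrite le_eqVlt; apply/orP; left; apply/eqP; field.
Qed.

Local Notation t_ := (cutoff_time l0 b).

Lemma cvg_inv_nat (c : R) : c / n%:R @[n --> \oo] --> (0 : R).
Proof.
apply/cvgrPdist_le => /= e e0; near=> n.
have n0 : (0 < n)%N by near: n; exact: nbhs_infty_gt.
have N0 : 0 < n%:R :> R by rewrite ltr0n.
rewrite sub0r normrN normrM [`|n%:R^-1|]gtr0_norm ?invr_gt0//.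
rewrite ler_pdivrMr// [leRHS]mulrC -ler_pdivrMr//.
by near: n; exact: nbhs_infty_ger.
Unshelve. all: by end_near. Qed.

Lemma cvg_heat_norm :
  heat_norm n (t_ n) @[n --> \oo] --> coef rho u0 l0 ^+ 2 * expR (- (2 * b)).
Proof.
have h1 := @cvg_mode_l0 R l0 b hl0.
have h2 := @cvg_mode_gt_l0 R l0 b hl0.
have h3 : mode_sum n l0 @[n --> \oo] --> mode_integral l0.
  apply/cvgrPdist_le => /= e e0; near=> n.
  have n0 : (0 < n)%N by near: n; exact: nbhs_infty_gt.
  have N0 : 0 < n%:R :> R by rewrite ltr0n.
  rewrite distrC; apply: le_trans (mode_sum_near l0 n0) _.
  rewrite ler_pdivrMr// [leRHS]mulrC -ler_pdivrMr//.
  by near: n; exact: nbhs_infty_ger.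
pose main n : R := 2 * mode_sum n l0 ^+ 2 * (n%:R * expR (- sine_eigenvalue n l0 * t_ n) ^+ 2).
have hm : main n @[n --> \oo] --> coef rho u0 l0 ^+ 2 * expR (- (2 * b)).
  rewrite coefE exprMn sqr_sqrtr//.
  have h4 := cvgM (cvgM (cvg_cst (2 : R)) (cvgM h3 h3)) h1.
  exact: h4.
pose err n : R := 2 * l0%:R * A ^+ 2 / n%:R + n%:R * expR (- sine_eigenvalue n l0.+1 * t_ n) ^+ 2.
have he : err n @[n --> \oo] --> (0 : R).
  rewrite -[X in _ --> X](addr0 0); exact: cvgD (cvg_inv_nat _) h2.
have hp : main n + err n @[n --> \oo] --> coef rho u0 l0 ^+ 2 * expR (- (2 * b)).
  rewrite -[X in _ --> X]addr0; exact: cvgD hm he.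
have hn : main n - err n @[n --> \oo] --> coef rho u0 l0 ^+ 2 * expR (- (2 * b)).
  rewrite -[X in _ --> X]subr0; exact: cvgB hm he.
apply: (squeeze_cvgr _ hn hp).
have ht := @cvg_cutoff_time R l0 b hl0.
have /cvgryPge /(_ 0) ht0 := ht.
near=> n.
have ln : (l0.+1 < n)%N by near: n; exact: nbhs_infty_gt.
have t0 : 0 <= t_ n by near: n; exact: ht0.
have := heat_norm_near ln t0; rewrite -/(main n) -/(err n) ler_norml => /andP[? ?].
by apply/andP; split; lra.
Unshelve. all: by end_near. Qed.

End Asymptotics.

Lemma G_call (R : realType) (m : R) : 0 <= m -> G m = call m 1.
Proof.
move=> m0; rewrite G_normal_cdf// /call ln1 mul0r add0r mul1r.
by rewrite sub0r.
Qed.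

Theorem theorem2p1 (R : realType) (rho : R) (hrho : 0 < rho < 1)
  (u0 : R -> R)
  (hu0_range : forall x, x \in `[0, 1] -> 0 <= u0 x <= 1)
  (hu0_diff : bounded_derivative01 u0)
  (hu0_left : u0 0 = rho) (hu0_right : u0 1 = rho)
  (hu0_open : forall x, x \in `[0, 1] -> 0 < u0 x < 1)
  (l0 : nat) (hl0_pos : (0 < l0)%N)
  (hl0_nz : coef rho u0 l0 != 0)
  (hl0_min : forall l : nat, (0 < l < l0)%N -> coef rho u0 l = 0)
  (b : R) :
  D rho u0 n (cutoff_time l0 b n) @[n --> \oo]
    --> G (`|coef rho u0 l0| / Num.sqrt (rho * (1 - rho)) * expR (- b)).
Proof.
have [M M0 lip] := profile_lipschitz hu0_diff.
have [eps eps0 margin] := profile_margin hu0_diff hu0_open.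
have cont : continuous (clamped u0) by move=> x; exact: clamped_continuous.
have /andP[r0 r1] := hrho.
pose chi := rho * (1 - rho).
have chi0 : 0 < chi by rewrite mulr_gt0// subr_gt0.
set m := _ / _ * _.
have m0 : 0 < m by rewrite mulr_gt0 ?expR_gt0// divr_gt0 ?normr_gt0// sqrtr_gt0.
rewrite G_call; last exact: ltW.
have ht := @cvg_cutoff_time R l0 b hl0_pos.
pose t_ n : R := cutoff_time l0 b n.
pose Q n : R := heat_norm rho u0 n (t_ n) / chi.
have hQ : Num.sqrt (Q n) @[n --> \oo] --> m.
  have h := @cvg_heat_norm R rho u0 M eps M0 eps0 cont lip margin hu0_left hu0_right l0 b hl0_pos hl0_min.
  have -> : m = Num.sqrt (coef rho u0 l0 ^+ 2 * expR (- (2 * b)) / chi).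
    rewrite -[LHS](gtr0_norm m0) -sqrtr_sqr; congr Num.sqrt.
    rewrite /m exprMn (exprMn _ `|_|) real_normK ?num_real// exprVn sqr_sqrtr; last exact: ltW.
    by rewrite -expRM_natl mulrN mulrAC.
  apply: continuous_cvg; first exact: sqrt_continuous.
  exact: cvgM h (cvg_cst _).
have hexp (k : R) : 0 < k -> expR (- (k * t_ n)) @[n --> \oo] --> (0 : R).
  move=> k0; have h1 : (k * t_ n) @[n --> \oo] --> +oo.
    by apply: (cvg_comp t_ (fun x => k * x) ht); apply: gt0_cvgMry.
  exact: (cvg_comp _ _ h1 (@cvgr_expR R)).
pose r := relax_rate M eps.
pose K := 2 * lsi_constant eps M * (M ^+ 2 / eps ^+ 4 * M ^+ 2).
have hE1 : Num.sqrt (K * expR (- r * t_ n)) @[n --> \oo] --> (0 : R).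
  rewrite -[X in _ --> X]sqrtr0; apply: continuous_cvg; first exact: sqrt_continuous.
  rewrite -[X in _ --> X](mulr0 K); apply: cvgM; first exact: cvg_cst.
  by under eq_cvg do rewrite mulNr; apply: hexp; exact: relax_rate_gt0.
have hV : M * expR (- t_ n) @[n --> \oo] --> (0 : R).
  rewrite -[X in _ --> X](mulr0 M); apply: cvgM; first exact: cvg_cst.
  by have := hexp _ ltr01; under eq_cvg do rewrite mul1r.
pose c0 : R := normal_peak 1.
have c00 : 0 <= c0 by exact: normal_peak_ge0.
apply/cvgrPdist_le => /= e e0.
(* The smoothing volatility is fixed before [n] grows, small enough for its two costs in [tv_call]
   to use at most half of [e]. *)
pose s := e / (4 * (c0 + 1)).
have s0 : 0 < s by rewrite divr_gt0// mulr_gt0// ltr_wpDl.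
have hs : c0 * (s + s) <= e / 2.
  rewrite (_ : c0 * (s + s) = e / 2 * (c0 / (c0 + 1))); last by rewrite /s; field; rewrite gt_eqF// ltr_wpDl.
  by rewrite ler_piMr ?divr_ge0 ?(ltW e0)// ler_pdivrMr ?ltr_wpDl// mul1r lerDl.
have herr : Num.sqrt (K * expR (- r * t_ n)) + c0 * `|Num.sqrt (Q n) - m| +
    lindeberg_rate rho s * (Num.sqrt (Q n) ^+ 2 * (M * expR (- t_ n))) @[n --> \oo] --> (0 : R).
  have h1 : `|Num.sqrt (Q n) - m| @[n --> \oo] --> (0 : R).
    rewrite -[X in _ --> X](normr0 R) -(subrr m).
    by apply: cvg_norm; apply: cvgB => //; exact: cvg_cst.
  have h2 : lindeberg_rate rho s * (Num.sqrt (Q n) ^+ 2 * (M * expR (- t_ n))) @[n --> \oo] -->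
      lindeberg_rate rho s * (m * m * 0).
    by apply: cvgM; [exact: cvg_cst | apply: cvgM hV; exact: cvgM].
  have h3 : c0 * `|Num.sqrt (Q n) - m| @[n --> \oo] --> c0 * 0 by apply: cvgM h1; exact: cvg_cst.
  by have := cvgD (cvgD hE1 h3) h2; rewrite !mulr0 !addr0; exact.
have e20 : 0 < e / 2 by rewrite divr_gt0.
have /cvgrPdist_le/(_ _ e20) ev1 := herr.
have /cvgryPge /(_ 0) ev2 := ht.
(* Threshold below which the uniform bound on the deviations meets the smallness hypotheses of
   [tv_call]. *)
have rmin0 : 0 < Num.min rho (1 - rho) / 2 by rewrite divr_gt0// lt_min r0 subr_gt0.
have /cvgrPdist_le/(_ _ rmin0) ev3 := hV.
near=> n.
have n3 : (2 < n)%N by near: n; exact: nbhs_infty_gt.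
have E1 : `|0 - (Num.sqrt (K * expR (- r * t_ n)) + c0 * `|Num.sqrt (Q n) - m| +
    lindeberg_rate rho s * (Num.sqrt (Q n) ^+ 2 * (M * expR (- t_ n))))| <= e / 2 by near: n; exact: ev1.
have t0 : 0 <= t_ n by near: n; exact: ev2.
have E3 : `|0 - M * expR (- t_ n)| <= Num.min rho (1 - rho) / 2 by near: n; exact: ev3.
have qE : Q n = Num.sqrt (Q n) ^+ 2.
  by rewrite sqr_sqrtr// divr_ge0 ?(ltW chi0)// sumr_ge0// => j _; exact: sqr_ge0.
(* The fixed-size estimates are stated at sizes [m.+3]; smaller [n] are discarded by the limit. *)
have nE : n = (n - 3).+3 by rewrite -addn3 subnK.
move: E1 t0 E3 qE; rewrite nE; move: (n - 3)%N => k E1 t0 E3 qE.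
set N := k.+3 in E1 t0 E3 qE *.
have H1 := D_near_product M0 eps0 lip margin hu0_left hu0_right k t0.
pose v (x : Lambda N) : R := heat N (deviation rho u0 N) (t_ N) (site x).
have hv x : `|v x| <= M * expR (- t_ N).
  apply: (heat_max_le M0 lip hu0_left hu0_right t0).
  by case/andP: (site_range x) => _ /leqW.
have hmin : M * expR (- t_ N) <= Num.min rho (1 - rho) / 2.
  by move: E3; rewrite sub0r normrN ger0_norm// mulr_ge0// expR_ge0.
have hv1 x : 2 * `|v x| <= rho.
  have h : Num.min rho (1 - rho) <= rho by rewrite ge_min lexx.
  by have := hv x; lra.
have hv2 x : 2 * `|v x| <= 1 - rho.
  have h : Num.min rho (1 - rho) <= 1 - rho by rewrite ge_min lexx orbT.
  by have := hv x; lra.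
have hQs : Q N = \sum_x v x ^+ 2 / chi.
  rewrite -mulr_suml /Q /heat_norm big_sites; congr (_ / _); apply: eq_big_nat => j hj.
  by rewrite /v pos_site.
have H2 := tv_call hrho hv1 hv2 s0 m0 hQs hv.
rewrite -qE in E1; rewrite -/chi -/c0 in H2; rewrite -/K -/r in H1.
set p := tv_fin _ _ in H1; rewrite -/p in H2.
move: E1; rewrite sub0r normrN => /(le_trans (ler_norm _)) E1.
rewrite (_ : call m 1 - _ = (call m 1 - p) - (D rho u0 N (t_ N) - p)); last by ring.
apply: le_trans (ler_normB _ _) _; rewrite distrC.
apply: le_trans (lerD H2 H1) _.
lra.
Unshelve. all: by end_near. Qed.
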